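(* There is a universal constant $C$ such that the following holds for every $n\ge 1$. Let $E$ be a symmetric function space on $\Omega_n=\{-1,1\}^n$, and assume that either (i) $E$ is 2-concave with constant $1$, or (ii) $E$ is 2-convex with constant $1$ and $q$-concave with constant $1$ for some $q\ge 2$. Put $K_E=1$ in case (i) and $K_E=Cq$ in case (ii); if $E=L^q(\Omega_n)$ with $q>2$, one may even take $K_E=C\sqrt q$. Let $\varphi\in L^1([0,\frac{\pi}{2}],d\theta)$. Then for every function $f:\Omega_n\to\mathbb{C}$ $$\Big\Vert\int_0^{\pi/2}\varphi(\theta)\,\frac{d}{d\theta}\cos^{\Delta/4}\theta\,(f)\,d\theta\Big\Vert_E\le \frac12 K_E\,\big\Vert\,|\nabla f|\,\big\Vert_E\int_0^{\pi/2}|\varphi(\theta)|\,d\theta .$$ In particular, for every $f:\Omega_n\to\mathbb{C}$: 1. $\Vert f-\mathbb{E}f\Vert_E\le \frac{\pi}{4}K_E\,\big\Vert\,|\nabla f|\,\big\Vert_E$. 2. For $\theta_0\in[0,\frac{\pi}{2}[$, $\ \Vert f-\cos^{\Delta/4}\theta_0\,(f)\Vert_E\le\frac12\theta_0K_E\,\big\Vert\,|\nabla f|\,\big\Vert_E$. 3. For $0<\alpha<\frac12$, $\ \Vert\Delta^\alpha f\Vert_E\le K_\alpha K_E\,\big\Vert\,|\nabla f|\,\big\Vert_E$, where $K_\alpha=\frac{1}{\Gamma(1-\alpha)}\int_0^{\pi/2}(-\log\cos\theta)^{-\alpha}d\theta$. 4. Moreover, if $C_E$ is UMD, then $\Vert\Delta^{1/2}f\Vert_E\le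 H_EK_E\,\big\Vert\,|\nabla f|\,\big\Vert_E$, where $H_E$ is the finite constant defined by $\sqrt{2\pi}\,H_E=\Vert L_\varphi\otimes \mathrm{Id}_{C_E}\Vert_{L^2(\mathbb{R}/2\pi\mathbb{Z},C_E)\to L^2(\mathbb{R}/2\pi\mathbb{Z},C_E)}$ and $L_\varphi$ is here the convolution operator on $L^2(\mathbb{R}/2\pi\mathbb{Z})$ with kernel $\varphi(\theta)=\mathrm{p.v.}\,1_{[-\frac{\pi}{2},\frac{\pi}{2}]}(\theta)\,\mathrm{sgn}(\theta)\,(-\log\cos\theta)^{-1/2}$.
   Context: $\Omega_n=\{-1,1\}^n$ carries the uniform probability, with expectation $\mathbb{E}$; $L^p(\Omega_n)$ is taken with respect to it. A symmetric function space $E$ on $\Omega_n$ is the space of complex functions on $\Omega_n$ with a norm making it a Banach lattice ($|f|\le|g|$ implies $\Vert f\Vert_E\le\Vert g\Vert_E$) and with $\Vert f\circ\sigma\Vert_E=\Vert f\Vert_E$ for every permutation $\sigma$ of the set $\Omega_n$. $E$ is $p$-convex with constant $M$ if $\Vert(\sum_i|v_i|^p)^{1/p}\Vert_E\le M(\sum_i\Vert v_i\Vert_E^p)^{1/p}$, and $q$-concave with constant $M$ if $(\sum_i\Vert v_i\Vert_E^q)^{1/q}\le M\Vert(\sum_i|v_i|^q)^{1/q}\Vert_E$, for all finite families $(v_i)$ in $E$. For $x,y\in\Omega_n$, $xy$ is the coordinatewise product; $e_j\in\Omega_n$ has $-1$ in coordinate $j$ and $1$ elsewhere; $(\partial_jf)(x)=f(x)-f(xe_j)$;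 $|\nabla f|=(\sum_{j=1}^n|\partial_jf|^2)^{1/2}$ pointwise. Let $\omega_j$ be the $j$-th coordinate function, $\omega_A=\prod_{j\in A}\omega_j$ for $A\subset\{1,\dots,n\}$, $\omega_\emptyset=1$; every $f$ is written $f=\mathbb{E}f+\sum_{A\ne\emptyset}\hat f(A)\omega_A$. The discrete Laplacian is $\Delta=\sum_j\partial_j^2$ (with $\partial_j^2=\partial_j\circ\partial_j$ normalized by $\partial_j\omega_A=2\omega_A$ if $j\in A$, $0$ otherwise), so $\Delta\omega_A=4|A|\omega_A$; $\Delta^\alpha\omega_A=(4|A|)^\alpha\omega_A$ for $A\neq\emptyset$ and $\Delta^\alpha 1=0$; and $\cos^{\Delta/4}\theta\,(f)=\mathbb{E}f+\sum_{A\ne\emptyset}(\cos\theta)^{|A|}\hat f(A)\omega_A$. $C_E$ is the algebra $\mathcal{M}_{2^n}$ of complex $2^n\times2^n$ matrices with the norm $\Vert S\Vert_{C_E}=\Vert(s_k(S))_{1\le k\le 2^n}\Vert_E$, where $s_k(S)$ are the eigenvalues of $|S|=(S^*S)^{1/2}$ in decreasing order and $\Omega_n$ is identified with $\{1,\dots,2^n\}$ by any bijection. Convolution on $\mathbb{R}/2\pi\mathbb{Z}$ is with respect to $d\theta$: $L_\varphi g(x)=\mathrm{p.v.}\int\varphi(\theta)g(x-\theta)\,d\theta$. UMD is the usual unconditional martingale differences property of Banach spaces. *)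

(* Defs.v *)
(* MathComp and MathComp-Analysis, with R[i] the complex numbers over R. *)
From HB Require Import structures.
From mathcomp Require Import all_boot all_order all_algebra.
From mathcomp Require Import all_classical all_reals all_analysis.
From mathcomp Require Import perm sesquilinear spectral.
From mathcomp.real_closed Require Import complex.

Set Implicit Arguments.
Unset Strict Implicit.
Unset Printing Implicit Defensive.
Import Order.TTheory GRing.Theory Num.Theory.
Import numFieldNormedType.Exports.
Local Open Scope classical_set_scope.
Local Open Scope ring_scope.

Notation mu := lebesgue_measure.

Definition cabs (R : rcfType) (z : R[i]) : R := ComplexField.Normc.normc z.

Definition ofreal (R : realType) (x : R) : R[i] := real_complex R x.

(** * The discrete cube *)

(* {-1,1}^n is encoded multiplicatively: the bit [true] stands for -1 and
   [false] for 1, so the coordinatewise product is the bitwise xor. *)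
Definition cube (n : nat) := {ffun 'I_n -> bool}.

Definition cube_mul n (x y : cube n) : cube n := [ffun i => x i (+) y i].

Definition cube_e n (j : 'I_n) : cube n := [ffun i => i == j].

Section Cube.
Variables (R : realType) (n : nat).
Implicit Types (f : cube n -> R[i]) (A : {set 'I_n}) (x : cube n).

Definition coordinate (j : 'I_n) x : R[i] := (-1) ^+ (x j).

Definition walsh A x : R[i] := \prod_(j in A) coordinate j x.

Definition mean (F : fieldType) (g : cube n -> F) : F :=
  (\sum_x g x) / (2 ^ n)%:R.

Definition fourier f A : R[i] := mean (fun x => f x * walsh A x).

Definition partial (j : 'I_n) f : cube n -> R[i] :=
  fun x => f x - f (cube_mul x (cube_e j)).

Definition grad_abs f : cube n -> R :=
  fun x => Num.sqrt (\sum_(j < n) cabs (partial j f x) ^+ 2).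

Definition laplacian f : cube n -> R[i] :=
  fun x => \sum_(j < n) partial j (partial j f) x.

(* The Walsh functions are the eigenvectors of the Laplacian; this is the
   source of the factor 4 in [laplacian_pow] below. *)
Lemma partial_walsh j A x :
  partial j (walsh A) x = if j \in A then 2 * walsh A x else 0.
Proof.
rewrite /partial /walsh; case: ifPn => jA.
  rewrite (bigD1 j)//= [X in _ - X](bigD1 j)//=.
  rewrite [X in _ - _ * X](eq_bigr (fun i => coordinate i x)); last first.
    by move=> i /andP[_ /negPf ij]; rewrite /coordinate /cube_mul /cube_e !ffunE ij addbF.
  rewrite /coordinate /cube_mul /cube_e !ffunE eqxx addbT.
  set P := \prod_(_ | _) _.
  by case: (x j); rewrite /= ?expr0 ?expr1 !(mulN1r, mul1r) ?opprK mulr_natl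
     ?mulrN // mulr2n // opprD.
rewrite [X in _ - X](eq_bigr (fun i => coordinate i x)) ?subrr// => i iA.
rewrite /coordinate /cube_mul /cube_e !ffunE; case: eqP => [ij|]; last by rewrite addbF.
by rewrite -ij iA in jA.
Qed.

Lemma laplacian_walsh A x : laplacian (walsh A) x = (4 * #|A|)%:R * walsh A x.
Proof.
rewrite /laplacian (eq_bigr (fun j => if j \in A then 4 * walsh A x else 0)).
  by rewrite -big_mkcond sumr_const natrM -mulrnAl mulr_natr.
move=> j _; rewrite {1}/partial !partial_walsh.
case: ifPn => jA; last by rewrite subrr.
rewrite -mulrBr; have := partial_walsh j A x.
by rewrite jA /partial => ->; rewrite mulrA -natrM.
Qed.

Definition laplacian_pow (a : R) f : cube n -> R[i] := fun x =>
  \sum_(A : {set 'I_n} | A != finset.set0)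
    ofreal ((4 * #|A|)%:R `^ a) * fourier f A * walsh A x.

Definition cos_laplacian (t : R) f : cube n -> R[i] := fun x =>
  mean f + \sum_(A : {set 'I_n} | A != finset.set0)
    ofreal (cos t ^+ #|A|) * fourier f A * walsh A x.

End Cube.

(** * Symmetric function spaces *)

(* Completeness is automatic, the space being finite-dimensional. *)
Record symmetric_space (R : realType) (n : nat) := SymmetricSpace {
  snorm :> (cube n -> R[i]) -> R ;
  snorm_eq0 : forall f, snorm f = 0 -> forall x, f x = 0 ;
  snormZ : forall (c : R[i]) f, snorm (fun x => c * f x) = cabs c * snorm f ;
  snormD : forall f g, snorm (fun x => f x + g x) <= snorm f + snorm g ;
  snorm_lattice : forall f g,
    (forall x, cabs (f x) <= cabs (g x)) -> snorm f <= snorm g ;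
  snorm_sym : forall f (s : {perm cube n}), snorm (fun x => f (s x)) = snorm f
}.

Section SymmetricSpace.
Variables (R : realType) (n : nat).
Implicit Types (E : symmetric_space R n) (p q M : R).

Definition snormR E (g : cube n -> R) : R := E (fun x => ofreal (g x)).

Definition convex_with_constant E p M :=
  forall (m : nat) (v : 'I_m -> cube n -> R[i]),
    snormR E (fun x => (\sum_i cabs (v i x) `^ p) `^ p^-1)
      <= M * (\sum_i E (v i) `^ p) `^ p^-1.

Definition concave_with_constant E q M :=
  forall (m : nat) (v : 'I_m -> cube n -> R[i]),
    (\sum_i E (v i) `^ q) `^ q^-1
      <= M * snormR E (fun x => (\sum_i cabs (v i x) `^ q) `^ q^-1).

Definition is_Lspace E q :=
  forall f, E f = (mean (fun x => cabs (f x) `^ q)) `^ q^-1.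

(* The values K_E allowed by the theorem, in terms of the universal C. *)
Definition admissible_constant (C : R) E (K : R) : Prop :=
  [\/ concave_with_constant E 2 1 /\ K = 1,
      exists q : R, [/\ 2 <= q, convex_with_constant E 2 1,
                        concave_with_constant E q 1 & K = C * q]
    | exists q : R, [/\ 2 < q, is_Lspace E q & K = C * Num.sqrt q] ].

End SymmetricSpace.

(** * Complex-valued calculus *)

Section ComplexCalculus.
Variables (d : measure_display) (T : measurableType d) (R : realType).
Implicit Types (m : {measure set T -> \bar R}) (D : set T).

Definition cintegrable m D (f : T -> R[i]) : Prop :=
  m.-integrable D (fun t => (complex.Re (f t))%:E) /\
  m.-integrable D (fun t => (complex.Im (f t))%:E).

Definition cintegral m D (f : T -> R[i]) : R[i] :=
  Complex (\int[m]_(t in D) complex.Re (f t)) (\int[m]_(t in D) complex.Im (f t)).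

End ComplexCalculus.

Definition cderive (R : realType) (f : R -> R[i]) (t : R) : R[i] :=
  Complex (derive1 (fun s => complex.Re (f s)) t)
          (derive1 (fun s => complex.Im (f s)) t).

Definition Gamma (R : realType) (s : R) : R :=
  \int[mu]_(t in `]0%R, +oo[) (t `^ (s - 1) * expR (- t)).

(** * The matrix space C_E *)

Section SingularValues.
Variables (R : realType) (N : nat).
Local Open Scope sesquilinear_scope.

(* (S^* S)^(1/2), by functional calculus: [spectralmx] is unitary and
   diagonalizes the normal matrix S^* S. *)
Definition absmx (S : 'M[R[i]]_N) : 'M[R[i]]_N :=
  let A := S^t* *m S in
  invmx (spectralmx A) *m diag_mx (map_mx sqrtC (spectral_diag A))
    *m spectralmx A.

(* Eigenvalues of |S|, with multiplicity, in decreasing order. *)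
Definition singular_values (S : 'M[R[i]]_N) : seq R :=
  sort (fun a b => b <= a)
    [seq complex.Re (spectral_diag (absmx S) ord0 k) | k <- enum 'I_N].

End SingularValues.

(* The cube is identified with {0, ..., 2^n - 1} by [enum_rank]; by symmetry
   of E the choice of the bijection is immaterial. *)
Definition CE_norm (R : realType) (n : nat) (E : symmetric_space R n)
    (S : 'M[R[i]]_(2 ^ n)) : R :=
  snormR E (fun x => nth 0 (singular_values S) (enum_rank x)).

(** * The UMD property *)

(* Norms under consideration live on a space of matrices: measurability and
   Bochner integrals there are entrywise notions. *)
Section UMD.
Variables (R : realType) (N : nat).

Definition adapted (T : Type) (F : set (set T)) (X : T -> 'M[R[i]]_N) :=
  forall i j (B : set R), measurable B ->
    F ((fun t => complex.Re (X t i j)) @^-1` B) /\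
    F ((fun t => complex.Im (X t i j)) @^-1` B).

Definition filtration d (T : measurableType d) (F : nat -> set (set T)) :=
  [/\ forall k, sigma_algebra setT (F k),
      forall k A, F k A -> measurable A
    & forall k A, F k A -> F k.+1 A].

(* E[D_{k+1} | F_k] = 0 is spelled out as: D_{k+1} has zero integral over every
   set of F_k. *)
Definition martingale_difference d (T : measurableType d)
    (P : probability T R) (F : nat -> set (set T))
    (D : nat -> T -> 'M[R[i]]_N) :=
  [/\ filtration F,
      forall k, adapted (F k) (D k),
      forall k i j, cintegrable P setT (fun t => D k t i j)
    & forall k i j A, F k A -> cintegral P A (fun t => D k.+1 t i j) = 0].

Definition UMD (nrm : 'M[R[i]]_N -> R) : Prop :=
  forall p : R, 1 < p -> exists beta : R,
  forall (d : measure_display) (T : measurableType d) (P : probability T R)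
    (F : nat -> set (set T)) (D : nat -> T -> 'M[R[i]]_N)
    (eps : nat -> bool) (m : nat),
  martingale_difference P F D ->
  (forall k, (Lnorm P p%:E (fun t => (nrm (D k t))%:E) < +oo)%E) ->
  (Lnorm P p%:E (fun t => (nrm (\sum_(k < m) (-1) ^+ (eps k) *: D k t))%:E)
    <= beta%:E * Lnorm P p%:E (fun t => (nrm (\sum_(k < m) D k t))%:E))%E.

End UMD.

(** * Principal value convolution operators on L^2(R/2piZ; X) *)

Section Convolution.
Variables (R : realType).

Definition truncated_conv (phi : R -> R) (g : R -> R[i]) (x eps : R) : R[i] :=
  cintegral mu [set t | (- pi <= t <= pi) /\ eps < `|t|]
    (fun t => ofreal (phi t) * g (x - t)).

(* y = p.v. \int phi(t) g(x - t) dt. *)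
Definition is_pv_conv (phi : R -> R) (g : R -> R[i]) (x : R) (y : R[i]) :=
  (complex.Re (truncated_conv phi g x eps) @[eps --> 0^'+] --> complex.Re y) /\
  (complex.Im (truncated_conv phi g x eps) @[eps --> 0^'+] --> complex.Im y).

Variable (N : nat).
Implicit Types (nrm : 'M[R[i]]_N -> R) (G H : R -> 'M[R[i]]_N).

Definition mx_measurable G := forall i j,
  measurable_fun setT (fun t => complex.Re (G t i j)) /\
  measurable_fun setT (fun t => complex.Im (G t i j)).

Definition periodic G := forall t, G (t + 2 * pi) = G t.

Definition L2_norm nrm G : \bar R :=
  ((\int[mu]_(t in `[(- pi)%R, pi]) ((nrm (G t)) ^+ 2)%:E) `^ 2^-1)%E.

(* H is the image of G by the convolution operator with kernel p.v. phi,
   tensored with the identity of the matrix space. *)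
Definition is_conv_tensor (phi : R -> R) G H :=
  {ae (@mu R), forall x, forall i j,
    is_pv_conv phi (fun t => G t i j) x (H x i j)}.

(* The norm, possibly infinite, of that operator on L^2(R/2piZ; nrm). *)
Definition conv_opnorm (phi : R -> R) nrm : \bar R :=
  ereal_sup [set z : \bar R | exists G H,
    [/\ mx_measurable G, periodic G & (L2_norm nrm G <= 1)%E] /\
    [/\ mx_measurable H, periodic H, is_conv_tensor phi G H
      & z = L2_norm nrm H]].

Definition H_kernel (t : R) : R :=
  \1_(`[(- (pi / 2))%R, pi / 2]) t * Num.sg t * (- ln (cos t)) `^ (- 2^-1).

End Convolution.

Section Constants.
Variable (R : realType).

Definition K_alpha (a : R) : R :=
  (Gamma (1 - a))^-1 * \int[mu]_(t in `[0%R, pi / 2]) (- ln (cos t)) `^ (- a).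

Definition H_norm n (E : symmetric_space R n) : \bar R :=
  conv_opnorm (@H_kernel R) (@CE_norm R n E).

(* sqrt (2 pi) * H_E is the operator norm; meaningful when the latter is
   finite. *)
Definition H_const n (E : symmetric_space R n) : R :=
  fine (H_norm E) / Num.sqrt (2 * pi).

End Constants.

(* Main.v *)
(* Write U_t for the n-fold tensor power of the plane rotation by t/2.  The
   squares of its entries form the kernel of cos^(Delta/4) t, and differentiating
   in t gives
     d/dt cos^(Delta/4) t (f) (x) = (U_t^* S_f U_t)(x, x),
   where S_f is the matrix of the edge differences of f, up to signs and a factor
   1/2.  By the polar decomposition of S_f the diagonal of U_t^* S_f U_t is
   dominated, in modulus, by a doubly substochastic matrix applied to the singular
   values of S_f; integrating these matrices against |phi| bounds the left-hand side of the
   main inequality by the C_E norm of S_f times the L^1 norm of phi.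

   It remains to bound the C_E norm of S_f by (K_E/2) || |grad f| ||_E.  If E is
   2-concave, then h -> || sqrt h ||_E^2 is concave and symmetric, hence larger on
   the diagonal of S_f^* S_f, which is |grad f|^2 / 4, than on its eigenvalues.
   If E is q-concave, let r = 2m be an even integer with q <= r.  Counting closed
   walks bounds tr |S_f|^(2m) by (C m)^m times the sum of |grad f|^(2m); deleting
   the vertices where |grad f| is largest perturbs S_f by a matrix of small rank,
   so that the same bound holds for the tails of the two sums, and the concavity
   of h -> || h^(1/r) ||_E^q turns the comparison of tails into one of norms.

   The applications to Delta^alpha come from
     - int_0^(pi/2) (-log cos t)^(-alpha) d/dt cos^k t dt = k^alpha Gamma(1 - alpha).
   For alpha = 1/2 the kernel is not integrable: one convolves t -> U_t^* S_f U_t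
   with the odd kernel phi.  The result is the orbit of a matrix T whose diagonal
   is Gamma(1/2) Delta^(1/2) f.  All these orbits have constant C_E norm, so the
   operator norm compares the C_E norms of T and S_f, and
   sqrt(2 pi) <= 2 Gamma(1/2).  That this operator norm is finite follows entrywise
   from the L^2 boundedness of the truncated scalar convolutions, which differ
   from conjugate Fejer kernels by kernels bounded in L^1. *)
Require Import Defs.
From HB Require Import structures.
From mathcomp Require Import all_boot all_order all_algebra.
From mathcomp Require Import all_classical all_reals all_analysis.
From mathcomp Require Import perm sesquilinear spectral measurable_realfun.
From mathcomp Require Import ring lra zify.
From mathcomp.real_closed Require Import complex.
Set Implicit Arguments.
Unset Strict Implicit.
Unset Printing Implicit Defensive.
Import Order.TTheory GRing.Theory Num.Theory.
Import numFieldNormedType.Exports.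
Local Open Scope classical_set_scope.
Local Open Scope ring_scope.
Local Open Scope complex_scope.
Local Open Scope sesquilinear_scope.

(** * Majorization and symmetric gauges *)

(** [grad_mx f] is the commutator of multiplication by f with the generator of the rotations; this
    is why the derivative in t is one fixed matrix moved along an orbit. For q-concave E a bound on
    the full trace is not enough: a symmetric norm is controlled through partial sums, and as the
    available functional is concave, these are the sums of the smallest terms. Deleting k vertices
    costs rank 2k, so tails of different lengths get compared; keeping every other singular value
    repairs the lengths and costs a factor 2. The exponent is even because only then is the trace
    bounded by a count of closed walks. The constant is 6 = 2 * 3: the 2 just mentioned, and 3 sqrt
    q as a rough bound for the sqrt(2m + 1) of the walk count, m being the integer part of q/2. The
    same 6 sqrt q serves L^q and is weakened to 6 q in case (ii). Convex and concave functionals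
    share one majorization lemma for a functional [F] on a domain [P]: nonnegative values for norms,
    nonpositive values and a change of sign for the concave ones. *)

Section Majorization.
Variables (R : realFieldType) (N : nat) (P : R -> Prop) (F : ('I_N -> R) -> R).
Hypothesis P_itv : forall x y z : R, P x -> P y -> x <= z <= y -> P z.
Hypothesis F_mono : forall a b : 'I_N -> R, (forall i, P (a i)) ->
  (forall i, P (b i)) -> (forall i, a i <= b i) -> F a <= F b.
Hypothesis F_tperm : forall (b : 'I_N -> R) (j k : 'I_N) (l : R),
  (forall i, P (b i)) -> 0 <= l <= 1 ->
  F (fun i => l * b i + (1 - l) * b (tperm j k i)) <= F b.

(** Hardy-Littlewood-Polya by transfers: while some [b k < a k], an earlier excess of [b] is moved
    to the first such [k] by a convex combination of [b] with a transposition of it, which does not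
    increase [F]. The induction is on the number of indices where [a] and [b] differ. Only [a] is
    sorted, so the modified [b] needs no re-sorting. *)
Lemma le_weak_majorization (a b : 'I_N -> R) :
  (forall i, P (a i)) -> (forall i, P (b i)) ->
  (forall i j : 'I_N, (i <= j)%N -> a j <= a i) ->
  (forall k : nat, \sum_(i < N | (i < k)%N) a i <= \sum_(i < N | (i < k)%N) b i) ->
  F a <= F b.
Proof.
move=> Pa Pb a_dec.
have [n] := ubnP #|[pred i | a i != b i]|; elim: n b Pb => // n IH b Pb card_ab ab.
have [ab_le|] := pselect (forall i, a i <= b i); first exact: F_mono.
move=> /existsNP[k0 /negP]; rewrite -ltNge => k0P.
pose k := [arg min_(i < k0 | (b i < a i)%R) (i : nat)]%N.
have [bka k_min] : b k < a k /\ forall i : 'I_N, (i < k)%N -> a i <= b i.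
  rewrite /k; case: arg_minnP => // k1 k1P k1min; split => // i ik.
  rewrite leNgt; apply/negP => /k1min; lia.
(* Otherwise [b <= a] up to [k], strictly at [k], against the partial sums of length [k.+1]. *)
have [j [jk ajb]] : exists j : 'I_N, (j < k)%N /\ a j < b j.
  apply: contrapT => /forallNP nj.
  have := ab k.+1; rewrite leNgt => /negP; apply.
  rewrite (bigD1 k)//= [ltRHS](bigD1 k)//=.
  rewrite ltr_leD//; apply: ler_sum => i /andP[ik ineq].
  rewrite leNgt; apply/negP => abi; apply: (nj i); split => //.
  by move: ik ineq; rewrite -val_eqE /=; lia.
(* The largest transfer that keeps [b' j >= a j] and [b' k <= a k]; the constraint reached with
   equality gives a new index of agreement. *)
pose d := Order.min (b j - a j) (a k - b k).
have d0 : 0 < d by rewrite /d lt_min !subr_gt0 ajb bka.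
have dj : d <= b j - a j by rewrite /d ge_min lexx.
have dk : d <= a k - b k by rewrite /d ge_min lexx orbT.
have ajk : a k <= a j by apply: a_dec; exact: ltnW.
have bjk0 : 0 < b j - b k by lra.
have jNk : j != k by rewrite -val_eqE /= ltn_eqF.
(* The weight for which the combination moves exactly [d] from [j] to [k]. *)
pose l := 1 - d / (b j - b k).
have dl : (1 - l) * (b j - b k) = d.
  by rewrite /l subKr divfK// gt_eqF.
have l01 : 0 <= l <= 1.
  rewrite /l subr_ge0 ler_pdivrMr// mul1r gerBl divr_ge0 ?(ltW d0) ?(ltW bjk0) ?andbT//.
  lra.
pose b' := fun i => l * b i + (1 - l) * b (tperm j k i).
have b'j : b' j = b j - d by rewrite /b' tpermL -dl; ring.
have b'k : b' k = b k + d by rewrite /b' tpermR -dl; ring.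
have b'i i : i != j -> i != k -> b' i = b i.
  by move=> ij ik; rewrite /b' tpermD 1?eq_sym// ; ring.
have b'sum (m : nat) : (k < m)%N ->
    \sum_(i < N | (i < m)%N) b' i = \sum_(i < N | (i < m)%N) b i.
  move=> km; have jm := ltn_trans jk km.
  rewrite (bigD1 k)//= (bigD1 j)/=; last by rewrite jm.
  rewrite [RHS](bigD1 k)//= [in RHS](bigD1 j)/=; last by rewrite jm.
  rewrite b'j b'k !addrA; congr (_ + _); first by ring.
  by apply: eq_bigr => i /andP[/andP[_ ik] ij]; exact: b'i.
apply: (@le_trans _ _ (F b')); last exact: F_tperm.
apply: IH.
- move=> i; have [->|ij] := eqVneq i j.
    by apply: (P_itv (Pb k) (Pb j)); rewrite b'j; lra.
  have [->|ik] := eqVneq i k; last by rewrite b'i.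
  by apply: (P_itv (Pb k) (Pb j)); rewrite b'k; lra.
- rewrite -ltnS; apply: leq_trans card_ab; rewrite ltnS; apply: proper_card.
  apply/properP; split.
    apply/fintype.subsetP => i; rewrite !inE; have [->|ij] := eqVneq i j.
      by move=> _; rewrite lt_eqF.
    have [->|ik] := eqVneq i k; first by move=> _; rewrite gt_eqF.
    by rewrite b'i.
  have [dE|dE] : d = b j - a j \/ d = a k - b k.
  - by rewrite /d; case: leP; [left|right].
  - exists j; first by rewrite !inE lt_eqF.
    rewrite !inE; by have -> : a j = b' j; [rewrite b'j dE; ring|rewrite eqxx].
  - exists k; first by rewrite !inE gt_eqF.
    rewrite !inE; by have -> : a k = b' k; [rewrite b'k dE; ring|rewrite eqxx].
- move=> m; have [mk|km] := leqP m k; last by rewrite b'sum.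
  apply: ler_sum => i im; have ik := leq_trans im mk.
  have [->|ij] := eqVneq i j; first by rewrite b'j; lra.
  rewrite b'i//; first exact: k_min.
  by rewrite -val_eqE /= ltn_eqF.
Qed.

End Majorization.

Lemma exists_sorting_perm (R : realDomainType) (N : nat) (a : 'I_N -> R) :
  exists s : {perm 'I_N}, forall i j : 'I_N, (i <= j)%N -> a (s j) <= a (s i).
Proof.
pose r := fun i j : 'I_N => a j <= a i.
have r_total : total r by move=> i j; exact: le_total.
have r_trans : transitive r by move=> i j k ij jk; exact: le_trans jk ij.
pose l := sort r (enum 'I_N).
have size_l : size l = N by rewrite size_sort size_enum_ord.
have uniq_l : uniq l by rewrite sort_uniq enum_uniq.
pose g (i : 'I_N) := nth i l i.
have g_inj : injective g.
  move=> i j; rewrite /g (set_nth_default i); last by rewrite size_l.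
  by move/eqP; rewrite nth_uniq ?size_l// => /eqP/val_inj.
exists (perm g_inj) => i j ij; rewrite !permE /g.
rewrite (set_nth_default i) ?size_l//.
have := @sorted_leq_nth _ r r_trans _ i l (sort_sorted r_total _).
by move=> /(_ (fun x => lexx (a x)) i j); apply => //; rewrite inE size_l.
Qed.

(** Bathtub principle: subtracting the threshold [t], every term (q - c) (s - t) is nonpositive, [c]
    being the indicator of the first k indices. The total is bounded by a sum of ones over [m < k]
    so that k beyond N is covered. Missing mass is harmless only when [s >= 0], hence the
    alternative of an exact total. *)
Lemma sum_weights_le (R : realFieldType) (N : nat) (s q : 'I_N -> R) (k : nat) :
  (forall i j : 'I_N, (i <= j)%N -> s j <= s i) ->
  (forall m, 0 <= q m <= 1) ->
  \sum_m q m <= \sum_(m < N | (m < k)%N) 1 ->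
  (forall m, 0 <= s m) \/ \sum_m q m = \sum_(m < N | (m < k)%N) 1 ->
  \sum_m q m * s m <= \sum_(m < N | (m < k)%N) s m.
Proof.
case: N => [|N] in s q *; first by move=> *; rewrite !big_ord0.
move=> s_dec q01 q_le sq.
(* The threshold between the kept values and the others; [minn] clamps it to the last index when k
   is too large. *)
pose t := s (inord (minn k N)).
have ts (m : 'I_N.+1) : (m < k)%N -> t <= s m.
  by move=> mk; apply: s_dec; rewrite inordK ?ltnS ?geq_minr// leq_min (ltnW mk) -ltnS /=.
have st (m : 'I_N.+1) : (k <= m)%N -> s m <= t.
  move=> km; apply: s_dec; rewrite inordK ?ltnS ?geq_minr//.
  by rewrite geq_min km.
pose c (m : 'I_N.+1) : R := (m < k)%N%:R.
have sumc (g : 'I_N.+1 -> R) : \sum_(m < N.+1 | (m < k)%N) g m = \sum_m c m * g m.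
  rewrite big_mkcond/=; apply: eq_bigr => m _; rewrite /c.
  by case: ifP => _; rewrite ?mul1r ?mul0r.
rewrite sumc -subr_le0 -sumrB.
have -> : \sum_(i < N.+1) (q i * s i - c i * s i) =
    \sum_i (q i - c i) * (s i - t) + (\sum_i q i - \sum_i c i) * t.
  by rewrite -sumrB big_distrl -big_split /=; apply: eq_bigr => i _; ring.
have c1 : \sum_i c i = \sum_(m < N.+1 | (m < k)%N) 1.
  by rewrite sumc; apply: eq_bigr => i _; rewrite mulr1.
have h1 : (\sum_i q i - \sum_i c i) * t <= 0.
  rewrite c1; case: sq => [s0|->]; last by rewrite subrr mul0r.
  by rewrite mulr_le0_ge0 ?subr_le0//; exact: s0.
suff : \sum_i (q i - c i) * (s i - t) <= 0 by lra.
apply: sumr_le0 => i _; have /andP[q0 q1] := q01 i; rewrite /c.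
case: ltnP => ik /=.
  by rewrite mulr_le0_ge0 ?subr_le0 ?subr_ge0 //; exact: ts.
by rewrite subr0 mulr_ge0_le0 ?subr_le0//; exact: st.
Qed.

(** * Symmetric convex functionals under doubly substochastic averaging *)

Section Stochastic.
Variables (R : realFieldType) (N : nat) (P : R -> Prop) (F : ('I_N -> R) -> R).
Hypothesis P_itv : forall x y z : R, P x -> P y -> x <= z <= y -> P z.
Hypothesis F_mono : forall a b : 'I_N -> R, (forall i, P (a i)) ->
  (forall i, P (b i)) -> (forall i, a i <= b i) -> F a <= F b.
Hypothesis F_perm : forall (b : 'I_N -> R) (s : {perm 'I_N}),
  (forall i, P (b i)) -> F (fun i => b (s i)) = F b.
Hypothesis F_conv : forall (b c : 'I_N -> R) (l : R),
  (forall i, P (b i)) -> (forall i, P (c i)) -> 0 <= l <= 1 ->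
  F (fun i => l * b i + (1 - l) * c i) <= l * F b + (1 - l) * F c.

Lemma symmetric_convex_tperm (b : 'I_N -> R) (j k : 'I_N) (l : R) :
  (forall i, P (b i)) -> 0 <= l <= 1 ->
  F (fun i => l * b i + (1 - l) * b (tperm j k i)) <= F b.
Proof.
move=> Pb l01; apply: le_trans (F_conv _ _ _) _ => //.
by rewrite F_perm// -mulrDl subrKC mul1r.
Qed.

(** After sorting, the first k entries of [a] are bounded by a combination of the values of [s]
    whose weights are sums of Q over k rows: they lie in [0, 1] and total at most k, so
    [sum_weights_le] yields the majorization, with no decomposition of Q into permutations. Exact
    row sums replace [s >= 0] when the values are nonpositive, as happens below for concave
    functionals. *)
Lemma symmetric_convex_le_stochastic (Q : 'I_N -> 'I_N -> R) (a s : 'I_N -> R) :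
  (forall i, P (a i)) -> (forall i, P (s i)) ->
  (forall i k, 0 <= Q i k) ->
  (forall i, \sum_k Q i k <= 1) -> (forall k, \sum_i Q i k <= 1) ->
  (forall k, 0 <= s k) \/ (forall i, \sum_k Q i k = 1) ->
  (forall i, a i <= \sum_k Q i k * s k) ->
  F a <= F s.
Proof.
move=> Pa Ps Q0 row col sQ aQ.
have [sa sa_dec] := exists_sorting_perm a.
have [ss ss_dec] := exists_sorting_perm s.
rewrite -(F_perm sa Pa) -(F_perm ss Ps).
apply: (le_weak_majorization P_itv F_mono symmetric_convex_tperm) => // k.
pose q m := \sum_(i < N | (i < k)%N) Q (sa i) (ss m).
have sumq : \sum_m q m = \sum_(i < N | (i < k)%N) \sum_m Q (sa i) m.
  rewrite exchange_big/=; apply: eq_bigr => i _.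
  by rewrite [RHS](reindex_inj (@perm_inj _ ss)).
apply: (@le_trans _ _ (\sum_m q m * s (ss m))).
  rewrite (eq_bigr _ (fun m _ => mulr_suml _ _ _ _)) exchange_big /=.
  apply: ler_sum => i _; apply: le_trans (aQ _) _.
  by rewrite (reindex_inj (@perm_inj _ ss)).
apply: sum_weights_le => //.
- move=> m; apply/andP; split; first by apply: sumr_ge0 => i _; exact: Q0.
  apply: le_trans (col (ss m)); rewrite [leRHS](reindex_inj (@perm_inj _ sa))/=.
  by rewrite [leRHS](bigID (fun i : 'I_N => (i < k)%N))/= lerDl sumr_ge0.
- by rewrite sumq; apply: ler_sum => i _; exact: row.
- by case: sQ => sQ; [left => m; exact: sQ|right; rewrite sumq; apply: eq_bigr].
Qed.

End Stochastic.

Lemma cabs_norm (R : realType) (z : R[i]) : (cabs z)%:C = `|z|.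
Proof. by []. Qed.

Lemma cabs_real (R : realType) (x : R) : cabs (x%:C) = `|x|.
Proof. by apply: complexI; rewrite cabs_norm normc_def /= expr0n addr0 sqrtr_sqr. Qed.

Lemma cabs_ge0 (R : realType) (z : R[i]) : 0 <= cabs z.
Proof. by rewrite -ler0c cabs_norm. Qed.

(** * Singular values *)

Section SingularValues.
Variables (R : realType) (N : nat).
Implicit Types (S V W A : 'M[R[i]]_N) (s d : 'I_N -> R).

Lemma trmxC_mul (m n p : nat) (A : 'M[R[i]]_(m, n)) (B : 'M[R[i]]_(n, p)) :
  (A *m B)^t* = B^t* *m A^t*.
Proof. by rewrite trmx_mul map_mxM. Qed.

Lemma unitarymxC V : V \is unitarymx -> V^t* *m V = 1%:M.
Proof. by move=> /unitarymxP/mulmx1C. Qed.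

Lemma trmxC_mul_diag (m n : nat) (A : 'M[R[i]]_(m, n)) (k : 'I_n) :
  (A^t* *m A) k k = (\sum_i cabs (A i k) ^+ 2)%:C.
Proof.
rewrite mxE rmorph_sum; apply: eq_bigr => i _.
by rewrite !mxE mulrC -normCK -cabs_norm rmorphXn.
Qed.

Definition real_diag s : 'M[R[i]]_N := diag_mx (\row_k (s k)%:C).

Lemma real_diagC s : (real_diag s)^t* = real_diag s.
Proof.
apply/matrixP => i j; rewrite !mxE eq_sym; case: eqP => [->|_].
  by rewrite !mulr1n conj_Creal// complex_real.
by rewrite !mulr0n conjC0.
Qed.

(** Both sides have the same characteristic polynomial, a product of linear factors over the
    diagonal, so the diagonals agree up to order. This frees the singular values from the particular
    diagonalizations chosen in their definition. *)
Lemma diag_eigenvalues_perm V W s d : V \is unitarymx -> W \is unitarymx ->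
  V^t* *m real_diag s *m V = W^t* *m real_diag d *m W ->
  perm_eq [seq s k | k <- enum 'I_N] [seq d k | k <- enum 'I_N].
Proof.
have char_diag c (X : 'M[R[i]]_N) : X \is unitarymx -> char_poly (X^t* *m real_diag c *m X) =
    \prod_(x <- [seq (c k)%:C | k <- enum 'I_N]) ('X - x%:P).
  move=> Xu; have Xi := unitarymx_unit Xu; rewrite -(invmx_unitary Xu) -(conjVmx _ Xi).
  have -> : char_poly (conjmx (invmx X) (real_diag c)) = char_poly (real_diag c).
    rewrite (conjVmx _ Xi) /char_poly /char_poly_mx !map_mxM.
    have XP : map_mx polyC (invmx X) *m map_mx polyC X = 1%:M.
      by rewrite -map_mxM (mulVmx Xi) map_mx1.
    have -> : 'X%:M - map_mx polyC (invmx X) *m map_mx polyC (real_diag c) *m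
        map_mx polyC X = map_mx polyC (invmx X) *m ('X%:M - map_mx polyC (real_diag c))
        *m map_mx polyC X.
      by rewrite mulmxBr mulmxBl; congr (_ - _); rewrite scalar_mxC -mulmxA XP mulmx1.
    by rewrite det_mulmx mulrC -det_mulmx mulmxA (mulmx1C XP) mul1mx.
  rewrite char_poly_trig; last first.
    by apply/is_trig_mxP => i j ij; rewrite !mxE -val_eqE /= ltn_eqF.
  rewrite big_map big_enum /=; apply: eq_bigr => i _.
  by rewrite !mxE eqxx mulr1n.
move=> Vu Wu /(congr1 (@char_poly _ _)); rewrite !char_diag// => /prod_XsubC_eq.
move=> /(perm_map (@complex.Re R)); rewrite -!map_comp.
by under eq_map do rewrite /=; under [X in perm_eq _ X]eq_map do rewrite /=.
Qed.

(** Half of a singular value decomposition: only the right singular vectors are recorded, so no left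
    factor has to be completed where [s] vanishes. [sv_decomp_polar] recovers a partial isometry on
    the left. *)
Definition sv_decomp S V s :=
  [/\ V \is unitarymx, forall k, 0 <= s k &
      S^t* *m S = V^t* *m real_diag (fun k => s k ^+ 2) *m V].

Lemma exists_sv_decomp S : exists V s, sv_decomp S V s /\ V = spectralmx (S^t* *m S).
Proof.
set A := S^t* *m S; pose V := spectralmx A.
have Vu : V \is unitarymx by exact: spectral_unitarymx.
have /orthomx_spectralP AE : A \is normalmx.
  by apply/normalmxP; rewrite /A trmxC_mul trmxCK.
rewrite -/V invmx_unitary// in AE.
have dE k : spectral_diag A ord0 k = (\sum_i cabs ((S *m V^t*) i k) ^+ 2)%:C.
  rewrite -trmxC_mul_diag trmxC_mul trmxCK mulmxA -(mulmxA V) -/A [in RHS]AE !mulmxA.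
  by rewrite (unitarymxP Vu) mul1mx mulmxtVK// mxE eqxx mulr1n.
exists V, (fun k => Num.sqrt (\sum_i cabs ((S *m V^t*) i k) ^+ 2)); split=> //.
split=> //.
rewrite -/A [LHS]AE; congr (_ *m diag_mx _ *m _); apply/matrixP => i k.
rewrite ord1 dE mxE sqr_sqrtr//.
by apply: sumr_ge0 => j _; exact: sqr_ge0.
Qed.

(** The definition diagonalizes twice, first S^* S and then [absmx S]. Both are unitarily equivalent
    to real diagonal matrices, so [diag_eigenvalues_perm] identifies the outcome with that of any
    decomposition. *)
Lemma singular_valuesE S V s : sv_decomp S V s ->
  singular_values S = sort (fun a b => b <= a) [seq s k | k <- enum 'I_N].
Proof.
move=> [Vu s0 SE]; apply/perm_sortP.
- by move=> a b; exact: le_total.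
- by move=> a b c ba cb; exact: le_trans cb ba.
- by move=> a b /andP[ba ab]; apply/eqP; rewrite eq_le ba ab.
have [W [d [[Wu d0 SE'] WE]]] := exists_sv_decomp S.
have sd_perm : perm_eq [seq d k | k <- enum 'I_N] [seq s k | k <- enum 'I_N].
  have := diag_eigenvalues_perm Wu Vu (etrans (esym SE') SE).
  have sqrtK c : (forall k, 0 <= c k) ->
      map Num.sqrt [seq c k ^+ 2 | k <- enum 'I_N] = [seq c k | k <- enum 'I_N].
    by move=> c0; rewrite -map_comp; apply: eq_map => k /=; rewrite sqrtr_sqr ger0_norm.
  by move=> /(perm_map Num.sqrt); rewrite !sqrtK.
apply: perm_trans sd_perm.
have absE : absmx S = W^t* *m real_diag d *m W.
  rewrite /absmx /real_diag -WE (invmx_unitary Wu); congr (_ *m diag_mx _ *m _).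
  apply/matrixP => i k; rewrite ord1 !mxE.
  have -> : spectral_diag (S^t* *m S) ord0 k = (d k)%:C ^+ 2.
    have /orthomx_spectralP AE : S^t* *m S \is normalmx.
      by apply/normalmxP; rewrite trmxC_mul trmxCK.
    rewrite -WE invmx_unitary// SE' in AE.
    move: AE => /(congr1 (fun X => W *m X *m W^t*)).
    rewrite !mulmxA (unitarymxP Wu) !mul1mx !mulmxtVK// => /matrixP /(_ k k).
    by rewrite -SE' !mxE eqxx !mulr1n -rmorphXn.
  by rewrite sqrCK// ler0c.
have absC : (absmx S)^t* = absmx S.
  by rewrite absE !trmxC_mul trmxCK real_diagC mulmxA.
have /orthomx_spectralP AE : absmx S \is normalmx by apply/normalmxP; rewrite absC.
have herm : absmx S \is hermsymmx.
  by apply/is_hermitianmxP; rewrite expr0 scale1r absC.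
have rs := hermitian_spectral_diag_real herm.
rewrite invmx_unitary ?spectral_unitarymx// in AE.
have sE : diag_mx (spectral_diag (absmx S)) =
    real_diag (fun k => complex.Re (spectral_diag (absmx S) ord0 k)).
  congr diag_mx; apply/matrixP => i k; rewrite ord1 !mxE.
  by rewrite RRe_real//; move/mxOverP: rs; exact.
rewrite sE absE in AE.
rewrite perm_sym; apply: (diag_eigenvalues_perm Wu (spectral_unitarymx _)).
by rewrite AE -absE.
Qed.

End SingularValues.

Lemma card_cube (n : nat) : #|{: cube n}| = (2 ^ n)%N.
Proof. by rewrite card_ffun card_bool card_ord. Qed.

Definition cube_rank (n : nat) (x : cube n) : 'I_(2 ^ n) :=
  cast_ord (card_cube n) (enum_rank x).

Definition cube_val (n : nat) (i : 'I_(2 ^ n)) : cube n :=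
  enum_val (cast_ord (esym (card_cube n)) i).

Lemma cube_rankK (n : nat) : cancel (@cube_rank n) (@cube_val n).
Proof. by move=> x; rewrite /cube_val /cube_rank cast_ordK enum_rankK. Qed.

Lemma cube_valK (n : nat) : cancel (@cube_val n) (@cube_rank n).
Proof. by move=> x; rewrite /cube_val /cube_rank enum_valK cast_ordKV. Qed.

Lemma cube_rank_inj n : injective (@cube_rank n).
Proof. exact: can_inj (@cube_rankK n). Qed.

Lemma cube_val_inj n : injective (@cube_val n).
Proof. exact: can_inj (@cube_valK n). Qed.

(** * The norm of E as a symmetric gauge on sequences indexed like matrices *)

Section Gauge.
Variables (R : realType) (n : nat) (E : symmetric_space R n).
Local Notation N := (2 ^ n)%N.
Implicit Types (a b : 'I_N -> R).

Definition gauge a : R := snormR E (fun x => a (cube_rank x)).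

Lemma gaugeE (g : cube n -> R) : snormR E g = gauge (fun i => g (cube_val i)).
Proof. by rewrite /gauge; congr (snormR E _); apply/funext => x; rewrite cube_rankK. Qed.

Lemma le_gauge a b : (forall i, `|a i| <= `|b i|) -> gauge a <= gauge b.
Proof. by move=> ab; apply: snorm_lattice => x; rewrite !cabs_real. Qed.

Lemma gauge_perm a (s : {perm 'I_N}) : gauge (fun i => a (s i)) = gauge a.
Proof.
pose t x := cube_val (s (cube_rank x)).
have t_inj : injective t.
  by move=> x y /cube_val_inj/perm_inj/cube_rank_inj.
have := snorm_sym E (fun x => ofreal (a (cube_rank x))) (perm t_inj).
rewrite /gauge /snormR => <-; congr (E _); apply/funext => x.
by rewrite permE /t cube_valK.
Qed.

Lemma gaugeZ (c : R) a : gauge (fun i => c * a i) = `|c| * gauge a.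
Proof.
rewrite /gauge /snormR -cabs_real -snormZ; congr (E _); apply/funext => x.
by rewrite /ofreal -rmorphM.
Qed.

Lemma gaugeD a b : gauge (fun i => a i + b i) <= gauge a + gauge b.
Proof.
rewrite /gauge /snormR; apply: le_trans (snormD _ _ _).
by rewrite le_eqVlt; apply/orP; left; apply/eqP; congr (E _); apply/funext => x; rewrite /ofreal rmorphD.
Qed.

Lemma gauge0 : gauge (fun=> 0) = 0.
Proof.
by have := gaugeZ 0 (fun=> 0); rewrite normr0 !mul0r.
Qed.

Lemma gauge_ge0 a : 0 <= gauge a.
Proof. by rewrite -gauge0; apply: le_gauge => i; rewrite normr0. Qed.

Lemma gauge_gt0 a i : a i != 0 -> 0 < gauge a.
Proof.
move=> ai; rewrite lt_neqAle gauge_ge0 andbT eq_sym; apply/eqP.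
move=> /snorm_eq0 /(_ (cube_val i)); rewrite cube_valK => /complexI/eqP.
by rewrite (negPf ai).
Qed.

Lemma gauge_substochastic (Q : 'I_N -> 'I_N -> R) (a s : 'I_N -> R) :
  (forall k, 0 <= s k) -> (forall i k, 0 <= Q i k) ->
  (forall i, \sum_k Q i k <= 1) -> (forall k, \sum_i Q i k <= 1) ->
  (forall i, 0 <= a i <= \sum_k Q i k * s k) ->
  gauge a <= gauge s.
Proof.
move=> s0 Q0 row col aQ.
apply: (@symmetric_convex_le_stochastic R N (fun x => 0 <= x) gauge _ _ _ _ Q) => //.
- by move=> x y z x0 _ /andP[xz _]; exact: le_trans xz.
- by move=> c d c0 d0 cd; apply: le_gauge => i; rewrite !ger0_norm.
- by move=> b p _; exact: gauge_perm.
- move=> b c l _ _ /andP[l0 l1]; apply: le_trans (gaugeD _ _) _.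
  by rewrite !gaugeZ !ger0_norm// subr_ge0.
- by move=> i; have /andP[] := aQ i.
- by left.
- by move=> i; have /andP[] := aQ i.
Qed.

(** Sorting is a permutation of the indices, which the gauge does not see; hence the norm can be
    read off any decomposition, in any order. *)
Lemma CE_normE (S V : 'M[R[i]]_N) (s : 'I_N -> R) :
  sv_decomp S V s -> CE_norm E S = gauge s.
Proof.
move=> /singular_valuesE SE; have [p p_dec] := exists_sorting_perm s.
rewrite -(gauge_perm _ p) /CE_norm /gauge; congr (snormR E _); apply/funext => x.
rewrite SE; have -> : sort (fun a b : R => b <= a) [seq s k | k <- enum 'I_N] =
    [seq s (p k) | k <- enum 'I_N].
  apply: (@sorted_eq _ (fun a b : R => b <= a)).
  - by move=> a b c ba cb; exact: le_trans cb ba.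
  - by move=> a b /andP[ba ab]; apply/eqP; rewrite eq_le ba ab.
  - by apply: sort_sorted => a b; exact: le_total.
  - have := iota_sorted 0 N; rewrite -val_enum_ord !sorted_map.
    by apply: sub_sorted => i j /= /p_dec.
  - rewrite perm_sort perm_sym (map_comp s p); apply: perm_map; apply: uniq_perm.
    + by rewrite map_inj_uniq ?enum_uniq//; exact: perm_inj.
    + exact: enum_uniq.
    + move=> i; rewrite mem_enum; apply/mapP; exists (p^-1%g i); rewrite ?mem_enum//.
      by rewrite permKV.
have -> : enum_rank x = cube_rank x :> nat by [].
by rewrite (nth_map (cube_rank x)) ?size_enum_ord// nth_ord_enum.
Qed.

End Gauge.

(** * Polar decomposition and diagonals of unitary conjugates *)

Section PartialIsometry.
Variables (R : realType) (N : nat).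
Implicit Types (S V W X : 'M[R[i]]_N) (s p : 'I_N -> R).

Lemma sum_cabs_eq0 (I : finType) (f : I -> R[i]) :
  \sum_i cabs (f i) ^+ 2 = 0 -> forall i, f i = 0.
Proof.
move=> f0 i; apply/eqP; rewrite -normr_eq0 -cabs_norm; apply/eqP.
have h : cabs (f i) ^+ 2 = 0 by apply: (psumr_eq0P _ f0) => // j _; exact: sqr_ge0.
by move/eqP: h; rewrite sqrf_eq0 => /eqP ->.
Qed.

Lemma mul_real_diagE (m : nat) (A : 'M[R[i]]_(m, N)) s i k :
  (A *m real_diag s) i k = A i k * (s k)%:C.
Proof. by rewrite mul_mx_diag !mxE. Qed.

(** The columns have norm 0 or 1 by hypothesis. For row i, M = X X^* is a self-adjoint idempotent,
    so its diagonal entry r satisfies r^2 <= sum_j |M_ji|^2 = r, whence r <= 1. *)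
Lemma partial_isometry_rows X p : (forall k, p k = 0 \/ p k = 1) ->
  X^t* *m X = real_diag p ->
  (forall i, \sum_k cabs (X i k) ^+ 2 <= 1) /\
  (forall k, \sum_i cabs (X i k) ^+ 2 <= 1).
Proof.
move=> p01 XX.
have colE k : \sum_i cabs (X i k) ^+ 2 = p k.
  by apply: complexI; rewrite -trmxC_mul_diag XX !mxE eqxx mulr1n.
split=> [i|k]; last by rewrite colE; case: (p01 k) => ->.
have Xp : X *m real_diag p = X.
  apply/matrixP => j k; rewrite mul_mx_diag !mxE.
  case: (p01 k) => pk; rewrite pk ?mulr1// mulr0.
  by have := colE k; rewrite pk => /sum_cabs_eq0 ->.
pose M := X *m X^t*.
have MM : M *m M = M by rewrite /M mulmxA -(mulmxA X) XX Xp.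
have MC : M^t* = M by rewrite /M trmxC_mul trmxCK.
pose r := \sum_k cabs (X i k) ^+ 2.
have Mr : M i i = r%:C.
  rewrite /M mxE /r rmorph_sum; apply: eq_bigr => k _.
  by rewrite !mxE -normCK -cabs_norm rmorphXn.
have r0 : 0 <= r by apply: sumr_ge0 => k _; exact: sqr_ge0.
have rr : r ^+ 2 <= r.
  rewrite -[leRHS](_ : \sum_j cabs (M j i) ^+ 2 = r).
    rewrite (bigD1 i)//= -[leLHS]addr0 lerD//; last by apply: sumr_ge0 => k _; exact: sqr_ge0.
    by rewrite Mr cabs_real ger0_norm.
  by apply: complexI; rewrite -trmxC_mul_diag MC MM Mr.
rewrite leNgt; apply/negP => r1; move: rr; rewrite leNgt => /negP; apply.
by rewrite expr2 ltr_pMr// (lt_trans ltr01).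
Qed.

Lemma sv_decomp_polar S V s : sv_decomp S V s -> exists W p,
  [/\ S = W *m real_diag s *m V, (forall k, p k = 0 \/ p k = 1) & W^t* *m W = real_diag p].
Proof.
move=> [Vu s0 SE]; pose Y := S *m V^t*.
have YY : Y^t* *m Y = real_diag (fun k => s k ^+ 2).
  by rewrite /Y trmxC_mul trmxCK mulmxA -(mulmxA V) SE !mulmxA (unitarymxP Vu) mul1mx mulmxtVK.
have Y0 k : s k = 0 -> forall i, Y i k = 0.
  move=> sk i; have : \sum_i cabs (Y i k) ^+ 2 = 0.
    by apply: complexI; rewrite -trmxC_mul_diag YY !mxE eqxx mulr1n sk expr0n.
  by move=> /sum_cabs_eq0 ->.
(* Since 0^-1 = 0, this also erases the columns with [s k = 0], where [Y] vanishes anyway. *)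
pose D := real_diag (fun k => (s k)^-1).
exists (Y *m D), (fun k => (s k != 0)%:R); split.
- have -> : Y *m D *m real_diag s = Y.
    apply/matrixP => i k; rewrite /D !mul_real_diagE.
    have [sk|sk] := eqVneq (s k) 0; first by rewrite (Y0 k sk i) !mul0r.
    by rewrite -mulrA -rmorphM mulVf// mulr1.
  by rewrite /Y mulmxKtV.
- by move=> k; case: eqP => _; [left|right].
rewrite trmxC_mul real_diagC mulmxA -(mulmxA D) YY.
apply/matrixP => i j; rewrite /D /real_diag !mulmx_diag !mxE.
case: eqP => [->|_]; last by rewrite !mulr0n.
rewrite !mulr1n -!rmorphM; congr (_ %:C).
have [->|sj] := eqVneq (s j) 0; first by rewrite invr0 !mul0r.
by rewrite /= expr2; field.
Qed.

(** The weight of [s k] in the diagonal entry i of U^* W diag(s) V U after |a b| <= (|a|^2 + |b|^2)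
    / 2. Averaging the two squared moduli bounds row sums and column sums by 1 at the same time,
    since U^* W is a partial isometry and V U is unitary. *)
Definition overlap W V (U : 'M[R[i]]_N) (i k : 'I_N) : R :=
  2^-1 * (cabs ((U^t* *m W) i k) ^+ 2 + cabs ((V *m U) k i) ^+ 2).

Lemma overlap_ge0 W V U i k : 0 <= overlap W V U i k.
Proof. by rewrite mulr_ge0// addr_ge0// sqr_ge0. Qed.

Lemma overlap_sum_le1 W V U p : U \is unitarymx -> V \is unitarymx ->
  (forall k, p k = 0 \/ p k = 1) -> W^t* *m W = real_diag p ->
  (forall i, \sum_k overlap W V U i k <= 1) /\
  (forall k, \sum_i overlap W V U i k <= 1).
Proof.
move=> Uu Vu p01 WW.
have UW : (U^t* *m W)^t* *m (U^t* *m W) = real_diag p.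
  by rewrite trmxC_mul trmxCK mulmxA mulmxtVK.
have VU : (V *m U)^t* *m (V *m U) = real_diag (fun=> 1).
  rewrite unitarymxC ?mul_unitarymx//.
  by apply/matrixP => i j; rewrite !mxE.
have [r1 c1] := partial_isometry_rows p01 UW.
have [r2 c2] := partial_isometry_rows (fun=> or_intror erefl) VU.
by split=> [i|k]; rewrite -mulr_sumr big_split/=; [have := lerD (r1 i) (c2 i)|
  have := lerD (c1 k) (r2 k)]; lra.
Qed.

Lemma diag_conj_le_overlap W V U s i : (forall k, 0 <= s k) ->
  cabs ((U^t* *m (W *m real_diag s *m V) *m U) i i) <= \sum_k overlap W V U i k * s k.
Proof.
move=> s0.
have -> : U^t* *m (W *m real_diag s *m V) *m U = (U^t* *m W) *m real_diag s *m (V *m U).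
  by rewrite !mulmxA.
rewrite -lecR cabs_norm mxE rmorph_sum; apply: le_trans (ler_norm_sum _ _ _) _.
apply: ler_sum => k _; rewrite mul_real_diagE !normrM -!cabs_norm.
rewrite cabs_real (ger0_norm (s0 k)) -!rmorphM lecR /overlap.
set a := cabs _; set b := cabs ((V *m U) k i).
have := sqr_ge0 (a - b); have := s0 k; rewrite sqrrB.
move=> sk ab; rewrite mulrAC ler_wpM2r//; lra.
Qed.

End PartialIsometry.

(** Read off from the convexity of x -> x^(1/e) at the points a^e and b^e, by taking e-th powers. *)
Lemma concave_powR (R : realType) (e l a b : R) : 0 < e <= 1 -> 0 <= l <= 1 ->
  0 <= a -> 0 <= b ->
  l * a `^ e + (1 - l) * b `^ e <= (l * a + (1 - l) * b) `^ e.
Proof.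
move=> /andP[e0 e1] /andP[l0 l1] a0 b0.
have p1 : 1 <= e^-1 by rewrite invf_ge1.
have ep : e * e^-1 = 1 by rewrite divff// gt_eqF.
have h0 : 0 <= l * a `^ e + (1 - l) * b `^ e.
  by rewrite addr_ge0// mulr_ge0 ?powR_ge0// subr_ge0.
have l01 : Itv.spec (@Itv.num_sem R) (Itv.Real `[0%Z, 1%Z]) l.
  by rewrite /= /Itv.num_sem/= in_itv/= l0 l1 num_real.
have := @convex_powR R _ p1 (Itv.mk l01) (a `^ e) (b `^ e).
rewrite !inE/= !in_itv/= !andbT !powR_ge0 => /(_ isT isT).
rewrite !convRE /= -!powRrM ep !powRr1// => /(ge0_ler_powR (ltW e0)).
rewrite !nnegrE powR_ge0 -powRrM mulVf ?gt_eqF// powRr1//.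
by apply => //; rewrite addr_ge0// mulr_ge0// subr_ge0.
Qed.

(** * Concave functionals attached to a q-concave norm *)

Section ConcaveGauge.
Variables (R : realType) (n : nat) (E : symmetric_space R n) (q r : R).
Local Notation N := (2 ^ n)%N.
Hypothesis q_gt0 : 0 < q.
Hypothesis le_qr : q <= r.
Hypothesis q_concave : concave_with_constant E q 1.
Implicit Types (a b h g : 'I_N -> R).

Definition gauge_root h : R := gauge E (fun i => h i `^ r^-1).

Let r_gt0 : 0 < r. Proof. exact: lt_le_trans le_qr. Qed.

Let powRK (x : R) : 0 <= x -> (x `^ q) `^ q^-1 = x.
Proof. by move=> x0; rewrite -powRrM mulfV ?gt_eqF// powRr1. Qed.

Let powRVK (x : R) : 0 <= x -> (x `^ q^-1) `^ q = x.
Proof. by move=> x0; rewrite -powRrM mulVf ?gt_eqF// powRr1. Qed.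

Let powR_le_inv (x y : R) : 0 <= x -> 0 <= y -> x `^ q <= y `^ q -> x <= y.
Proof.
move=> x0 y0 xy; rewrite -(powRK x0) -(powRK y0); apply: ge0_ler_powR => //.
- by rewrite invr_ge0 ltW.
- by rewrite nnegrE powR_ge0.
- by rewrite nnegrE powR_ge0.
Qed.

(** This is q-concavity for the family of the two functions a^(1/q) and b^(1/q). *)
Lemma gauge_superadditive a b : (forall i, 0 <= a i) -> (forall i, 0 <= b i) ->
  gauge E (fun i => a i `^ q^-1) `^ q + gauge E (fun i => b i `^ q^-1) `^ q
    <= gauge E (fun i => (a i + b i) `^ q^-1) `^ q.
Proof.
move=> a0 b0.
pose v (k : 'I_2) (x : cube n) : R[i] :=
  ofreal ((if k == ord0 then a (cube_rank x) else b (cube_rank x)) `^ q^-1).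
have sum2 (f : 'I_2 -> R) : \sum_i f i = f ord0 + f ord_max.
  by rewrite big_ord_recr big_ord1; congr (f _ + _); apply: val_inj.
have v0 : E (v ord0) = gauge E (fun i => a i `^ q^-1) by [].
have v1 : E (v ord_max) = gauge E (fun i => b i `^ q^-1) by [].
have v2 : snormR E (fun x => (\sum_i cabs (v i x) `^ q) `^ q^-1) =
    gauge E (fun i => (a i + b i) `^ q^-1).
  congr (snormR E _); apply: funext => x; rewrite sum2 {1 2}/v /ofreal !cabs_real.
  by rewrite !ger0_norm ?powR_ge0// !powRVK.
have := q_concave v; rewrite mul1r v2 sum2 v0 v1.
move=> /(ge0_ler_powR (ltW q_gt0)); rewrite !nnegrE powR_ge0 gauge_ge0 => /(_ isT isT).
by rewrite powRVK ?addr_ge0 ?powR_ge0.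
Qed.

(** A homogeneous superadditive functional is concave, which is the case r = q. For r > q the
    functional is composed with x -> x^(q/r), itself concave and increasing. *)
Lemma concave_gauge a b (l : R) : (forall i, 0 <= a i) -> (forall i, 0 <= b i) ->
  0 <= l <= 1 ->
  l * gauge_root a `^ q + (1 - l) * gauge_root b `^ q
    <= gauge_root (fun i => l * a i + (1 - l) * b i) `^ q.
Proof.
move=> a0 b0 /andP[l0 l1]; have l1' : 0 <= 1 - l by rewrite subr_ge0.
have scale c h : 0 <= c -> (forall i, 0 <= h i) ->
    c * gauge_root h `^ q = gauge E (fun i => (c * h i `^ (q / r)) `^ q^-1) `^ q.
  move=> c0 h0; rewrite -{1}(powRVK c0) -powRM ?powR_ge0 ?gauge_ge0//; congr (_ `^ _).
  rewrite -[X in X * _]ger0_norm ?powR_ge0// -gaugeZ; congr (gauge E _).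
  apply/funext => i; rewrite powRM ?powR_ge0//; congr (_ * _).
  by rewrite -powRrM mulrAC mulfV ?gt_eqF// mul1r.
rewrite !scale//; apply: le_trans (gauge_superadditive _ _) _.
- by move=> i; rewrite mulr_ge0// powR_ge0.
- by move=> i; rewrite mulr_ge0// powR_ge0.
apply: ge0_ler_powR; rewrite ?nnegrE ?gauge_ge0 ?(ltW q_gt0)//.
apply: le_gauge => i; rewrite !ger0_norm ?powR_ge0//.
have rE : r^-1 = (q / r) * q^-1 by rewrite mulrAC mulfV ?gt_eqF// mul1r.
rewrite [in leRHS]rE [leRHS]powRrM; apply: ge0_ler_powR; rewrite ?nnegrE ?powR_ge0 ?invr_ge0 ?(ltW q_gt0)//.
  by rewrite addr_ge0// mulr_ge0// powR_ge0.
apply: concave_powR; rewrite ?a0 ?b0 ?l0 ?l1//.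
by rewrite divr_gt0//= ler_pdivrMr// mul1r.
Qed.

(** The change of sign turns a concave increasing functional on nonnegative sequences into a convex
    increasing one on nonpositive sequences, to which the majorization lemmas apply. *)
Let F h : R := - gauge_root (fun i => - h i) `^ q.
Let P (x : R) := x <= 0.

Let P_itv x y z : P x -> P y -> x <= z <= y -> P z.
Proof. by move=> _ Py /andP[_ zy]; exact: le_trans Py. Qed.

Let F_mono a b : (forall i, P (a i)) -> (forall i, P (b i)) ->
  (forall i, a i <= b i) -> F a <= F b.
Proof.
move=> Pa Pb ab; rewrite lerN2; apply: ge0_ler_powR; rewrite ?nnegrE ?gauge_ge0 ?(ltW q_gt0)//.
apply: le_gauge => i; rewrite !ger0_norm ?powR_ge0//.
by apply: ge0_ler_powR; rewrite ?nnegrE ?oppr_ge0 ?lerN2 ?invr_ge0 ?(ltW r_gt0)//; [exact: Pb|exact: Pa].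
Qed.

Let F_perm a (s : {perm 'I_N}) : (forall i, P (a i)) -> F (fun i => a (s i)) = F a.
Proof. by move=> _; rewrite /F /gauge_root (gauge_perm E (fun i => (- a i) `^ r^-1)). Qed.

Let F_conv a b (l : R) : (forall i, P (a i)) -> (forall i, P (b i)) -> 0 <= l <= 1 ->
  F (fun i => l * a i + (1 - l) * b i) <= l * F a + (1 - l) * F b.
Proof.
move=> Pa Pb l01; rewrite /F !mulrN -opprD lerN2.
have -> : (fun i => - (l * a i + (1 - l) * b i)) = (fun i => l * - a i + (1 - l) * - b i).
  by apply/funext => i; ring.
by apply: concave_gauge => // i; rewrite oppr_ge0; [exact: Pa|exact: Pb].
Qed.

Let F_le h g : F (fun i => - g i) <= F (fun i => - h i) -> gauge_root h <= gauge_root g.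
Proof.
have opp2 (f : 'I_N -> R) : (fun i => - - f i) = f by apply/funext => i; rewrite opprK.
rewrite /F !opp2 lerN2; apply: powR_le_inv; exact: gauge_ge0.
Qed.

Lemma gauge_root_le_stochastic (Q : 'I_N -> 'I_N -> R) h g :
  (forall i, 0 <= h i) -> (forall i k, 0 <= Q i k) ->
  (forall i, \sum_k Q i k = 1) -> (forall k, \sum_i Q i k <= 1) ->
  (forall i, g i = \sum_k Q i k * h k) ->
  gauge_root h <= gauge_root g.
Proof.
move=> h0 Q0 row col gQ; apply: F_le.
apply: (@symmetric_convex_le_stochastic R N P F P_itv F_mono F_perm F_conv Q) => //.
- by move=> i; rewrite /P oppr_le0 gQ sumr_ge0// => k _; rewrite mulr_ge0.
- by move=> i; rewrite /P oppr_le0.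
- by move=> i; rewrite row.
- by right.
- by move=> i; rewrite gQ -sumrN; apply: ler_sum => k _; rewrite mulrN.
Qed.

(** Majorization from below: as [g] is listed in increasing order, the partial sums on the right are
    those of its smallest entries. After negation, [g] plays the sorted part in
    [le_weak_majorization]. *)
Lemma gauge_root_le_tail h g : (forall i, 0 <= h i) -> (forall i, 0 <= g i) ->
  (forall i j : 'I_N, (i <= j)%N -> g i <= g j) ->
  (forall k : nat, \sum_(i < N | (i < k)%N) h i <= \sum_(i < N | (i < k)%N) g i) ->
  gauge_root h <= gauge_root g.
Proof.
move=> h0 g0 g_inc hg; apply: F_le.
apply: (@le_weak_majorization R N P F P_itv F_mono (symmetric_convex_tperm F_perm F_conv)).
- by move=> i; rewrite /P oppr_le0.
- by move=> i; rewrite /P oppr_le0.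
- by move=> i j ij; rewrite lerN2 g_inc.
- by move=> k; rewrite !sumrN lerN2.
Qed.

End ConcaveGauge.

(** Schur's observation: the diagonal of S^* S is the image of its eigenvalues under the doubly
    stochastic matrix of the |V_ki|^2, and averaging increases a symmetric concave functional. Here
    q = r = 2. *)
Lemma gauge_le_column_norms (R : realType) (n : nat) (E : symmetric_space R n)
    (S V : 'M[R[i]]_(2 ^ n)) (s : 'I_(2 ^ n) -> R) :
  concave_with_constant E 2 1 -> sv_decomp S V s ->
  gauge E s <= gauge E (fun k => Num.sqrt (\sum_i cabs (S i k) ^+ 2)).
Proof.
move=> E2 [Vu s0 SE].
pose g k := \sum_i cabs (S i k) ^+ 2.
have g0 k : 0 <= g k by apply: sumr_ge0 => i _; exact: sqr_ge0.
have := @gauge_root_le_stochastic R n E 2 2 (ltr0n _ 2) (lexx _) E2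
  (fun i k => cabs (V k i) ^+ 2) (fun k => s k ^+ 2) g.
rewrite /gauge_root.
have -> : (fun i => (s i ^+ 2) `^ 2^-1) = s.
  by apply/funext => i; rewrite powR12_sqrt ?sqr_ge0// sqrtr_sqr ger0_norm.
have -> : (fun i => g i `^ 2^-1) = (fun k => Num.sqrt (g k)).
  by apply/funext => i; rewrite powR12_sqrt.
apply.
- by move=> i; exact: sqr_ge0.
- by move=> i k; exact: sqr_ge0.
- move=> i; apply: complexI; rewrite -trmxC_mul_diag unitarymxC//.
  by rewrite mxE eqxx.
- move=> k; suff -> : \sum_i cabs (V k i) ^+ 2 = 1 by [].
  apply: complexI; have := congr1 (fun M : 'M[R[i]]_(2 ^ n) => M k k) (unitarymxP Vu).
  rewrite /= !mxE eqxx => h; rewrite rmorph1 -[RHS]h rmorph_sum; apply: eq_bigr => i _.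
  by rewrite !mxE -normCK -cabs_norm rmorphXn.
- move=> k; apply: complexI; rewrite /g -trmxC_mul_diag SE mxE rmorph_sum.
  apply: eq_bigr => i _; rewrite mul_real_diagE !mxE [RHS]rmorphM /=.
  have -> : real_complex R (cabs (V i k) ^+ 2) = V i k * ((V i k)^*)%R.
    by rewrite -normCK -cabs_norm rmorphXn.
  by rewrite /=; ring.
Qed.

(** * Rank truncation and closed walks *)

Section RankPerturbation.
Variables (R : realType) (N : nat).
Implicit Types (S T V W : 'M[R[i]]_N) (s t : 'I_N -> R).

Lemma cabs_sqrC (z : R[i]) : (cabs z ^+ 2)%:C = z * (z^*)%R.
Proof. by rewrite -normCK -cabs_norm rmorphXn. Qed.

Lemma quad_form_diag (w : 'rV[R[i]]_N) V s : V \is unitarymx ->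
  (w *m (V^t* *m real_diag s *m V) *m w^t*) 0 0 =
    (\sum_k s k * cabs ((w *m V^t*) 0 k) ^+ 2)%:C.
Proof.
move=> Vu; pose c := w *m V^t*.
have -> : w *m (V^t* *m real_diag s *m V) *m w^t* = c *m real_diag s *m c^t*.
  by rewrite /c trmxC_mul trmxCK !mulmxA.
rewrite -/c mxE rmorph_sum; apply: eq_bigr => k _.
by rewrite mul_real_diagE !mxE [RHS]rmorphM /= cabs_sqrC; ring.
Qed.

Lemma sqr_norm_diag (w : 'rV[R[i]]_N) V : V \is unitarymx ->
  (w *m w^t*) 0 0 = (\sum_k cabs ((w *m V^t*) 0 k) ^+ 2)%:C.
Proof.
move=> Vu; have := @quad_form_diag w V (fun=> 1) Vu.
have -> : real_diag (fun=> 1) = 1%:M :> 'M[R[i]]_N.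
  by apply/matrixP => i j; rewrite !mxE.
rewrite mulmx1 (unitarymxC Vu) mulmx1 => ->; congr (_ %:C).
by apply: eq_bigr => k _; rewrite mul1r.
Qed.

(** Weyl's inequality for values in increasing order. A dimension count yields a nonzero w on which
    S and T coincide; the common squared norm of its image is at least s_i^2 |w|^2, seen from S, and
    at most t_j^2 |w|^2, seen from T. *)
Lemma singular_value_rank_perturbation S T V W s t (r : nat) (i j : 'I_N) :
  sv_decomp S V s -> sv_decomp T W t ->
  (forall i j : 'I_N, (i <= j)%N -> s i <= s j) ->
  (forall i j : 'I_N, (i <= j)%N -> t i <= t j) ->
  (\rank (S - T)%R <= r)%N -> (j = i + r :> nat)%N ->
  s i <= t j.
Proof.
move=> [Vu s0 SE] [Wu t0 TE] s_inc t_inc rST jE.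
(* [A] spans the right singular directions of S of index at least i, [B] those of T of index at most
   j, and [K] the vectors where S and T agree; vectors being rows, the adjoint of [S - T] appears.
   The dimensions N - i, j + 1 and at least N - r exceed 2 N in total, so the three spaces meet. *)
pose A := copid_mx i *m V.
pose B : 'M[R[i]]_N := pid_mx j.+1 *m W.
pose K := kermx ((S - T)%R^t*).
have [w wABK w0] : exists2 w : 'rV_N, (w <= (A :&: B) :&: K)%MS & w != 0.
  apply: rowV0Pn; rewrite -mxrank_eq0 -lt0n.
  have rA : \rank A = (N - i)%N.
    by rewrite /A mxrankMfree ?row_free_unit ?unitarymx_unit// rank_copid_mx// ltnW.
  have rB : \rank B = j.+1.
    by rewrite /B mxrankMfree ?row_free_unit ?unitarymx_unit// rank_pid_mx.
  have rK : (N - r <= \rank K)%N.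
    rewrite /K mxrank_ker leq_sub2l//.
    by rewrite mxrank_map mxrank_tr.
  have h1 := mxrank_sum_cap A B; have h2 := mxrank_sum_cap (A :&: B)%MS K.
  have h3 := rank_leq_col (A + B)%MS; have h4 := rank_leq_col ((A :&: B) + K)%MS.
  move: (ltn_ord j) h1 h2 h3 h4 rK; rewrite rA rB jE.
  move: (\rank (A :&: B + K)%MS) (\rank (A :&: B :&: K)%MS) (\rank (A + B)%MS).
  by move: (\rank (A :&: B)%MS) (\rank K) => a1 a2 a3 a4 a5; lia.
move: wABK; rewrite !sub_capmx => /andP[/andP[/submxP[c cE] /submxP[d dE]] /sub_kermxP wK].
have wV (k : 'I_N) : (k < i)%N -> (w *m V^t*) 0 k = 0.
  move=> ki; rewrite cE /A mulmxA (mulmxtVK _ Vu) mxE big1// => l _.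
  rewrite /copid_mx !mxE -(val_eqE l k) /=; case: eqP => [->|_]; last by rewrite subr0 mulr0.
  by rewrite ki subrr mulr0.
have wW (k : 'I_N) : (j < k)%N -> (w *m W^t*) 0 k = 0.
  move=> jk; rewrite dE /B mulmxA (mulmxtVK _ Wu) mxE big1// => l _.
  rewrite !mxE; case: eqP => [->|_] /=; last by rewrite mulr0.
  by rewrite ltnS leqNgt jk /= mulr0.
have wST : S *m w^t* = T *m w^t*.
  apply/eqP; rewrite -subr_eq0 -mulmxBl; apply/eqP.
  by rewrite -[LHS]trmxCK trmxC_mul trmxCK wK trmx0 map_mx0.
pose n2 := \sum_k cabs ((w *m V^t*) 0 k) ^+ 2.
have n2W : n2 = \sum_k cabs ((w *m W^t*) 0 k) ^+ 2.
  by apply: complexI; rewrite /n2 -!sqr_norm_diag.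
have n2_gt0 : 0 < n2.
  rewrite lt_neqAle sumr_ge0 ?andbT; last by move=> k _; exact: sqr_ge0.
  apply: contra w0 => /eqP/esym/sum_cabs_eq0 h.
  have wV0 : w *m V^t* = 0 by apply/matrixP => a b; rewrite ord1 h mxE.
  by rewrite -(mulmxKtV w Vu erefl) wV0 mul0mx.
have eqST : \sum_k s k ^+ 2 * cabs ((w *m V^t*) 0 k) ^+ 2 =
            \sum_k t k ^+ 2 * cabs ((w *m W^t*) 0 k) ^+ 2.
  apply: complexI; rewrite -!quad_form_diag// -SE -TE !mulmxA.
  rewrite -(trmxCK w) -!trmxC_mul -!mulmxA (trmxCK w) wST.
  by rewrite !trmxC_mul.
have hs : s i ^+ 2 * n2 <= \sum_k s k ^+ 2 * cabs ((w *m V^t*) 0 k) ^+ 2.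
  rewrite /n2 mulr_sumr; apply: ler_sum => k _.
  have [ki|ik] := ltnP k i; first by rewrite wV// cabs_real normr0 expr0n !mulr0.
  by rewrite ler_wpM2r ?sqr_ge0// ler_sqr ?nnegrE// s_inc.
have ht : \sum_k t k ^+ 2 * cabs ((w *m W^t*) 0 k) ^+ 2 <= t j ^+ 2 * n2.
  rewrite n2W mulr_sumr; apply: ler_sum => k _.
  have [jk|kj] := ltnP j k; first by rewrite wW// cabs_real normr0 expr0n !mulr0.
  by rewrite ler_wpM2r ?sqr_ge0// ler_sqr ?nnegrE// t_inc.
have : s i ^+ 2 * n2 <= t j ^+ 2 * n2 by apply: le_trans hs _; rewrite eqST.
by rewrite ler_pM2r// ler_sqr ?nnegrE.
Qed.

Lemma sv_decomp_perm S V s (p : {perm 'I_N}) : sv_decomp S V s ->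
  sv_decomp S (row_perm p V) (fun k => s (p k)).
Proof.
move=> [Vu s0 SE]; split => [|k|].
- apply/unitarymxP/matrixP => i j; rewrite !mxE.
  have := congr1 (fun M : 'M[R[i]]_N => M (p i) (p j)) (unitarymxP Vu).
  rewrite /= !mxE (inj_eq perm_inj) => <-; apply: eq_bigr => k _.
  by rewrite !mxE.
- exact: s0.
rewrite SE; apply/matrixP => i j; rewrite !mxE (reindex_inj (@perm_inj _ p)).
apply: eq_bigr => k _; rewrite !mul_real_diagE !mxE; congr (_ * _ * _).
Qed.

Lemma exists_sorted_sv_decomp S : exists V s, sv_decomp S V s /\
  (forall i j : 'I_N, (i <= j)%N -> s i <= s j).
Proof.
have [V [s [sv _]]] := exists_sv_decomp S.
have [p pdec] := exists_sorting_perm (fun i => - s i).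
exists (row_perm p V), (fun k => s (p k)); split; first exact: sv_decomp_perm.
by move=> i j /pdec; rewrite lerN2.
Qed.

End RankPerturbation.

(** Weighted arithmetic-geometric mean inequality with integer exponents only. The induction
    multiplies the previous case by x and adds (x^(m+1) - y^(m+1)) (x - y) >= 0. *)
Lemma young_nat (R : realDomainType) (m : nat) (x y : R) : 0 <= x -> 0 <= y ->
  m.+1%:R * (x ^+ m * y) <= m%:R * x ^+ m.+1 + y ^+ m.+1.
Proof.
move=> x0 y0; elim: m => [|m IH]; first by rewrite !expr0 !expr1 mul0r add0r !mul1r.
have h : 0 <= (x ^+ m.+1 - y ^+ m.+1) * (x - y).
  have [xy|yx] := leP x y.
    by rewrite mulr_le0// subr_le0// lerXn2r// nnegrE.
  by rewrite mulr_ge0// subr_ge0 ?(ltW yx)// lerXn2r ?nnegrE// ltW.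
have := ler_wpM2l x0 IH.
rewrite -!natr1 !(exprS _ m.+1) in h *; rewrite !(exprS _ m) in h *.
set a := x ^+ m; set b := y ^+ m; set k : R := m%:R => IH'.
have e : k * (x * (x * a)) + (x * (x * a)) + (y * (y * b)) - (k + 1 + 1) * (x * a * y) =
   (x * (k * (x * a) + y * b) - x * ((k + 1) * (a * y))) + (x * a - y * b) * (x - y) by ring.
rewrite -subr_ge0; move: h IH'; rewrite -/a -/b => h IH'.
have -> : (k + 1) * (x * (x * a)) + y * (y * b) - (k + 1 + 1) * (x * a * y) =
  (x * (k * (x * a) + y * b) - x * ((k + 1) * (a * y))) + (x * a - y * b) * (x - y) by ring.
by rewrite addr_ge0// subr_ge0.
Qed.

(** [young_nat] at the mean [d] is the tangent line inequality for the power function; averaging it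
    removes the linear term. *)
Lemma jensen_nat (R : realFieldType) (I : finType) (p g : I -> R) (m : nat) :
  (forall i, 0 <= p i) -> \sum_i p i = 1 -> (forall i, 0 <= g i) ->
  (\sum_i p i * g i) ^+ m <= \sum_i p i * g i ^+ m.
Proof.
move=> p0 p1 g0; case: m => [|m].
  by rewrite expr0 (eq_bigr p) ?p1// => i _; rewrite expr0 mulr1.
set d := \sum_i p i * g i.
have d0 : 0 <= d by apply: sumr_ge0 => i _; rewrite mulr_ge0.
have : \sum_i p i * (m.+1%:R * (d ^+ m * g i)) <= \sum_i p i * (m%:R * d ^+ m.+1 + g i ^+ m.+1).
  by apply: ler_sum => i _; rewrite ler_wpM2l// young_nat.
have -> : \sum_i p i * (m.+1%:R * (d ^+ m * g i)) = m.+1%:R * d ^+ m.+1.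
  rewrite exprSr mulrA {3}/d mulr_sumr; apply: eq_bigr => i _; ring.
have -> : \sum_i p i * (m%:R * d ^+ m.+1 + g i ^+ m.+1) =
    m%:R * d ^+ m.+1 + \sum_i p i * g i ^+ m.+1.
  rewrite (eq_bigr _ (fun i _ => mulrDr _ _ _)) big_split/=; congr (_ + _).
  by rewrite -mulr_suml p1 mul1r.
by rewrite -natr1 mulrDl mul1r lerD2l.
Qed.

Lemma rearrangement_powers (R : realDomainType) (x y : R) (i l : nat) :
  0 <= x -> 0 <= y -> x ^+ i * y ^+ l + y ^+ i * x ^+ l <= x ^+ (i + l) + y ^+ (i + l).
Proof.
move=> x0 y0; rewrite -subr_ge0.
have -> : x ^+ (i + l) + y ^+ (i + l) - (x ^+ i * y ^+ l + y ^+ i * x ^+ l) =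
   (x ^+ i - y ^+ i) * (x ^+ l - y ^+ l) by rewrite !exprD; ring.
have [xy|yx] := leP x y.
  by rewrite mulr_le0// subr_le0 lerXn2r.
by rewrite mulr_ge0// subr_ge0 lerXn2r// ltW.
Qed.

(** The order is that of R[i], so [mx_le 0 A] also says that the entries are real. *)
Definition mx_le (R : realType) (m n : nat) (A B : 'M[R[i]]_(m, n)) :=
  forall i j, A i j <= B i j.

Lemma mx_le_mul (R : realType) (m n p : nat) (A A' : 'M[R[i]]_(m, n)) (B B' : 'M[R[i]]_(n, p)) :
  mx_le 0 A -> mx_le 0 B -> mx_le A A' -> mx_le B B' -> mx_le (A *m B) (A' *m B').
Proof.
move=> A0 B0 AA BB i j; rewrite !mxE; apply: ler_sum => k _.
by apply: ler_pM; [have := A0 i k|have := B0 k j|exact: AA|exact: BB]; rewrite mxE.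
Qed.

Lemma mx_le_add (R : realType) (m n : nat) (A A' B B' : 'M[R[i]]_(m, n)) :
  mx_le A A' -> mx_le B B' -> mx_le (A + B) (A' + B').
Proof. by move=> AA BB i j; rewrite !mxE lerD. Qed.

Lemma mx_le_refl (R : realType) (m n : nat) (A : 'M[R[i]]_(m, n)) : mx_le A A.
Proof. by move=> i j. Qed.

Lemma mx_le_trans (R : realType) (m n : nat) (A B C : 'M[R[i]]_(m, n)) :
  mx_le A B -> mx_le B C -> mx_le A C.
Proof. by move=> AB BC i j; exact: le_trans (AB i j) (BC i j). Qed.

Lemma mx_ge0_mul (R : realType) (m n p : nat) (A : 'M[R[i]]_(m, n)) (B : 'M[R[i]]_(n, p)) :
  mx_le 0 A -> mx_le 0 B -> mx_le 0 (A *m B).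
Proof.
move=> A0 B0 i j; rewrite !mxE; apply: sumr_ge0 => k _.
by apply: mulr_ge0; [have := A0 i k|have := B0 k j]; rewrite mxE.
Qed.

Lemma mx_ge0_exp (R : realType) (n : nat) (A : 'M[R[i]]_n) (k : nat) :
  mx_le 0 A -> mx_le 0 (A ^+ k).
Proof.
move=> A0; elim: k => [|k IH]; last by rewrite exprS -mulmxE; exact: mx_ge0_mul.
by move=> i j; rewrite expr0 !mxE ler0n.
Qed.

Lemma mx_le_exp (R : realType) (n : nat) (A B : 'M[R[i]]_n) (k : nat) :
  mx_le 0 A -> mx_le A B -> mx_le (A ^+ k) (B ^+ k).
Proof.
move=> A0 AB; elim: k => [|k IH]; first exact: mx_le_refl.
by rewrite !exprS -!mulmxE; apply: mx_le_mul => //; exact: mx_ge0_exp.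
Qed.

Lemma mx_le_mxtrace (R : realType) (n : nat) (A B : 'M[R[i]]_n) :
  mx_le A B -> \tr A <= \tr B.
Proof. by move=> AB; apply: ler_sum => i _; exact: AB. Qed.


Lemma hermitian_spectral (R : realType) (N : nat) (A : 'M[R[i]]_N) : A^t* = A ->
  exists (V : 'M[R[i]]_N) (mu : 'I_N -> R),
    V \is unitarymx /\ A = V^t* *m real_diag mu *m V.
Proof.
move=> hA; have /orthomx_spectralP eA : A \is normalmx by apply/normalmxP; rewrite hA.
have Ah : A \is hermsymmx by apply/is_hermitianmxP; rewrite expr0 scale1r hA.
have rs := hermitian_spectral_diag_real Ah.
exists (spectralmx A), (fun k => complex.Re (spectral_diag A ord0 k)).
have u := spectral_unitarymx A; split; first exact: u.
have dE : diag_mx (spectral_diag A) =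
    real_diag (fun k => complex.Re (spectral_diag A ord0 k)).
  apply/matrixP => i k; rewrite !mxE; case: eqP => [->|_]; last by rewrite !mulr0n.
  by rewrite !mulr1n RRe_real//; move/mxOverP: rs; exact.
by rewrite [LHS]eA (invmx_unitary u) dE.
Qed.

Lemma spectral_exp (R : realType) (N : nat) (A V : 'M[R[i]]_N) (mu : 'I_N -> R) k :
  V \is unitarymx -> A = V^t* *m real_diag mu *m V ->
  A ^+ k = V^t* *m real_diag (fun x => mu x ^+ k) *m V.
Proof.
move=> Vu eA; elim: k => [|k IH].
  have -> : real_diag (fun x => mu x ^+ 0) = 1%:M :> 'M[R[i]]_N.
    by apply/matrixP => i j; rewrite !mxE expr0.
  by rewrite mulmx1 (unitarymxC Vu) expr0.
have DD : real_diag mu *m real_diag (fun x => mu x ^+ k) = real_diag (fun x => mu x ^+ k.+1).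
  apply/matrixP => i j; rewrite /real_diag mulmx_diag !mxE; congr (_ *+ _).
  by rewrite -rmorphM exprS.
rewrite exprS -mulmxE {1}eA IH !mulmxA (mulmxtVK _ Vu).
by rewrite -(mulmxA (V^t*) (real_diag mu)) DD.
Qed.

Lemma mxtrace_exp (R : realType) (N : nat) (A V : 'M[R[i]]_N) (mu : 'I_N -> R) k :
  V \is unitarymx -> A = V^t* *m real_diag mu *m V ->
  \tr (A ^+ k) = (\sum_x mu x ^+ k)%:C.
Proof.
move=> Vu eA; rewrite (spectral_exp _ Vu eA) mxtrace_mulC mulmxA (unitarymxP Vu) mul1mx.
by rewrite /mxtrace rmorph_sum; apply: eq_bigr => x _; rewrite !mxE eqxx mulr1n.
Qed.

(** * Traces of powers and closed walks *)

Section ClosedWalks.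
Variables (R : realType) (N : nat) (J : finType).
Local Notation C := R[i].
(** [b j] stands for the weighted edges of direction j and [Z j] for multiplication by the sign of
    coordinate j: crossing an edge of direction j changes that sign and no other. *)
Variables (b Z : J -> 'M[C]_N) (d : 'I_N -> R).
Local Notation B := (\sum_j b j).
Hypothesis b_ge0 : forall j, mx_le 0 (b j).
Hypothesis b_sym : forall j, (b j)^t* = b j.
Hypothesis Z_sqr : forall j, Z j *m Z j = 1%:M.
Hypothesis Z_anti : forall j, Z j *m b j = - (b j *m Z j).
Hypothesis Z_comm : forall j k, k != j -> Z j *m b k = b k *m Z j.
Hypothesis b_sqr : \sum_j b j *m b j = real_diag d.

Let B_ge0 : mx_le 0 B.
Proof.
by move=> x y; rewrite summxE !mxE; apply: sumr_ge0 => j _; have := b_ge0 j x y; rewrite mxE.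
Qed.

Let rest j := \sum_(k | k != j) b k.

Let restE j : B = b j + rest j. Proof. by rewrite (bigD1 j). Qed.

Let rest_ge0 j : mx_le 0 (rest j).
Proof.
by move=> x y; rewrite summxE !mxE; apply: sumr_ge0 => k _; have := b_ge0 k x y; rewrite mxE.
Qed.

Let rest_le j : mx_le (rest j) B.
Proof.
by move=> x y; rewrite (restE j) [leRHS]mxE lerDr; have := b_ge0 j x y; rewrite mxE.
Qed.

(** A walk that uses direction j exactly once cannot close: conjugation by [Z j] fixes [rest j] and
    negates [b j], so the trace equals its opposite. *)
Let mxtrace_rest j M : \tr (b j *m rest j ^+ M) = 0.
Proof.
have ZC : Z j *m rest j = rest j *m Z j.
  by rewrite /rest mulmx_sumr mulmx_suml; apply: eq_bigr => k; exact: Z_comm.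
have ZCM : Z j *m rest j ^+ M = rest j ^+ M *m Z j.
  elim: M => [|M IH]; first by rewrite !expr0 mulmx1 mul1mx.
  by rewrite exprS -mulmxE mulmxA ZC -mulmxA IH mulmxA.
have e : Z j *m (b j *m rest j ^+ M) *m Z j = - (b j *m rest j ^+ M).
  rewrite mulmxA Z_anti !mulNmx -!mulmxA -ZCM; congr (- (_ *m _)).
  by rewrite mulmxA Z_sqr mul1mx.
have : \tr (b j *m rest j ^+ M) = - \tr (b j *m rest j ^+ M).
  have := congr1 mxtrace e.
  by rewrite (mxtrace_mulC _ (Z j)) (mulmxA (Z j) (Z j)) Z_sqr mul1mx raddfN.
by move/eqP; rewrite -addr_eq0 -mulr2n mulrn_eq0 => /eqP.
Qed.

(** A word in the edge operators either avoids [b j] or has a rightmost factor [b j], at some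
    position i. What follows that factor is then bounded by powers of the full sum. *)
Let expr_le j M : mx_le (B ^+ M)
  (rest j ^+ M + \sum_(i < M) B ^+ i *m b j *m B ^+ (M.-1 - i)).
Proof.
elim: M => [|M IH]; first by rewrite big_ord0 addr0 !expr0; exact: mx_le_refl.
rewrite exprS -mulmxE big_ord_recl /=.
apply: mx_le_trans (mx_le_mul B_ge0 (mx_ge0_exp _ B_ge0) (mx_le_refl _) IH) _.
have -> : B *m (rest j ^+ M + \sum_(i < M) B ^+ i *m b j *m B ^+ (M.-1 - i)) =
    rest j ^+ M.+1 + (b j *m rest j ^+ M +
      B *m \sum_(i < M) B ^+ i *m b j *m B ^+ (M.-1 - i)).
  rewrite mulmxDr exprS -mulmxE addrA; congr (_ + _).
  by rewrite {1}(restE j) mulmxDl addrC.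
apply: mx_le_add; first exact: mx_le_refl.
apply: mx_le_add.
  rewrite expr0 mul1mx subn0; apply: mx_le_mul.
  - exact: b_ge0.
  - exact: mx_ge0_exp.
  - exact: mx_le_refl.
  - exact: mx_le_exp.
rewrite mulmx_sumr => x y; rewrite !summxE; apply: ler_sum => i _.
rewrite /bump /= exprS -mulmxE !mulmxA.
by have -> : (M - (1 + i) = M.-1 - i)%N by lia.
Qed.

Let closed_walk_le j M : \tr (b j *m B ^+ M) <=
  \sum_(i < M) \tr (b j *m B ^+ i *m b j *m B ^+ (M.-1 - i)).
Proof.
have := mx_le_mul (b_ge0 j) (mx_ge0_exp M B_ge0) (mx_le_refl _) (expr_le j M).
move=> /mx_le_mxtrace; rewrite mulmxDr mxtraceD (mxtrace_rest j M) add0r.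
rewrite mulmx_sumr raddf_sum /= => /le_trans; apply.
by apply: ler_sum => i _; rewrite !mulmxA.
Qed.

Let B_sym : B^t* = B.
Proof.
rewrite (raddf_sum (@trmx C N N)) (raddf_sum (map_mx Num.conj_op)).
by apply: eq_bigr => j _; exact: b_sym.
Qed.

Let exists_spectral : exists (V : 'M[C]_N) (mu : 'I_N -> R), V \is unitarymx /\ B = V^t* *m real_diag mu *m V.
Proof. exact: hermitian_spectral. Qed.

Let mxtrace_spectral (V : 'M[C]_N) (mu : 'I_N -> R) (A : 'M[C]_N) i l : V \is unitarymx ->
  B = V^t* *m real_diag mu *m V -> A^t* = A ->
  \tr (A *m B ^+ i *m A *m B ^+ l) =
  (\sum_x \sum_y cabs ((V *m A *m V^t*) x y) ^+ 2 * (mu y ^+ i * mu x ^+ l))%:C.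
Proof.
move=> Vu BE AC; pose A' := V *m A *m V^t*.
have A'C : A'^t* = A' by rewrite /A' !trmxC_mul trmxCK AC mulmxA.
have -> : \tr (A *m B ^+ i *m A *m B ^+ l) =
    \tr (A' *m real_diag (fun x => mu x ^+ i) *m (A' *m real_diag (fun x => mu x ^+ l))).
  rewrite !(spectral_exp _ Vu BE) !mulmxA mxtrace_mulC /A' !mulmxA.
  by congr (\tr _).
rewrite -/A' /mxtrace rmorph_sum; apply: eq_bigr => x _.
rewrite mxE rmorph_sum; apply: eq_bigr => y _; rewrite !mul_real_diagE.
have -> : A' y x = ((A' x y)^*)%R by rewrite -{1}A'C !mxE.
by rewrite [RHS]rmorphM /= cabs_sqrC [in RHS]rmorphM /=; ring.
Qed.

(** In an eigenbasis both sides are sums of mu_y^i mu_x^l against the same symmetric nonnegative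
    weights. Symmetrizing in x and y leaves [rearrangement_powers] for |mu_x| and |mu_y|; as i + l
    is even, the moduli do not change the right-hand side. *)
Let crossing_le j i l : ~~ odd (i + l) ->
  \tr (b j *m B ^+ i *m b j *m B ^+ l) <= \tr (b j *m b j *m B ^+ (i + l)).
Proof.
move=> evenL; have [V [mu [Vu BE]]] := exists_spectral.
have -> : b j *m b j = b j *m B ^+ 0 *m b j by rewrite expr0 mulmx1.
rewrite !(mxtrace_spectral _ _ Vu BE (b_sym j)) lecR.
set a := fun x y => cabs ((V *m b j *m V^t*) x y) ^+ 2.
rewrite -[leLHS]/(\sum_x \sum_y a x y * (mu y ^+ i * mu x ^+ l)).
rewrite -[leRHS]/(\sum_x \sum_y a x y * (mu y ^+ 0 * mu x ^+ (i + l))).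
have a_sym x y : a x y = a y x.
  have h : (V *m b j *m V^t*)^t* = V *m b j *m V^t*.
    by rewrite !trmxC_mul trmxCK b_sym mulmxA.
  rewrite /a; congr (_ ^+ 2); apply: complexI; rewrite !cabs_norm.
  by rewrite -[in LHS]h !mxE norm_conjC.
have sym_sum (F : 'I_N -> 'I_N -> R) : \sum_x \sum_y a x y * F x y =
    2^-1 * \sum_x \sum_y a x y * (F x y + F y x).
  have h : \sum_x \sum_y a x y * F y x = \sum_x \sum_y a x y * F x y.
    rewrite exchange_big; apply: eq_bigr => x _; apply: eq_bigr => y _.
    by rewrite a_sym.
  have -> : \sum_x \sum_y a x y * (F x y + F y x) =
      \sum_x \sum_y a x y * F x y + \sum_x \sum_y a x y * F y x.
    rewrite -big_split; apply: eq_bigr => x _ /=.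
    by rewrite -big_split; apply: eq_bigr => y _ /=; rewrite mulrDr.
  by rewrite h; field.
rewrite sym_sum [leRHS]sym_sum ler_wpM2l//; apply: ler_sum => x _; apply: ler_sum => y _.
apply: ler_wpM2l; first exact: sqr_ge0.
have absL (z : R) : z ^+ (i + l) = `|z| ^+ (i + l).
  by rewrite -normrX ger0_norm// exprn_even_ge0.
rewrite !expr0 !mul1r (absL (mu x)) (absL (mu y)); apply: le_trans (rearrangement_powers i l _ _) => //.
have h (u v : R) : u ^+ i * v ^+ l <= `|u| ^+ i * `|v| ^+ l.
  by rewrite -!normrX -normrM ler_norm.
by rewrite addrC; apply: lerD; exact: h.
Qed.

Lemma mxtrace_pow_le (m : nat) : \tr (B ^+ m.*2.+2) <=
  (m.*2.+1)%:R * \tr (real_diag d *m B ^+ m.*2).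
Proof.
rewrite exprS -mulmxE {1}mulmx_suml raddf_sum /=.
rewrite -b_sqr mulmx_suml raddf_sum mulr_sumr /=; apply: ler_sum => j _.
apply: le_trans (closed_walk_le _ _) _.
rewrite -[in leRHS](card_ord m.*2.+1) mulr_natl -sumr_const; apply: ler_sum => i _ /=.
have iL : (i + (m.*2 - i) = m.*2)%N by have := ltn_ord i; lia.
rewrite -[in leRHS]iL; apply: crossing_le.
by rewrite iL odd_double.
Qed.

(* Closed walks: every step in a direction j is matched by another one, so
   tr (B_j B^k) <= sum_i tr (B_j B^i B_j B^(k-1-i)) <= k tr (B_j^2 B^(k-1)) for
   odd k, and sum_j B_j^2 is diagonal; Young and Jensen close the recursion. *)
Lemma mxtrace_pow_bound (m : nat) :
  \tr (B ^+ m.+1.*2) <= ((m.*2.+1)%:R ^+ m.+1 * \sum_x d x ^+ m.+1)%:C.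
Proof.
have [V [mu [Vu BE]]] := exists_spectral.
have d0 x : 0 <= d x.
  rewrite -lecR; have := congr1 (fun M : 'M[C]_N => M x x) b_sqr.
  rewrite /= summxE !mxE eqxx mulr1n => <-; apply: sumr_ge0 => j _.
  by have := mx_ge0_mul (b_ge0 j) (b_ge0 j) x x; rewrite mxE.
have trB k := mxtrace_exp k Vu BE.
pose p a x := cabs (V a x) ^+ 2.
have p_row a : \sum_x p a x = 1.
  apply: complexI; have := congr1 (fun M : 'M[C]_N => M a a) (unitarymxP Vu).
  rewrite /= !mxE eqxx => h; rewrite rmorph1 -[RHS]h rmorph_sum; apply: eq_bigr => x _.
  by rewrite !mxE /p -normCK -cabs_norm rmorphXn.
have p_col x : \sum_a p a x = 1.
  by apply: complexI; rewrite -trmxC_mul_diag (unitarymxC Vu) mxE eqxx.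
pose del a := \sum_x p a x * d x.
have del0 a : 0 <= del a by apply: sumr_ge0 => x _; rewrite mulr_ge0 ?sqr_ge0.
have trdB k : \tr (real_diag d *m B ^+ k) = (\sum_a mu a ^+ k * del a)%:C.
  rewrite (spectral_exp _ Vu BE) mulmxA mxtrace_mulC !mulmxA /mxtrace rmorph_sum.
  apply: eq_bigr => a _; rewrite mul_real_diagE mulrC rmorphM; congr (_ * _).
  rewrite mxE /del rmorph_sum; apply: eq_bigr => x _.
  by rewrite mul_real_diagE !mxE rmorphM /= /p (rmorphXn (real_complex R)) /= cabs_norm normCK; ring.
set c : R := (m.*2.+1)%:R.
have c0 : 0 <= c by rewrite ler0n.
have key : \sum_a mu a ^+ m.+1.*2 <= c * \sum_a mu a ^+ m.*2 * del a.
  have := mxtrace_pow_le m; rewrite trdB doubleS trB.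
  by rewrite -(rmorph_nat (real_complex R)) -rmorphM lecR.
(* Young's inequality with x = mu^2 and y = c del: the sum it produces with factor m is absorbed by
   m of the m + 1 copies of [key]. *)
have young : m.+1%:R * (c * \sum_a mu a ^+ m.*2 * del a) <=
    m%:R * \sum_a mu a ^+ m.+1.*2 + c ^+ m.+1 * \sum_a del a ^+ m.+1.
  rewrite !mulr_sumr -big_split; apply: ler_sum => a _ /=.
  have := @young_nat R m (mu a ^+ 2) (c * del a) (sqr_ge0 _) (mulr_ge0 c0 (del0 a)).
  rewrite -!exprM !mul2n => h; rewrite -exprMn.
  have -> : m.+1%:R * (c * (mu a ^+ m.*2 * del a)) =
    m.+1%:R * (mu a ^+ m.*2 * (c * del a)) by ring.
  exact: h.
have del_le : \sum_a del a ^+ m.+1 <= \sum_x d x ^+ m.+1.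
  apply: (@le_trans _ _ (\sum_a \sum_x p a x * d x ^+ m.+1)).
    apply: ler_sum => a _; apply: jensen_nat => // x; exact: sqr_ge0.
  rewrite exchange_big le_eqVlt; apply/orP; left; apply/eqP; apply: eq_bigr => x _ /=.
  by rewrite -mulr_suml p_col mul1r.
rewrite trB lecR.
have := ler_wpM2l (ler0n _ m.+1) key => h1.
have := le_trans h1 young; rewrite -natr1 mulrDl mul1r lerD2l => /le_trans; apply.
by rewrite ler_wpM2l// exprn_ge0.
Qed.

End ClosedWalks.

Lemma singular_values_powers (R : realType) (N : nat) (S V : 'M[R[i]]_N)
    (s : 'I_N -> R) (m : nat) : sv_decomp S V s ->
  \tr ((S^t* *m S) ^+ m) = (\sum_k s k ^+ m.*2)%:C.
Proof.
move=> [Vu _ SE]; rewrite (mxtrace_exp m Vu SE); congr (_ %:C).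
by apply: eq_bigr => k _; rewrite -exprM mul2n.
Qed.

Definition mx_dom (R : realType) (m n : nat) (A B : 'M[R[i]]_(m, n)) :=
  forall i j, `|A i j| <= B i j.

Lemma mx_dom_mul (R : realType) (m n p : nat) (A A' : 'M[R[i]]_(m, n))
    (B B' : 'M[R[i]]_(n, p)) :
  mx_dom A A' -> mx_dom B B' -> mx_dom (A *m B) (A' *m B').
Proof.
move=> AA BB i j; rewrite !mxE; apply: le_trans (ler_norm_sum _ _ _) _.
by apply: ler_sum => k _; rewrite normrM ler_pM.
Qed.

Lemma mx_dom_exp (R : realType) (n : nat) (A B : 'M[R[i]]_n) (k : nat) :
  mx_dom A B -> mx_dom (A ^+ k) (B ^+ k).
Proof.
move=> AB; elim: k => [|k IH]; last by rewrite !exprS -!mulmxE; exact: mx_dom_mul.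
by move=> i j; rewrite !expr0 !mxE ger0_norm ?ler0n.
Qed.

Lemma mx_dom_mxtrace (R : realType) (n : nat) (A B : 'M[R[i]]_n) :
  mx_dom A B -> `|\tr A| <= \tr B.
Proof.
by move=> AB; apply: le_trans (ler_norm_sum _ _ _) _; apply: ler_sum => i _; exact: AB.
Qed.

Lemma mxrank_real_diag_le (R : realType) (N : nat) (u : 'I_N -> R) :
  (\rank (real_diag u) <= #|[pred i | (u i != 0)%R]|)%N.
Proof.
have -> : real_diag u = \sum_(i | u i != 0) (u i)%:C *: delta_mx i i.
  apply/matrixP => i j; rewrite !mxE summxE.
  under eq_bigr do rewrite !mxE.
  have [<-|ij] := eqVneq i j; last first.
    rewrite mulr0n big1// => k _; case: eqP => [<-|_]; last by rewrite mulr0.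
    by rewrite eq_sym (negPf ij) mulr0.
  rewrite mulr1n big_mkcond (bigD1 i)//= !eqxx mulr1 big1 ?addr0.
    by case: eqP => // ->.
  by move=> k ki; case: ifP => // _; rewrite eq_sym (negPf ki) mulr0.
rewrite -sum1_card; elim/big_rec2: _ => [|i n A _ IH]; first by rewrite mxrank0.
apply: leq_trans (mxrank_add _ _) _; apply: leq_add => //.
by apply: leq_trans (mxrank_scale _ _) _; rewrite mxrank_delta.
Qed.

(** * Matrices supported on the edges of the cube *)

Section CubeMatrices.
Variables (R : realType) (n : nat).
Local Notation N := (2 ^ n)%N.
Implicit Types (c : 'I_n -> 'I_N -> R[i]).

Definition flip (j : 'I_n) (x : 'I_N) : 'I_N :=
  cube_rank (cube_mul (cube_val x) (cube_e j)).

Lemma flipE j x i : cube_val (flip j x) i = cube_val x i (+) (i == j).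
Proof. by rewrite /flip cube_rankK /cube_mul /cube_e !ffunE. Qed.

Lemma cube_val_eq (x y : 'I_N) : (forall i, cube_val x i = cube_val y i) -> x = y.
Proof. by move=> xy; apply: cube_val_inj; apply/ffunP. Qed.

Lemma flipK j : involutive (flip j).
Proof. by move=> x; apply: cube_val_eq => i; rewrite !flipE -addbA addbb addbF. Qed.

Lemma flip_eq j k x : (flip j x == flip k x) = (j == k).
Proof.
apply/eqP/eqP => [h|->//]; have := congr1 (fun y => cube_val y j) h.
by rewrite /= !flipE eqxx => /addbI/esym/eqP.
Qed.

(** At most one term of each sum is nonzero, the neighbours [flip j x] being distinct by
    [flip_eq]. *)
Definition neighbor_mx c : 'M[R[i]]_N :=
  \matrix_(x, y) \sum_j (if y == flip j x then c j x else 0).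

Definition edge_sqr c (x : 'I_N) : R := \sum_j cabs (c j x) ^+ 2.

Lemma neighbor_mx_column c (y : 'I_N) :
  (forall j x, cabs (c j (flip j x)) = cabs (c j x)) ->
  \sum_x cabs (neighbor_mx c x y) ^+ 2 = edge_sqr c y.
Proof.
move=> c_sym.
transitivity (\sum_x \sum_j if y == flip j x then cabs (c j x) ^+ 2 else 0).
  apply: eq_bigr => x _; rewrite mxE.
  have [j /eqP yj|no] := pickP (fun j => y == flip j x).
    rewrite (bigD1 j)//= yj eqxx big1 ?addr0.
      rewrite (bigD1 j)//= eqxx big1 ?addr0// => k kj.
      by rewrite flip_eq eq_sym (negPf kj).
    by move=> k kj; rewrite flip_eq eq_sym (negPf kj).
  rewrite big1 ?big1 ?cabs_real ?normr0 ?expr0n//.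
  - by move=> j _; rewrite no.
  - by move=> j _; rewrite no.
rewrite exchange_big; apply: eq_bigr => j _.
rewrite (bigD1 (flip j y))//= flipK eqxx c_sym big1 ?addr0// => x xy.
by case: eqP => // yx; rewrite yx flipK eqxx in xy.
Qed.

(** Passing to the moduli of the coefficients can only increase the trace, and makes both the matrix
    and its adjoint bounded by one symmetric sum of edge operators. [b j] exchanges x and
    [flip j x], so its square is diagonal, and summing over j gives [edge_sqr c]. *)
Lemma neighbor_mx_mxtrace_le c (m : nat) :
  (forall j x, cabs (c j (flip j x)) = cabs (c j x)) ->
  \tr (((neighbor_mx c)^t* *m neighbor_mx c) ^+ m.+1) <=
    ((m.*2.+1)%:R ^+ m.+1 * \sum_x edge_sqr c x ^+ m.+1)%:C.
Proof.
move=> c_sym.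
pose b j : 'M[R[i]]_N := \matrix_(x, y) (if y == flip j x then (cabs (c j x))%:C else 0).
pose Z (j : 'I_n) : 'M[R[i]]_N := real_diag (fun x => (-1) ^+ (cube_val x j)).
have b0 j : mx_le 0 (b j).
  by move=> x y; rewrite !mxE; case: ifP => // _; rewrite ler0c cabs_ge0.
have flip_swap j (x y : 'I_N) : (y == flip j x) = (x == flip j y).
  by apply/eqP/eqP => ->; rewrite flipK.
have bC j : (b j)^t* = b j.
  apply/matrixP => x y; rewrite !mxE flip_swap; case: eqP => [->|_]; last by rewrite conjC0.
  by rewrite conj_Creal ?complex_real// c_sym.
have ZZ j : Z j *m Z j = 1%:M.
  apply/matrixP => x y; rewrite /Z mul_real_diagE !mxE; case: eqP => [->|_] /=.
    by rewrite !mulr1n -rmorphM -expr2 sqrr_sign.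
  by rewrite !mulr0n mul0r.
have Zb j k x y : (Z j *m b k) x y = ((-1) ^+ (cube_val x j))%:C * b k x y.
  by rewrite mul_diag_mx !mxE.
have bZ j k x y : (b k *m Z j) x y = b k x y * ((-1) ^+ (cube_val y j))%:C.
  by rewrite mul_real_diagE.
have Zanti j : Z j *m b j = - (b j *m Z j).
  apply/matrixP => x y; rewrite Zb [RHS]mxE bZ !mxE; case: eqP => [->|_]; last first.
    by rewrite mulr0 mul0r oppr0.
  rewrite flipE eqxx addbT mulrC -mulrN; congr (_ * _).
  by rewrite -rmorphN; case: (cube_val x j); rewrite /= ?expr0 ?expr1 ?opprK.
have Zcomm j k : k != j -> Z j *m b k = b k *m Z j.
  move=> kj; apply/matrixP => x y; rewrite Zb bZ !mxE; case: eqP => [->|_]; last first.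
    by rewrite mulr0 mul0r.
  by rewrite flipE eq_sym (negPf kj) addbF mulrC.
have bb : \sum_j b j *m b j = real_diag (edge_sqr c).
  apply/matrixP => x z; rewrite summxE !mxE.
  have e j : (b j *m b j) x z = (x == z)%:R * (cabs (c j x) ^+ 2)%:C.
    rewrite mxE (bigD1 (flip j x))//= !mxE eqxx flipK c_sym big1 ?addr0.
      rewrite eq_sym; case: eqP => _; last by rewrite mulr0 mul0r.
      by rewrite mul1r -rmorphM.
    by move=> y yx; rewrite !mxE (negPf yx) mul0r.
  rewrite (eq_bigr _ (fun j _ => e j)) -mulr_sumr /edge_sqr rmorph_sum mulr_natl.
  by case: eqP.
have dom : mx_dom (neighbor_mx c) (\sum_j b j).
  move=> x y; rewrite mxE summxE; apply: le_trans (ler_norm_sum _ _ _) _.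
  by apply: ler_sum => j _; rewrite mxE; case: ifP => _; rewrite ?normr0 -?cabs_norm.
have domC : mx_dom ((neighbor_mx c)^t*) (\sum_j b j).
  move=> x y; rewrite !mxE norm_conjC summxE; have := dom y x; rewrite mxE => /le_trans; apply.
  rewrite summxE; apply: ler_sum => j _; rewrite -[in leLHS]bC !mxE.
  by case: ifP => _; rewrite ?conjC0// conj_Creal ?complex_real.
have := mx_dom_mxtrace (mx_dom_exp m.+1 (mx_dom_mul domC dom)).
move=> h; apply: le_trans (mxtrace_pow_bound b0 bC ZZ Zanti Zcomm bb m).
have -> : (\sum_j b j) ^+ m.+1.*2 = ((\sum_j b j) *m \sum_j b j) ^+ m.+1.
  by rewrite mulmxE -expr2 -exprM mul2n.
apply: le_trans h; rewrite real_ler_norm//.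
have [V [s [sv _]]] := exists_sv_decomp (neighbor_mx c).
by rewrite (singular_values_powers _ sv) complex_real.
Qed.

End CubeMatrices.

Section Truncation.
Variables (R : realType) (n : nat).
Local Notation N := (2 ^ n)%N.
Variable c : 'I_n -> 'I_N -> R[i].
Hypothesis c_sym : forall j x, cabs (c j (flip j x)) = cabs (c j x).
Local Notation S := (neighbor_mx c).

(* Deleting the rows and columns of k indices changes S by a matrix of rank at
   most 2k. *)
Lemma tail_singular_values V (s : 'I_N -> R) (m k : nat) (p : {perm 'I_N}) :
  sv_decomp S V s -> (forall i j : 'I_N, (i <= j)%N -> s i <= s j) ->
  \sum_(i < N | (i < N - k.*2)%N) s i ^+ m.+1.*2 <=
    (m.*2.+1)%:R ^+ m.+1 * \sum_(i < N | (i < N - k)%N) edge_sqr c (p i) ^+ m.+1.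
Proof.
move=> sv s_inc.
(* [p] lists the vertices in such a way that the deleted ones occupy the last k positions. *)
pose keep x := ((p^-1%g x : 'I_N) < N - k)%N.
pose c' j x := if keep x && keep (flip j x) then c j x else 0.
have c'_sym j x : cabs (c' j (flip j x)) = cabs (c' j x).
  by rewrite /c' flipK andbC; case: ifP.
have [W [t [tv t_inc]]] := exists_sorted_sv_decomp (neighbor_mx c').
have ht := neighbor_mx_mxtrace_le m c'_sym.
have {}t0 : forall i, 0 <= t i by case: tv.
rewrite (singular_values_powers _ tv) lecR in ht.
have edge' x : edge_sqr c' x <= if keep x then edge_sqr c x else 0.
  rewrite /edge_sqr /c'; case: ifP => kx; last first.
    by rewrite big1// => j _; rewrite cabs_real normr0 expr0n.
  apply: ler_sum => j _; case: ifP => _; first exact: lexx.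
  by rewrite cabs_real normr0 expr0n sqr_ge0.
have edge0 u x : 0 <= edge_sqr u x by apply: sumr_ge0 => j _; exact: sqr_ge0.
have hd : \sum_x edge_sqr c' x ^+ m.+1 <=
    \sum_(i < N | (i < N - k)%N) edge_sqr c (p i) ^+ m.+1.
  rewrite (reindex_inj (@perm_inj _ p)) [leRHS]big_mkcond /=; apply: ler_sum => i _.
  have := edge' (p i); rewrite /keep permK; case: ifP => _ h.
    by rewrite lerXn2r// nnegrE edge0.
  have /eqP -> : edge_sqr c' (p i) == 0 by rewrite eq_le h edge0.
  by rewrite expr0n.
apply: (@le_trans _ _ (\sum_l t l ^+ m.+1.*2)); last first.
  by apply: le_trans ht _; rewrite ler_wpM2l// exprn_ge0.
pose P : 'M[R[i]]_N := real_diag (fun x => (keep x)%:R).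
pose Q : 'M[R[i]]_N := real_diag (fun x => (~~ keep x)%:R).
have rQ : (\rank Q <= k)%N.
  apply: leq_trans (mxrank_real_diag_le _) _.
  rewrite -sum1_card big_mkcond /= (reindex_inj (@perm_inj _ p)) /=.
  rewrite (eq_bigr (fun i : 'I_N => (N - k <= i)%N : nat)); last first.
    move=> i _; rewrite inE /keep permK -leqNgt.
    by case: (N - k <= i)%N; rewrite ?eqxx// oner_eq0.
  rewrite -(big_mkord xpredT (fun i => (N - k <= i)%N : nat)).
  rewrite (big_cat_nat (n := N - k)) ?leq_subr//= big_nat_cond big1 ?add0n; last first.
    by move=> i /andP[/andP[_ ik] _]; rewrite leqNgt ik.
  apply: (@leq_trans (\sum_(N - k <= i < N) 1)%N).
    by apply: leq_sum => i _; exact: leq_b1.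
  by rewrite sum_nat_const_nat muln1; lia.
have S'E x y : neighbor_mx c' x y = if keep x && keep y then S x y else 0.
  rewrite !mxE /c'; case: ifP => k12; last first.
    by rewrite big1// => j _; case: eqP => // <-; rewrite k12.
  by apply: eq_bigr => j _; case: eqP => // <-; rewrite k12.
have rST : (\rank (S - neighbor_mx c')%R <= k.*2)%N.
  (* The deleted rows [Q *m S], then the deleted columns of the kept rows; each has rank at most k
     because [Q] does. *)
  have -> : S - neighbor_mx c' = Q *m S + P *m S *m Q.
    apply/matrixP => x y; rewrite [LHS]mxE [X in _ + X]mxE S'E [RHS]mxE mul_real_diagE.
    rewrite !mul_diag_mx !(mxE matrix_key).
    case: (keep x) => /=; case: (keep y); rewrite ?rmorph1 ?rmorph0; ring.
  rewrite -addnn; apply: leq_trans (mxrank_add _ _) (leq_add _ _).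
    exact: leq_trans (mxrankM_maxl _ _) rQ.
  exact: leq_trans (mxrankM_maxr _ _) rQ.
have st (i j : 'I_N) : (j = i + k.*2 :> nat)%N -> s i <= t j.
  exact: (singular_value_rank_perturbation sv tv s_inc t_inc rST).
have N_gt0 : (0 < N)%N by rewrite expn_gt0.
(* A cyclic shift by 2k is injective on all indices; those that wrap around are outside the range of
   the left-hand sum and contribute 0 there. *)
pose sh (i : 'I_N) : 'I_N := Ordinal (ltn_pmod (i + k.*2) N_gt0).
have sh_inj : injective sh.
  move=> i j /(congr1 val) /= /eqP; rewrite eqn_modDr !modn_small// => /eqP.
  exact: val_inj.
rewrite [leRHS](reindex_inj sh_inj) [leLHS]big_mkcond /=; apply: ler_sum => i _.
have s0 : forall i, 0 <= s i by case: sv.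
case: ifP => ik; last by rewrite exprn_ge0.
have lt_sub a b d : (a < b - d -> a + d < b)%N by lia.
by rewrite lerXn2r// ?nnegrE//; apply: st => /=; rewrite modn_small//; exact: (lt_sub _ _ _ ik).
Qed.

End Truncation.

(** * From inequalities between tails to an inequality between norms *)

Section ConcaveBound.
Variables (R : realType) (n : nat) (E : symmetric_space R n.+1) (q : R) (m : nat).
Local Notation N := (2 ^ n.+1)%N.
Variable c : 'I_n.+1 -> 'I_N -> R[i].
Hypothesis c_sym : forall j x, cabs (c j (flip j x)) = cabs (c j x).
Hypothesis q_gt0 : 0 < q.
Hypothesis q_le : q <= m.+1.*2%:R.
Hypothesis q_concave : concave_with_constant E q 1.
Local Notation S := (neighbor_mx c).

Lemma gauge_root_exp (k : nat) (h : 'I_N -> R) : (0 < k)%N -> (forall i, 0 <= h i) ->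
  gauge_root E k%:R (fun i => h i ^+ k) = gauge E h.
Proof.
move=> k0 h0; rewrite /gauge_root; congr (gauge E _); apply/funext => i.
by rewrite -powR_mulrn// -powRrM mulfV ?powRr1// pnatr_eq0 -lt0n.
Qed.

Lemma edge_sqr_ge0 x : 0 <= edge_sqr c x.
Proof. by apply: sumr_ge0 => j _; exact: sqr_ge0. Qed.

(* [tail_singular_values] compares a tail of length 2 k with one of length k,
   so only every other singular value enters; this lists the even indices first. *)
Definition unshuffle_fun (i : 'I_N) : 'I_N :=
  insubd i (if (i < 2 ^ n)%N then i.*2 else (i - 2 ^ n).*2.+1).

Lemma unshuffleE (i : 'I_N) :
  unshuffle_fun i = (if (i < 2 ^ n)%N then i.*2 else (i - 2 ^ n).*2.+1) :> nat.
Proof.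
have N2 : (2 ^ n.+1 = (2 ^ n).*2)%N by rewrite expnS mul2n.
have iN : (i < (2 ^ n).*2)%N by rewrite -N2.
rewrite /unshuffle_fun val_insubd; case: ifP => // /negP[]; rewrite [ltnRHS]N2.
move: iN; move: (nat_of_ord i) (2 ^ n)%N => a b. by case: (ltnP a b); lia.
Qed.

Lemma unshuffle_inj : injective unshuffle_fun.
Proof.
move=> i j /(congr1 val); rewrite /= !unshuffleE => ij; apply: val_inj => /=.
by move: ij; case: (ltnP i (2 ^ n)) => hi; case: (ltnP j (2 ^ n)) => hj ij; lia.
Qed.

(** The sequence [h] is 0 on the first half of the indices and then lists the odd-indexed singular
    values. Its first N - k entries therefore involve only indices below N - 2k, the range
    controlled by [tail_singular_values], and partial sums of equal length can be compared. *)
Lemma gauge_upper_half_le (V : 'M[R[i]]_N) (s : 'I_N -> R) :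
  sv_decomp S V s -> (forall i j : 'I_N, (i <= j)%N -> s i <= s j) ->
  gauge E (fun i => if (i < 2 ^ n)%N then 0 else s (perm unshuffle_inj i)) <=
    Num.sqrt (m.*2.+1)%:R * gauge E (fun x => Num.sqrt (edge_sqr c x)).
Proof.
move=> sv s_inc; have s0 : forall i, 0 <= s i by case: sv.
set tau := perm unshuffle_inj; set h := fun i : 'I_N => _.
have h0 i : 0 <= h i by rewrite /h; case: ifP.
have [p p_dec] := exists_sorting_perm (fun x => - edge_sqr c x).
set a : R := (m.*2.+1)%:R; have a0 : 0 <= a by rewrite ler0n.
pose g i := Num.sqrt a * Num.sqrt (edge_sqr c (p i)).
have g0 i : 0 <= g i by rewrite mulr_ge0// sqrtr_ge0.
have -> : Num.sqrt a * gauge E (fun x => Num.sqrt (edge_sqr c x)) = gauge E g.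
  rewrite /g gaugeZ ger0_norm ?sqrtr_ge0//; congr (_ * _).
  by rewrite (gauge_perm E (fun x => Num.sqrt (edge_sqr c x))).
have gX i : g i ^+ m.+1.*2 = a ^+ m.+1 * edge_sqr c (p i) ^+ m.+1.
  rewrite -mul2n exprM -exprMn; congr (_ ^+ _).
  by rewrite /g exprMn !sqr_sqrtr ?edge_sqr_ge0.
have m0 : (0 < m.+1.*2)%N by rewrite double_gt0.
rewrite -(gauge_root_exp m0 h0) -(gauge_root_exp m0 g0).
apply: (gauge_root_le_tail q_gt0 q_le q_concave).
- by move=> i; rewrite exprn_ge0.
- by move=> i; rewrite exprn_ge0.
- move=> i j ij; rewrite lerXn2r ?nnegrE// ler_wpM2l ?sqrtr_ge0// ler_wsqrtr//.
  by have := p_dec i j ij; rewrite lerN2.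
(* [k] is the number of deleted vertices; for [k0] beyond N it is 0 and the sums are complete. *)
move=> k0; pose k := (N - k0)%N.
have eqk (F : 'I_N -> R) : \sum_(i < N | (i < k0)%N) F i = \sum_(i < N | (i < N - k)%N) F i.
  by apply: eq_bigl => i; have := ltn_ord i; rewrite /k; lia.
rewrite !eqk (eq_bigr _ (fun i _ => gX i)) -mulr_sumr.
apply: le_trans (tail_singular_values c_sym m k p sv s_inc).
rewrite [leRHS](reindex_inj (@perm_inj _ tau)) [leLHS]big_mkcond [leRHS]big_mkcond /=.
apply: ler_sum => i _; rewrite /h permE unshuffleE.
have -> : forall z, (z < N - k.*2)%N = (z < (2 ^ n).*2 - k.*2)%N.
  by move=> z; rewrite expnS mul2n.
have N2 : (2 ^ n.+1 = (2 ^ n).*2)%N by rewrite expnS mul2n.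
have -> : (i < N - k)%N = (i < (2 ^ n).*2 - k)%N by rewrite -N2.
case: (ltnP i (2 ^ n)) => i_lo.
  by rewrite expr0n /=; case: ifP => _; case: ifP => _ //; rewrite exprn_ge0.
case: ifP => ik; last by case: ifP => _ //; rewrite exprn_ge0.
rewrite ifT//; move: i_lo ik; move: (nat_of_ord i) (2 ^ n)%N => a1 b1; lia.
Qed.

(** In increasing order each even-indexed singular value is at most the next one, so the missing
    half is dominated by a rearrangement of the half already bounded; the triangle inequality gives
    the factor 2. *)
Lemma gauge_le_edge_sqr (V : 'M[R[i]]_N) (s : 'I_N -> R) : sv_decomp S V s ->
  gauge E s <= 2 * Num.sqrt (m.*2.+1)%:R * gauge E (fun x => Num.sqrt (edge_sqr c x)).
Proof.
move=> sv; have [p p_dec] := exists_sorting_perm (fun x => - s x).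
have {}sv := sv_decomp_perm p sv.
have s_inc : forall i j : 'I_N, (i <= j)%N -> s (p i) <= s (p j).
  by move=> i j /p_dec; rewrite lerN2.
have s0 : forall i, 0 <= s (p i) by case: sv.
rewrite -(gauge_perm E s p).
have hle := gauge_upper_half_le sv s_inc.
rewrite -mulrA; apply: (@le_trans _ _ (2 * gauge E (fun i : 'I_N =>
  if (i < 2 ^ n)%N then 0 else s (p (perm unshuffle_inj i))))); last first.
  by rewrite ler_wpM2l.
set tau := perm unshuffle_inj.
pose h (i : 'I_N) := if (i < 2 ^ n)%N then 0 else s (p (tau i)).
rewrite -/h; pose low (i : 'I_N) := if (i < 2 ^ n)%N then s (p (tau i)) else 0.
have N_gt0 : (0 < N)%N by rewrite expn_gt0.
(* A shift by half the length sends the place of index 2i to that of 2i + 1 in the unshuffled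
   list. *)
pose sh (i : 'I_N) : 'I_N := Ordinal (ltn_pmod (i + 2 ^ n) N_gt0).
have sh_inj : injective sh.
  move=> i j /(congr1 val) /= /eqP; rewrite eqn_modDr !modn_small// => /eqP.
  exact: val_inj.
rewrite -(gauge_perm E (fun i => s (p i)) tau).
have -> : (fun i => s (p (tau i))) = (fun i => h i + low i).
  by apply/funext => i; rewrite /h /low; case: ltnP => _; rewrite ?add0r ?addr0.
apply: le_trans (gaugeD _ _ _) _.
rewrite mulr_natl mulr2n lerD2l -(gauge_perm E h (perm sh_inj)).
apply: le_gauge => i; rewrite /low /h (permE sh_inj).
case: ltnP => i_lo; last by rewrite normr0 normr_ge0.
have shE : sh i = (i + 2 ^ n)%N :> nat.
  rewrite /= modn_small//.
  have -> : forall z, (z < N)%N = (z < (2 ^ n).*2)%N by move=> z; rewrite expnS mul2n.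
  by move: i_lo; lia.
rewrite shE ltnNge leq_addl /= !ger0_norm//; apply: s_inc.
rewrite !permE !unshuffleE shE i_lo ltnNge leq_addl /=; lia.
Qed.

End ConcaveBound.

(** * The rotation group *)

Section PlaneRotation.
Variable R : realType.
Implicit Types (s t : R) (a b : bool).

(** The angle is halved so that the squared entries are (1 + cos t) / 2 and (1 - cos t) / 2, the
    kernel of [cos_laplacian] for one bit. *)
Definition rot2 t a b : R :=
  if a == b then cos (t / 2) else if a then sin (t / 2) else - sin (t / 2).

Lemma rot2D s t a b : \sum_c rot2 s a c * rot2 t c b = rot2 (s + t) a b.
Proof.
rewrite big_bool /rot2 mulrDl; case: a; case: b => /=; rewrite ?cosD ?sinD; ring.
Qed.

Lemma sqr_rot2 t a b : rot2 t a b ^+ 2 = (1 + cos t * (-1) ^+ (a (+) b)) / 2.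
Proof.
have ct : cos t = cos (t / 2) ^+ 2 - sin (t / 2) ^+ 2.
  by rewrite {1}(splitr t) cosD !expr2.
have := cos2Dsin2 (t / 2); rewrite /rot2 ct.
by case: a; case: b => /= h; rewrite ?expr0 ?expr1 ?sqrrN; lra.
Qed.

(** The sign with which differentiation exchanges the rows of a plane rotation. *)
Definition sgb a : R := if a then 1 else -1.

Lemma is_derive_rot2 t a b :
  is_derive t 1 (fun u => rot2 u a b) (2^-1 * (sgb a * rot2 t (~~ a) b)).
Proof.
have c2 : is_derive t 1 (fun u : R => u / 2) 2^-1.
  by apply: is_derive_eq; rewrite !scaler0 add0r /GRing.scale /= mulr1.
have dc := @is_derive1_comp _ _ (fun u : R => u / 2) t _ _ (is_derive_cos (t / 2)) c2.
have ds := @is_derive1_comp _ _ (fun u : R => u / 2) t _ _ (is_derive_sin (t / 2)) c2.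
rewrite /rot2 /sgb; case: a; case: b => /=.
- by apply: is_derive_eq dc _; rewrite /=; ring.
- by apply: is_derive_eq ds _; rewrite /=; ring.
- by apply: is_derive_eq (is_deriveN ds) _; rewrite /=; ring.
- by apply: is_derive_eq dc _; rewrite /=; ring.
Qed.

End PlaneRotation.

Lemma sum_cube_val (V : nmodType) (n : nat) (F : cube n -> V) : \sum_z F (cube_val z) = \sum_z F z.
Proof.
rewrite [RHS](reindex (@cube_val n))//; exists (@cube_rank n) => z _.
  exact: cube_valK.
exact: cube_rankK.
Qed.

Section Rotation.
Variables (R : realType) (n : nat).
Local Notation N := (2 ^ n)%N.
Implicit Types (s t : R) (a b : bool) (x y z : 'I_N) (f : cube n -> R[i]).

(* Tensor power of a rotation: the squares of these entries are the kernel of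
   [cos_laplacian t]. *)
Definition rotR t x y : R := \prod_j rot2 t (cube_val x j) (cube_val y j).

Definition rotmx t : 'M[R[i]]_N := \matrix_(x, y) (rotR t x y)%:C.

Lemma rotRD s t x y : \sum_z rotR s x z * rotR t z y = rotR (s + t) x y.
Proof.
rewrite (sum_cube_val (fun z : cube n => (\prod_j rot2 s (cube_val x j) (z j)) *
  \prod_j rot2 t (z j) (cube_val y j))).
under eq_bigr do rewrite -big_split.
rewrite -(bigA_distr_bigA (fun j c => rot2 s (cube_val x j) c * rot2 t c (cube_val y j))).
by apply: eq_bigr => j _; exact: rot2D.
Qed.

Lemma rotRN t x y : rotR (- t) x y = rotR t y x.
Proof.
apply: eq_bigr => j _; rewrite /rot2 eq_sym mulNr cosN sinN.
by case: (cube_val x j); case: (cube_val y j) => //=; rewrite opprK.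
Qed.

Lemma rotR0 x y : rotR 0 x y = (x == y)%:R.
Proof.
have [->|xy] := eqVneq x y.
  by apply: big1 => j _; rewrite /rot2 eqxx mul0r cos0.
have [j xyj] : exists j, cube_val x j != cube_val y j.
  apply/existsP; apply: contraNT xy => /existsPn h; apply/eqP/cube_val_eq => j.
  by have := h j; rewrite negbK => /eqP.
rewrite /rotR (bigD1 j)//= /rot2 (negPf xyj) mul0r sin0 oppr0.
by case: ifP => _; rewrite mul0r.
Qed.

Lemma rotmxD s t : rotmx s *m rotmx t = rotmx (s + t).
Proof.
apply/matrixP => x y; rewrite !mxE -rotRD rmorph_sum; apply: eq_bigr => z _.
by rewrite !mxE -rmorphM.
Qed.

Lemma rotmxC t : (rotmx t)^t* = rotmx (- t).
Proof.
by apply/matrixP => x y; rewrite !mxE conj_Creal ?complex_real// rotRN.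
Qed.

Lemma rotmx0 : rotmx 0 = 1%:M.
Proof. by apply/matrixP => x y; rewrite !mxE rotR0; case: eqP. Qed.

Lemma rotmx_unitary t : rotmx t \is unitarymx.
Proof. by apply/unitarymxP; rewrite rotmxC rotmxD subrr rotmx0. Qed.

(** The half angle leaves a sign for each coordinate; it cancels in conjugations, whose orbits are
    therefore 2 pi periodic. *)
Lemma rotR_2pi t x y : rotR (t + 2 * pi) x y = (-1) ^+ n * rotR t x y.
Proof.
have -> : (-1) ^+ n = \prod_(j < n) (-1) :> R by rewrite prodr_const card_ord.
rewrite -big_split; apply: eq_bigr => j _ /=.
rewrite /rot2 mulrDl mulrAC mulfV// mul1r cosDpi sinDpi.
by case: eqP; case: (cube_val x j) => _; rewrite mulN1r.
Qed.

End Rotation.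

Arguments rotmx {R n} t.

Lemma is_derive_prod (R : realType) (I : eqType) (r : seq I) (F dF : I -> R -> R) (t : R) :
  uniq r -> (forall i, is_derive t 1 (F i) (dF i t)) ->
  is_derive t 1 (fun u => \prod_(i <- r) F i u)
    (\sum_(j <- r) \prod_(i <- r) (if i == j then dF i t else F i t)).
Proof.
move=> + dFP; elim: r => [_|i r IH /= /andP[ir ur]].
  rewrite big_nil; have -> : (fun u => \prod_(i <- [::]) F i u) = cst 1.
    by apply/funext => u; rewrite big_nil.
  exact: is_derive_cst.
have -> : (fun u => \prod_(j <- i :: r) F j u) = (F i) * (fun u => \prod_(j <- r) F j u).
  by apply/funext => u; rewrite big_cons.
apply: is_derive_eq (is_deriveM (dFP i) (IH ur)) _.
rewrite big_cons big_cons eqxx addrC; congr (_ + _); last first.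
  rewrite [LHS]/GRing.scale /= mulr_sumr; apply: eq_big_seq => j jr.
  rewrite big_cons; case: eqP => // ij; by rewrite ij jr in ir.
rewrite [LHS]/GRing.scale /= mulrC; congr (_ * _); apply: eq_big_seq => j jr.
by case: eqP => // ji; rewrite -ji jr in ir.
Qed.

(** * The derivative of the heat kernel as the diagonal of a rotation orbit *)

Section HeatDerivative.
Variables (R : realType) (n : nat).
Local Notation N := (2 ^ n)%N.
Implicit Types (s t : R) (x y z : 'I_N) (f : cube n -> R[i]).

Lemma is_derive_rotR t x y : is_derive t 1 (fun u => rotR u x y)
  (2^-1 * \sum_j sgb R (cube_val x j) * rotR t (flip j x) y).
Proof.
have := @is_derive_prod R 'I_n (index_enum 'I_n)
  (fun j u => rot2 u (cube_val x j) (cube_val y j))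
  (fun j u => 2^-1 * (sgb R (cube_val x j) * rot2 u (~~ cube_val x j) (cube_val y j))) t
  (index_enum_uniq _) (fun j => is_derive_rot2 t _ _).
move=> /is_derive_eq; apply.
rewrite mulr_sumr; apply: eq_bigr => j _.
rewrite (bigD1 j)//= eqxx /rotR [in RHS](bigD1 j)//= flipE eqxx addbT -!mulrA.
congr (_ * (_ * (_ * _))); apply: eq_bigr => k kj.
by rewrite (negPf kj) flipE (negPf kj) addbF.
Qed.

(** Expanding the product of the factors (1 + cos t z_j x_j) / 2 over subsets A produces cos^|A| t
    times the Walsh functions at z and x. *)
Lemma cos_laplacianE t f (x : cube n) :
  cos_laplacian t f x = \sum_z f (cube_val z) * (rotR t z (cube_rank x) ^+ 2)%:C.
Proof.
have -> : cos_laplacian t f x =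
    \sum_(A : {set 'I_n}) ofreal (cos t ^+ #|A|) * fourier f A * walsh R A x.
  rewrite [RHS](bigD1 finset.set0)//= /cos_laplacian; congr (_ + _).
  rewrite cards0 expr0 /fourier /walsh big_set0 mulr1.
  rewrite -[X in X * _]/(real_complex R 1) rmorph1 mul1r /mean; congr (_ / _).
  by apply: eq_bigr => z _; rewrite big_set0 mulr1.
transitivity (\sum_(z : cube n) f z *
    (\prod_j ((1 + cos t * (-1) ^+ (z j (+) x j)) / 2))%:C); last first.
  rewrite -sum_cube_val; apply: eq_bigr => z _; rewrite /rotR -prodrXl; congr (_ * _%:C).
  by apply: eq_bigr => j _; rewrite sqr_rot2 cube_rankK.
have key (z : cube n) : (\prod_j ((1 + cos t * (-1) ^+ (z j (+) x j)) / 2))%:C =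
    \sum_(A : {set 'I_n}) ofreal (cos t ^+ #|A|) * walsh R A z * walsh R A x / (2 ^ n)%:R.
  rewrite big_split /= prodr_const card_ord exprVn -natrX rmorphM /= fmorphV rmorph_nat -mulr_suml.
  congr (_ / _).
  rewrite (eq_bigr (fun j => cos t * (-1) ^+ (z j (+) x j) + 1)); last by move=> j _; rewrite addrC.
  rewrite bigA_distr rmorph_sum; apply: eq_bigr => A _.
  rewrite -big_mkcond /= big_split /= prodr_const rmorphM -mulrA; congr (_ * _).
  rewrite /walsh -big_split rmorph_prod; apply: eq_bigr => j _ /=.
  rewrite /coordinate signr_addb rmorphM /=.
  by case: (z j); case: (x j); rewrite /= ?expr0 ?expr1 ?rmorphN ?rmorph1.
rewrite (eq_bigr (fun A : {set 'I_n} => \sum_z f z * (ofreal (cos t ^+ #|A|) * walsh R A z * walsh R A x / (2 ^ n)%:R))).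
  by rewrite exchange_big; apply: eq_bigr => z _; rewrite key mulr_sumr.
move=> A _; rewrite /fourier /mean mulrA mulr_sumr !mulr_suml; apply: eq_bigr => z _; ring.
Qed.

(** The generator G of [rotmx] has entry [sgb / 2] on the edge from z to [flip j z]; these
    coefficients are the entries of the commutator M_f G - G M_f, with M_f the multiplication by f.
    As G is antisymmetric, this is the derivative at 0 of U^* M_f U, whose diagonal is
    [cos_laplacian t f]. *)
Definition grad_coef f (j : 'I_n) z : R[i] :=
  (2^-1 * sgb R (cube_val z j))%:C * (f (cube_val z) - f (cube_val (flip j z))).

Definition grad_mx f : 'M[R[i]]_N := neighbor_mx (grad_coef f).

Lemma grad_coef_sym f j z : cabs (grad_coef f j (flip j z)) = cabs (grad_coef f j z).
Proof.
apply: complexI; rewrite !cabs_norm /grad_coef flipK flipE eqxx addbT !normrM.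
rewrite [in LHS]distrC; congr (_ * _); rewrite -!cabs_norm !cabs_real !normrM.
by case: (cube_val z j); rewrite /= normrN1 normr1.
Qed.

Lemma edge_sqr_grad f z : edge_sqr (grad_coef f) z = (2^-1 * grad_abs f (cube_val z)) ^+ 2.
Proof.
rewrite exprMn sqr_sqrtr; last by apply: sumr_ge0 => j _; exact: sqr_ge0.
rewrite mulr_sumr; apply: eq_bigr => j _; rewrite -exprMn; congr (_ ^+ 2).
apply: complexI; rewrite cabs_norm /grad_coef normrM -cabs_norm cabs_real normrM.
rewrite [RHS]rmorphM /= cabs_norm; congr (_%:C * _); last first.
  by rewrite /partial /flip cube_rankK.
by rewrite ger0_norm ?invr_ge0//; case: (cube_val z j); rewrite /= ?normrN1 ?normr1 mulr1.
Qed.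

(** The weights [a j z] change sign under [flip j], so both terms of the difference of f contribute
    equally and the factor 1/2 disappears. What remains on the right is f against the derivative of
    the squared entries of the rotation. *)
Lemma grad_mx_conj_diag t f x : ((rotmx t)^t* *m grad_mx f *m rotmx t) x x =
  \sum_z f (cube_val z) *
    (rotR t z x * \sum_j sgb R (cube_val z j) * rotR t (flip j z) x)%:C.
Proof.
pose a j z : R[i] := (sgb R (cube_val z j) * rotR t z x * rotR t (flip j z) x)%:C.
have a_flip j z : a j (flip j z) = - a j z.
  rewrite /a flipK flipE eqxx addbT -rmorphN; congr (_ %:C).
  by case: (cube_val z j); rewrite /= /sgb /=; ring.
have -> : ((rotmx t)^t* *m grad_mx f *m rotmx t) x x =
    \sum_z \sum_j (2^-1)%:C * (f (cube_val z) - f (cube_val (flip j z))) * a j z.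
  rewrite rotmxC mxE exchange_big /=.
  transitivity (\sum_y \sum_z (rotR t z x)%:C * grad_mx f z y * (rotR t y x)%:C).
    apply: eq_bigr => y _; rewrite mxE mulr_suml; apply: eq_bigr => z _.
    by rewrite !(mxE matrix_key) rotRN.
  rewrite exchange_big [RHS]exchange_big; apply: eq_bigr => z _.
  rewrite (eq_bigr (fun y => \sum_j (if y == flip j z then
    (2^-1)%:C * (f (cube_val z) - f (cube_val (flip j z))) * a j z else 0))); last first.
    move=> y _; rewrite mxE mulr_sumr mulr_suml; apply: eq_bigr => j _.
    case: eqP => [->|_]; last by rewrite mulr0 mul0r.
    rewrite /grad_coef /a !rmorphM; ring.
  rewrite exchange_big; apply: eq_bigr => j _.
  by rewrite -big_mkcond big_pred1_eq.
rewrite exchange_big [RHS](eq_bigr (fun z => \sum_j f (cube_val z) * a j z)); last first.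
  move=> z _; rewrite mulr_sumr rmorph_sum mulr_sumr; apply: eq_bigr => j _.
  by rewrite /a !rmorphM /=; ring.
rewrite [RHS]exchange_big; apply: eq_bigr => j _ /=.
have h : \sum_z f (cube_val (flip j z)) * a j z = - \sum_z f (cube_val z) * a j z.
  rewrite (reindex_inj (can_inj (flipK j))) -sumrN; apply: eq_bigr => z _.
  by rewrite flipK a_flip mulrN.
transitivity ((2^-1)%:C * (\sum_z f (cube_val z) * a j z -
    \sum_z f (cube_val (flip j z)) * a j z)).
  by rewrite -sumrB mulr_sumr; apply: eq_bigr => z _; ring.
rewrite h opprK; set X := (X in X + X).
have -> : (2^-1)%:C = 2^-1 :> R[i] by rewrite fmorphV rmorph_nat.
by rewrite -/X; field.
Qed.

Lemma Re_mul_real (c : R[i]) (r : R) : complex.Re (c * r%:C) = complex.Re c * r.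
Proof. by case: c => a b; rewrite /= mulr0 subr0. Qed.

Lemma Im_mul_real (c : R[i]) (r : R) : complex.Im (c * r%:C) = complex.Im c * r.
Proof. by case: c => a b; rewrite /= mulr0 add0r. Qed.

Lemma is_derive_cos_laplacian t f (x : cube n)
    (u := ((rotmx t)^t* *m grad_mx f *m rotmx t) (cube_rank x) (cube_rank x)) :
  is_derive t 1 (fun s => complex.Re (cos_laplacian s f x)) (complex.Re u) /\
  is_derive t 1 (fun s => complex.Im (cos_laplacian s f x)) (complex.Im u).
Proof.
rewrite /u grad_mx_conj_diag; set y := cube_rank x.
pose w' z := rotR t z y * \sum_j sgb R (cube_val z j) * rotR t (flip j z) y.
have dw z : is_derive t 1 (fun u => rotR u z y ^+ 2) (w' z).
  have -> : (fun u : R => rotR u z y ^+ 2) =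
      (fun u : R => rotR u z y : R) * (fun u : R => rotR u z y : R).
    by apply: funext => v; rewrite expr2.
  have d := is_derive_rotR t z y.
  by apply: is_derive_eq (is_deriveM d d) _; rewrite /w' /GRing.scale /=; field.
have dsum (g : 'I_N -> R) : is_derive t 1 (fun u => \sum_z g z * rotR u z y ^+ 2)
    (\sum_z g z * w' z).
  have -> : (fun u => \sum_z g z * rotR u z y ^+ 2) =
      \sum_z (fun u => g z * rotR u z y ^+ 2).
    by apply/funext => v; rewrite fct_sumE.
  by apply: is_derive_sum => z; exact: is_deriveZ.
have -> : (fun s => complex.Re (cos_laplacian s f x)) =
    (fun u => \sum_z complex.Re (f (cube_val z)) * rotR u z y ^+ 2).
  apply/funext => v; rewrite cos_laplacianE raddf_sum; apply: eq_bigr => z _; exact: Re_mul_real.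
have -> : (fun s => complex.Im (cos_laplacian s f x)) =
    (fun u => \sum_z complex.Im (f (cube_val z)) * rotR u z y ^+ 2).
  apply/funext => v; rewrite cos_laplacianE raddf_sum; apply: eq_bigr => z _; exact: Im_mul_real.
split; apply: is_derive_eq (dsum _) _; rewrite raddf_sum; apply: eq_bigr => z _.
  exact/esym/Re_mul_real.
exact/esym/Im_mul_real.
Qed.

Lemma cderive_cos_laplacian t f (x : cube n) :
  cderive (fun s => cos_laplacian s f x) t =
    ((rotmx t)^t* *m grad_mx f *m rotmx t) (cube_rank x) (cube_rank x).
Proof.
have [dr di] := is_derive_cos_laplacian t f x.
rewrite /cderive !derive1E (@derive_val _ _ _ _ _ _ _ dr) (@derive_val _ _ _ _ _ _ _ di).
by case: (_ (cube_rank x) (cube_rank x)).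
Qed.

End HeatDerivative.

(** Equality even holds: the sum over the family and the mean commute. *)
Lemma Lspace_concave (R : realType) (n : nat) (E : symmetric_space R n) (q : R) :
  0 < q -> is_Lspace E q -> concave_with_constant E q 1.
Proof.
move=> q0 Eq m v; rewrite mul1r /snormR Eq.
have qV (x : R) : 0 <= x -> (x `^ q^-1) `^ q = x.
  by move=> x0; rewrite -powRrM mulVf ?gt_eqF// powRr1.
have mean_ge0 (g : cube n -> R) : (forall x, 0 <= g x) -> 0 <= mean g.
  by move=> g0; rewrite /mean divr_ge0// sumr_ge0.
rewrite le_eqVlt; apply/orP; left; apply/eqP; congr (_ `^ _).
transitivity (\sum_i mean (fun x => cabs (v i x) `^ q)).
  by apply: eq_bigr => i _; rewrite Eq qV// mean_ge0// => x; exact: powR_ge0.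
rewrite /mean -mulr_suml exchange_big; congr (_ / _); apply: eq_bigr => x _.
rewrite /ofreal cabs_real ger0_norm ?powR_ge0// qV//.
by apply: sumr_ge0 => i _; exact: powR_ge0.
Qed.

Lemma gauge_grad_mx_concave (R : realType) (n : nat) (E : symmetric_space R n.+1)
    (q : R) (f : cube n.+1 -> R[i]) :
  2 <= q -> concave_with_constant E q 1 ->
  CE_norm E (grad_mx f) <= 2^-1 * (6 * Num.sqrt q) * snormR E (grad_abs f).
Proof.
move=> q2 Eq; have [V [s [sv _]]] := exists_sv_decomp (grad_mx f).
have q0 : 0 < q by exact: lt_le_trans q2.
rewrite (CE_normE E sv).
(* The exponent r = 2 (m + 1) is then an even integer above q, with 2m + 1 <= q + 1. *)
pose m := Num.truncn (q / 2).
have /andP[m1 m2] : m%:R <= q / 2 < m.+1%:R by apply: truncn_itv; rewrite divr_ge0// ltW.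
have qm : q <= m.+1.*2%:R by rewrite -mul2n natrM; lra.
apply: le_trans (gauge_le_edge_sqr (@grad_coef_sym R n.+1 f) q0 qm Eq sv) _.
have -> : (fun x => Num.sqrt (edge_sqr (grad_coef f) x)) =
    (fun x => 2^-1 * grad_abs f (cube_val x)).
  apply/funext => x; rewrite edge_sqr_grad sqrtr_sqr ger0_norm//.
  by rewrite mulr_ge0// sqrtr_ge0.
rewrite gaugeZ gaugeE ger0_norm// mulrA ler_wpM2r ?gauge_ge0//.
(* The rough bound 2m + 1 <= 9 q gives 3 sqrt q; with the factor 2 of [gauge_le_edge_sqr] this is
   the constant 6. *)
have : Num.sqrt (m.*2.+1)%:R <= Num.sqrt (3 ^+ 2 * q).
  rewrite ler_wsqrtr// -natr1 -mul2n natrM; lra.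
rewrite sqrtrM ?sqr_ge0// sqrtr_sqr ger0_norm//; lra.
Qed.

Lemma CE_norm_grad_mx (R : realType) (n : nat) (E : symmetric_space R n.+1) (K : R)
    (f : cube n.+1 -> R[i]) : admissible_constant 6 E K ->
  CE_norm E (grad_mx f) <= 2^-1 * K * snormR E (grad_abs f).
Proof.
case=> [[E2 ->]|[q [q2 _ Eq ->]]|[q [q2 Eq ->]]].
- have [V [s [sv _]]] := exists_sv_decomp (grad_mx f).
  rewrite (CE_normE E sv) mulr1; apply: le_trans (gauge_le_column_norms E2 sv) _.
  rewrite gaugeE -[leRHS]ger0_norm ?mulr_ge0 ?gauge_ge0// normrM [X in _ * X]ger0_norm ?gauge_ge0//.
  rewrite -gaugeZ; apply: le_gauge => x.
  rewrite neighbor_mx_column; last exact: grad_coef_sym.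
  by rewrite edge_sqr_grad sqrtr_sqr normr_id.
(* Here sqrt q is enlarged to q, as q >= 1. *)
- apply: le_trans (gauge_grad_mx_concave f q2 Eq) _.
  rewrite gaugeE ler_wpM2r ?gauge_ge0// ler_wpM2l// ler_wpM2l//.
  rewrite -[leRHS]ger0_norm ?(le_trans _ q2)// -sqrtr_sqr ler_wsqrtr// ler_eXnr//.
  lra.
- apply: gauge_grad_mx_concave; first exact: ltW.
  by apply: Lspace_concave => //; exact: lt_trans q2.
Qed.

(** * Integrals along the rotation group *)

Section ComplexIntegral.
Context {d : measure_display} {T : measurableType d} {R : realType}.
Variables (m : {measure set T -> \bar R}) (D : set T).
Hypothesis mD : measurable D.

Lemma integrable_mul_bounded (g h : T -> R) (M : R) :
  m.-integrable D (EFin \o g) -> measurable_fun D h ->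
  (forall x, D x -> `|h x| <= M) -> m.-integrable D (EFin \o (fun x => g x * h x)).
Proof.
move=> ig mh hM; have mg := measurable_int _ ig.
apply: (le_integrable mD) (integrableZl mD M ig).
  by apply/measurable_EFinP; apply: measurable_funM => //; exact/measurable_EFinP.
move=> x Dx; rewrite /= lee_fin mulrC !normrM ler_wpM2r//.
exact: le_trans (hM _ Dx) (ler_norm _).
Qed.

Lemma Rintegral_sum (I : finType) (F : I -> T -> R) :
  (forall i, m.-integrable D (EFin \o F i)) ->
  \int[m]_(x in D) (\sum_i F i x) = \sum_i \int[m]_(x in D) F i x.
Proof.
move=> iF; rewrite /Rintegral; under eq_integral do rewrite -sumEFin.
rewrite integral_sum// -[RHS]/(fine (\sum_i _)%:E) -sumEFin; congr fine.
by apply: eq_bigr => i _; rewrite /Rintegral fineK// (integrable_fin_num mD (iF i)).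
Qed.

Lemma measurable_cabs (f : T -> R[i]) :
  measurable_fun D (fun x => complex.Re (f x)) -> measurable_fun D (fun x => complex.Im (f x)) ->
  measurable_fun D (fun x => cabs (f x)).
Proof.
move=> mr mi.
apply: (eq_measurable_fun (fun x => Num.sqrt (complex.Re (f x) ^+ 2 + complex.Im (f x) ^+ 2))).
  by move=> x _; case: (f x).
have ms : measurable_fun setT (@Num.sqrt R).
  by apply: continuous_measurable_fun; exact: sqrt_continuous.
by apply: (measurableT_comp ms); apply: measurable_funD; exact: measurable_funX.
Qed.

Lemma ler_norm_cabs (z : R[i]) : `|complex.Re z| <= cabs z /\ `|complex.Im z| <= cabs z.
Proof.
by case: z => a b; rewrite /cabs /=; split; rewrite -sqrtr_sqr ler_wsqrtr// ?lerDl ?lerDr sqr_ge0.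
Qed.

Lemma cabs_le_add (z : R[i]) : cabs z <= `|complex.Re z| + `|complex.Im z|.
Proof.
case: z => a b; rewrite /cabs /= -[leRHS]ger0_norm ?addr_ge0// -sqrtr_sqr ler_wsqrtr//.
rewrite sqrrD !real_normK ?num_real// lerD2r lerDl mulrn_wge0// mulr_ge0//.
Qed.

Lemma integrable_cabs (f : T -> R[i]) : cintegrable m D f ->
  m.-integrable D (EFin \o (fun x => cabs (f x))).
Proof.
move=> [ir ii].
have mc : measurable_fun D (fun x => cabs (f x)).
  apply: measurable_cabs; [exact/measurable_EFinP/(measurable_int _ ir)|
    exact/measurable_EFinP/(measurable_int _ ii)].
refine (le_integrable mD _ _ (integrableD mD (integrable_abse ir) (integrable_abse ii))).
  exact/measurable_EFinP.
move=> x Dx /=; rewrite lee_fin ger0_norm ?cabs_ge0// ger0_norm ?addr_ge0//.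
exact: cabs_le_add.
Qed.

(** If a + i b is the integral and r its modulus, then r^2 is the integral of a Re f + b Im f, which
    the Cauchy-Schwarz inequality in the plane bounds by r |f|. *)
Lemma cabs_cintegral_le (f : T -> R[i]) : cintegrable m D f ->
  cabs (cintegral m D f) <= \int[m]_(x in D) cabs (f x).
Proof.
move=> icf; have [ir ii] := icf; have ic := integrable_cabs icf.
rewrite /cintegral /cabs /=.
set a := \int[m]_(x in D) complex.Re (f x); set b := \int[m]_(x in D) complex.Im (f x).
set r := Num.sqrt (a ^+ 2 + b ^+ 2).
have ab0 : 0 <= a ^+ 2 + b ^+ 2 by rewrite addr_ge0// sqr_ge0.
have r2 : r ^+ 2 = a ^+ 2 + b ^+ 2 by rewrite sqr_sqrtr.
have [r0|r0] := leP r 0.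
  by apply: le_trans r0 _; apply: Rintegral_ge0 => x _; exact: cabs_ge0.
suff : a * \int[m]_(x in D) complex.Re (f x) + b * \int[m]_(x in D) complex.Im (f x) <=
    r * \int[m]_(x in D) cabs (f x).
  by rewrite -/a -/b -!expr2 -r2 expr2 ler_pM2l.
rewrite -!RintegralZl// -RintegralD//; [|exact: (integrableZl mD a ir)|exact: (integrableZl mD b ii)].
apply: le_Rintegral => //.
- exact: integrableD (integrableZl mD a ir) (integrableZl mD b ii).
- exact: (integrableZl mD r ic).
move=> x _; rewrite /cabs; case: (f x) => u v /=.
rewrite /r -sqrtrM//; apply: le_trans (ler_norm _) _.
rewrite -sqrtr_sqr ler_wsqrtr//.
rewrite -subr_ge0 (_ : _ - _ = (a * v - b * u) ^+ 2) ?sqr_ge0//; ring.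
Qed.

End ComplexIntegral.

Section RotationIntegral.
Variables (R : realType) (n : nat).
Local Notation N := (2 ^ n)%N.
Local Notation mu := (@lebesgue_measure R).
Local Notation TR := (measurableTypeR R).
Variable D : set TR.
Hypothesis mD : measurable D.
Implicit Types (S V W : 'M[R[i]]_N) (s : 'I_N -> R).

Lemma rot_conjE S (t : R) (x y : 'I_N) : ((rotmx t)^t* *m S *m rotmx t) x y =
  \sum_z \sum_w S z w * (rotR t z x * rotR t w y)%:C.
Proof.
rewrite rotmxC mxE exchange_big; apply: eq_bigr => w _; rewrite mxE mulr_suml.
by apply: eq_bigr => z _; rewrite !(mxE matrix_key) rotRN rmorphM; ring.
Qed.

Lemma continuous_rotR (x y : 'I_N) : continuous (fun t : R => rotR t x y).
Proof.
move=> t; apply: differentiable_continuous; apply/derivable1_diffP.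
have d := is_derive_rotR t x y; exact: ex_derive.
Qed.

Lemma measurable_rotR (x y : 'I_N) : measurable_fun [set: TR] (fun t : R => rotR t x y).
Proof. by apply: continuous_measurable_fun; exact: continuous_rotR. Qed.

Lemma measurable_rot_conj S (x y : 'I_N) :
  measurable_fun [set: TR] (fun t => complex.Re (((rotmx t)^t* *m S *m rotmx t) x y)) /\
  measurable_fun [set: TR] (fun t => complex.Im (((rotmx t)^t* *m S *m rotmx t) x y)).
Proof.
split.
  apply: (eq_measurable_fun (fun t => \sum_z \sum_w complex.Re (S z w) * (rotR t z x * rotR t w y))).
    move=> t _; rewrite rot_conjE raddf_sum; apply: eq_bigr => z _.
    by rewrite raddf_sum; apply: eq_bigr => w _; rewrite -Re_mul_real.
  apply: measurable_sum => z; apply: measurable_sum => w.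
  by apply: measurable_funM => //; apply: measurable_funM; exact: measurable_rotR.
apply: (eq_measurable_fun (fun t => \sum_z \sum_w complex.Im (S z w) * (rotR t z x * rotR t w y))).
  move=> t _; rewrite rot_conjE raddf_sum; apply: eq_bigr => z _.
  by rewrite raddf_sum; apply: eq_bigr => w _; rewrite -Im_mul_real.
apply: measurable_sum => z; apply: measurable_sum => w.
by apply: measurable_funM => //; apply: measurable_funM; exact: measurable_rotR.
Qed.

Lemma measurable_overlap W V (i k : 'I_N) :
  measurable_fun [set: TR] (fun t => overlap W V (rotmx t) i k).
Proof.
have mre (c : 'I_N -> R[i]) (F : 'I_N -> R -> R) : (forall z, measurable_fun [set: TR] (F z)) ->
    measurable_fun [set: TR] (fun t => cabs (\sum_z c z * (F z t)%:C) ^+ 2).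
  move=> mF; apply: measurable_funX; apply: measurable_cabs.
    apply: (eq_measurable_fun (fun t => \sum_z complex.Re (c z) * F z t)).
      by move=> t _; rewrite raddf_sum; apply: eq_bigr => z _; rewrite -Re_mul_real.
    by apply: measurable_sum => z; apply: measurable_funM => //; exact: mF.
  apply: (eq_measurable_fun (fun t => \sum_z complex.Im (c z) * F z t)).
    by move=> t _; rewrite raddf_sum; apply: eq_bigr => z _; rewrite -Im_mul_real.
  by apply: measurable_sum => z; apply: measurable_funM => //; exact: mF.
rewrite /overlap; apply: measurable_funM => //; apply: measurable_funD.
  apply: (eq_measurable_fun (fun t => cabs (\sum_z W z k * (rotR t z i)%:C) ^+ 2)).
    move=> t _; congr (cabs _ ^+ 2); rewrite rotmxC mxE; apply: eq_bigr => z _.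
    by rewrite mxE rotRN mulrC.
  by apply: mre => z; exact: measurable_rotR.
apply: (eq_measurable_fun (fun t => cabs (\sum_z V k z * (rotR t z i)%:C) ^+ 2)).
  by move=> t _; congr (cabs _ ^+ 2); rewrite mxE; apply: eq_bigr => z _; rewrite mxE.
by apply: mre => z; exact: measurable_rotR.
Qed.

Lemma snorm_rotation_integral (E : symmetric_space R n) S (phi : R -> R[i]) :
  cintegrable mu D phi ->
  E (fun x => cintegral mu D (fun t =>
       phi t * ((rotmx t)^t* *m S *m rotmx t) (cube_rank x) (cube_rank x))) <=
  CE_norm E S * \int[mu]_(t in D) cabs (phi t).
Proof.
move=> iphi; have ic := integrable_cabs mD iphi.
have [V [s [sv _]]] := exists_sv_decomp S.
have [Vu s0 _] := sv; have [W [p [SE p01 WW]]] := sv_decomp_polar sv.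
rewrite (CE_normE E sv); set Phi := \int[mu]_(t in D) _.
have Phi0 : 0 <= Phi by apply: Rintegral_ge0 => t _; exact: cabs_ge0.
pose Q i k := \int[mu]_(t in D) (cabs (phi t) * overlap W V (rotmx t) i k).
have ov t := overlap_sum_le1 (rotmx_unitary n t) Vu p01 WW.
have ov1 t i k : overlap W V (rotmx t) i k <= 1.
  apply: le_trans ((ov t).1 i); rewrite (bigD1 k)//= lerDl; apply: sumr_ge0 => j _.
  exact: overlap_ge0.
have iQ i k : mu.-integrable D (EFin \o (fun t => cabs (phi t) * overlap W V (rotmx t) i k)).
  apply: (integrable_mul_bounded mD ic (M := 1)).
    exact: measurable_funTS (measurable_overlap _ _ _ _).
  by move=> t _; rewrite ger0_norm ?overlap_ge0.
have Q0 i k : 0 <= Q i k.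
  by apply: Rintegral_ge0 => t _; rewrite mulr_ge0 ?cabs_ge0 ?overlap_ge0.
have Qrow i : \sum_k Q i k <= Phi.
  rewrite -Rintegral_sum//; apply: le_Rintegral => //.
    have := @integrable_sum _ _ _ mu D mD 'I_N (index_enum _) xpredT _ (fun k _ => iQ i k).
    by apply: eq_integrable => // t _; rewrite /= sumEFin.
  move=> t _; rewrite -mulr_sumr -[leRHS]mulr1 ler_wpM2l ?cabs_ge0//; exact: (ov t).1.
have Qcol k : \sum_i Q i k <= Phi.
  rewrite -Rintegral_sum//; apply: le_Rintegral => //.
    have := @integrable_sum _ _ _ mu D mD 'I_N (index_enum _) xpredT _ (fun i _ => iQ i k).
    by apply: eq_integrable => // t _; rewrite /= sumEFin.
  move=> t _; rewrite -mulr_sumr -[leRHS]mulr1 ler_wpM2l ?cabs_ge0//; exact: (ov t).2.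
pose u t x := ((rotmx t)^t* *m S *m rotmx t) x x.
have u_le t x : cabs (u t x) <= \sum_k overlap W V (rotmx t) x k * s k.
  by rewrite /u SE; exact: diag_conj_le_overlap.
pose B := \sum_k s k.
have u_B t x : cabs (u t x) <= B.
  apply: le_trans (u_le t x) _; apply: ler_sum => k _.
  by rewrite -[leRHS]mul1r ler_wpM2r.
have iphu x : cintegrable mu D (fun t => phi t * u t x).
  have [ir ii] := iphi.
  have [mr mi] := measurable_rot_conj S x x.
  have ruB t : `|complex.Re (u t x)| <= B by apply: le_trans (u_B t x); exact: (ler_norm_cabs _).1.
  have iuB t : `|complex.Im (u t x)| <= B by apply: le_trans (u_B t x); exact: (ler_norm_cabs _).2.
  have mr' : measurable_fun D (fun t => complex.Re (u t x)) by exact: measurable_funTS.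
  have mi' : measurable_fun D (fun t => complex.Im (u t x)) by exact: measurable_funTS.
  have irr := integrable_mul_bounded mD ir mr' (fun t _ => ruB t).
  have iii := integrable_mul_bounded mD ii mi' (fun t _ => iuB t).
  have iri := integrable_mul_bounded mD ir mi' (fun t _ => iuB t).
  have iir := integrable_mul_bounded mD ii mr' (fun t _ => ruB t).
  split.
    have := integrableB mD irr iii; apply: eq_integrable => // t _.
    by rewrite /=; case: (phi t) => a b; case: (u t x) => c d.
  have := integrableD mD iri iir; apply: eq_integrable => // t _.
  by rewrite /=; case: (phi t) => a b; case: (u t x) => c d.
have main x : cabs (cintegral mu D (fun t => phi t * u t x)) <= \sum_k Q x k * s k.
  apply: le_trans (cabs_cintegral_le mD (iphu x)) _.
  have -> : \sum_k Q x k * s k =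
      \int[mu]_(t in D) (\sum_k cabs (phi t) * overlap W V (rotmx t) x k * s k).
    rewrite (Rintegral_sum mD); last first.
      by move=> k; apply: (integrable_mul_bounded mD (iQ x k) (M := s k)) => // t _; rewrite ger0_norm.
    by apply: eq_bigr => k _; rewrite RintegralZr.
  apply: (le_Rintegral mD).
  - by have h := integrable_cabs mD (iphu x); exact: h.
  - have iQs k : mu.-integrable D (EFin \o (fun t => cabs (phi t) * overlap W V (rotmx t) x k * s k)).
      by apply: (integrable_mul_bounded mD (iQ x k) (M := s k)) => // t _; rewrite ger0_norm.
    have := @integrable_sum _ _ _ mu D mD 'I_N (index_enum _) xpredT _ (fun k _ => iQs k).
    by apply: eq_integrable => // t _; rewrite /= sumEFin.
  - move=> t _; have -> : cabs (phi t * u t x) = cabs (phi t) * cabs (u t x).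
      by apply: complexI; rewrite cabs_norm normrM -!cabs_norm rmorphM.
    under eq_bigr do rewrite -mulrA.
    by rewrite -mulr_sumr ler_wpM2l ?cabs_ge0.
have EE (g : cube n -> R[i]) : E g <= gauge E (fun i => cabs (g (cube_val i))).
  by apply: snorm_lattice => x; rewrite /ofreal cabs_real cube_rankK ger0_norm ?cabs_ge0.
apply: le_trans (EE _) _; rewrite mulrC -[X in X * _](ger0_norm Phi0) -gaugeZ.
(* [Q] has to be divided by [Phi], so the case [Phi = 0], where all its entries vanish, is
   separate. *)
have [Phi_eq0|Phi_gt0] := leP Phi 0.
  have Phi00 : Phi = 0 by apply/eqP; rewrite eq_le Phi_eq0.
  apply: le_gauge => x; rewrite ger0_norm ?cabs_ge0// cube_valK.
  apply: le_trans (main x) _; apply: le_trans (_ : 0 <= _); last exact: normr_ge0.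
  apply: sumr_le0 => k _; apply: mulr_le0_ge0 => //.
  apply: le_trans (_ : \sum_k Q x k <= _); last by rewrite (le_trans (Qrow x)) ?Phi00.
  by rewrite (bigD1 k)//= lerDl sumr_ge0.
(* [Q / Phi] is doubly substochastic; the factor [Phi] goes to the singular values. *)
have hQ := @gauge_substochastic R n E (fun i k => Q i k / Phi)
  (fun i => cabs (cintegral mu D (fun t => phi t * u t i))) (fun k => Phi * s k).
have -> : (fun i => cabs (cintegral mu D (fun t => phi t *
    ((rotmx t)^t* *m S *m rotmx t) (cube_rank (cube_val i)) (cube_rank (cube_val i))))) =
  (fun i => cabs (cintegral mu D (fun t => phi t * u t i))).
  by apply/funext => i; rewrite cube_valK.
apply: hQ.
- by move=> k; rewrite mulr_ge0.
- by move=> i k; rewrite divr_ge0.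
- by move=> i; rewrite -mulr_suml ler_pdivrMr// mul1r.
- by move=> k; rewrite -mulr_suml ler_pdivrMr// mul1r.
move=> i; rewrite cabs_ge0 /=; apply: le_trans (main i) _.
rewrite le_eqVlt; apply/orP; left; apply/eqP; apply: eq_bigr => k _.
by rewrite mulrA divfK// gt_eqF.
Qed.

End RotationIntegral.

(** * The main inequality and its first consequences *)

Section HeatFlow.
Variables (R : realType) (n : nat) (E : symmetric_space R n.+1) (K : R).
Local Notation N := (2 ^ n.+1)%N.
Local Notation mu := (@lebesgue_measure R).
Implicit Types (f : cube n.+1 -> R[i]).
Hypothesis EK : admissible_constant 6 E K.

Lemma snorm_heat_integral (phi : R -> R[i]) f :
  cintegrable mu `[0%R, pi / 2] phi ->
  E (fun x => cintegral mu `[0%R, pi / 2]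
       (fun t => phi t * cderive (fun s => cos_laplacian s f x) t))
  <= 2^-1 * K * snormR E (grad_abs f)
       * \int[mu]_(t in `[0%R, pi / 2]) cabs (phi t).
Proof.
move=> iphi.
under [X in E X]funext do under [X in cintegral _ _ X]funext do rewrite cderive_cos_laplacian.
apply: le_trans (snorm_rotation_integral (measurable_itv _) E (grad_mx f) iphi) _.
apply: ler_wpM2r (CE_norm_grad_mx f EK).
by apply: Rintegral_ge0 => t _; exact: cabs_ge0.
Qed.

Lemma cos_laplacian0 f x : cos_laplacian 0 f x = f x.
Proof.
rewrite cos_laplacianE (bigD1 (cube_rank x))//= rotR0 eqxx expr1n mulr1 cube_rankK big1 ?addr0//.
by move=> z zx; rewrite rotR0 (negPf zx) expr0n mulr0.
Qed.

Lemma cos_laplacian_pi2 f x : cos_laplacian (pi / 2) f x = mean f.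
Proof.
rewrite /cos_laplacian big1 ?addr0// => A A0.
by rewrite cos_pihalf expr0n cards_eq0 (negPf A0) /ofreal rmorph0 !mul0r.
Qed.

Lemma continuous_rot_conj (S : 'M[R[i]]_N) (x y : 'I_N) :
  continuous (fun t => complex.Re (((rotmx t)^t* *m S *m rotmx t) x y)) /\
  continuous (fun t => complex.Im (((rotmx t)^t* *m S *m rotmx t) x y)).
Proof.
have c (a : 'I_N -> 'I_N -> R) :
    continuous (fun t : R => \sum_z \sum_w a z w * (rotR t z x * rotR t w y)).
  apply: continuous_big => [|z _]; first exact: add_continuous.
  apply: continuous_big => [|w _ t]; first exact: add_continuous.
  apply: cvgM; first exact: cvg_cst.
  by apply: cvgM; exact: continuous_rotR.
split.
  rewrite (_ : (fun t : R => complex.Re (((rotmx t)^t* *m S *m rotmx t) x y)) =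
    (fun t => \sum_z \sum_w complex.Re (S z w) * (rotR t z x * rotR t w y))); first exact: c.
  apply/funext => t; rewrite rot_conjE raddf_sum; apply: eq_bigr => z _.
  by rewrite raddf_sum; apply: eq_bigr => w _; rewrite -Re_mul_real.
rewrite (_ : (fun t : R => complex.Im (((rotmx t)^t* *m S *m rotmx t) x y)) =
  (fun t => \sum_z \sum_w complex.Im (S z w) * (rotR t z x * rotR t w y))); first exact: c.
apply/funext => t; rewrite rot_conjE raddf_sum; apply: eq_bigr => z _.
by rewrite raddf_sum; apply: eq_bigr => w _; rewrite -Im_mul_real.
Qed.

Lemma Rintegral_derive (F f : R -> R) (a b : R) : a < b ->
  continuous f -> (forall t : R, is_derive t 1 F (f t)) ->
  \int[mu]_(t in `[a, b]) f t = F b - F a.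
Proof.
move=> ab cf dF; rewrite /Rintegral (continuous_FTC2 (F := F) ab)//.
- by apply: continuous_subspaceT.
- have cF : continuous F.
    by move=> t; apply: differentiable_continuous; apply/derivable1_diffP; exact: ex_derive.
  split => [t _| |].
  + by have [] := dF t.
  + exact: cvg_at_right_filter (cF a).
  + exact: cvg_at_left_filter (cF b).
- by move=> t _; rewrite derive1E derive_val.
Qed.

(** The weight -1 on [0, theta] integrates the derivative to f - cos_laplacian theta f. For theta =
    pi/2 the latter term is the mean, which accounts for the constant pi/4. *)
Lemma snorm_sub_cos_laplacian (theta : R) f : 0 <= theta ->
  E (fun x => f x - cos_laplacian theta f x)
  <= 2^-1 * theta * K * snormR E (grad_abs f).
Proof.
rewrite le_eqVlt => /predU1P[<-|theta0].
  rewrite mulr0 !mul0r; under [X in E X]funext do rewrite cos_laplacian0 subrr.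
  by have := gauge0 E; rewrite /gauge /snormR /ofreal rmorph0 => ->.
have i1 : cintegrable mu `[0%R, theta] (fun=> -1 : R[i]).
  have ic (c : R) : mu.-integrable `[0, theta] (EFin \o cst c).
    apply: continuous_compact_integrable; first exact: segment_compact.
    by apply: continuous_subspaceT => t; exact: cvg_cst.
  by split; [exact: (ic (-1))|exact: (ic (- 0))].
have := snorm_rotation_integral (measurable_itv _) E (grad_mx f) i1.
have -> : (fun x : cube n.+1 => cintegral mu `[0%R, theta] (fun t => -1 *
     ((rotmx t)^t* *m grad_mx f *m rotmx t) (cube_rank x) (cube_rank x))) =
  (fun x => f x - cos_laplacian theta f x).
  apply/funext => x; set y := cube_rank x.
  have [cr ci] := continuous_rot_conj (grad_mx f) y y.
  have hr := Rintegral_derive theta0 cr (fun t => (is_derive_cos_laplacian t f x).1).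
  have hi := Rintegral_derive theta0 ci (fun t => (is_derive_cos_laplacian t f x).2).
  have ir : mu.-integrable `[0%R, theta] (EFin \o (fun t => complex.Re (((rotmx t)^t* *m grad_mx f *m rotmx t) y y))).
    apply: continuous_compact_integrable; first exact: segment_compact.
    exact: continuous_subspaceT.
  have ii : mu.-integrable `[0%R, theta] (EFin \o (fun t => complex.Im (((rotmx t)^t* *m grad_mx f *m rotmx t) y y))).
    apply: continuous_compact_integrable; first exact: segment_compact.
    exact: continuous_subspaceT.
  rewrite /cintegral.
  under eq_Rintegral do rewrite mulN1r raddfN -mulN1r.
  under [X in Complex _ X]eq_Rintegral do rewrite mulN1r raddfN -mulN1r.
  rewrite !RintegralZl// hr hi !cos_laplacian0 !mulN1r !opprB.
  by case: (f x) => a b; case: (cos_laplacian theta f x) => c d.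
move=> /le_trans; apply.
have -> : \int[mu]_(t in `[0%R, theta]) cabs (-1 : R[i]) = theta.
  have -> : cabs (-1 : R[i]) = 1 by apply: complexI; rewrite cabs_norm normrN1.
  rewrite Rintegral_cst ?measurable_itv//= lebesgue_measure_itv /= lte_fin theta0 /=.
  by rewrite subr0 mul1r.
rewrite mulrC [leRHS](_ : _ = theta * (2^-1 * K * snormR E (grad_abs f))); last by ring.
by rewrite ler_wpM2l ?(ltW theta0)//; exact: CE_norm_grad_mx.
Qed.

End HeatFlow.

(** * The kernels (- ln cos) ^ (- a) *)

Section Trigonometry.
Variable R : realType.
Implicit Types t : R.

Lemma cos_gt0_0pihalf t : 0 < t < pi / 2 -> 0 < cos t.
Proof.
move=> /andP[t0 t1]; apply: cos_gt0_pihalf; rewrite t1 andbT.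
by rewrite (lt_trans _ t0)// oppr_lt0 divr_gt0 ?pi_gt0.
Qed.

(** By doubling, sin t = 2 sin(t/2) cos(t/2), and the mean value theorem writes sin(t/2) as (t/2)
    cos c. Both cosines are taken on [0, pi/4], where cos^2 >= 1/2. *)
Lemma sin_ge_half t : 0 <= t <= pi / 2 -> t / 2 <= sin t.
Proof.
move=> /andP[]; rewrite le_eqVlt => /predU1P[<-|t0] t1; first by rewrite mul0r sin0.
have u0 : 0 < t / 2 by rewrite divr_gt0.
have [c /[!in_itv]/= /andP[c0 ct]] := @MVT R sin cos 0 (t / 2) u0
  (fun x _ => is_derive_sin x) (continuous_subspaceT (@continuous_sin R)).
rewrite sin0 !subr0 => sE.
have c2 (x : R) : 0 <= x <= t / 2 -> 2^-1 <= cos x ^+ 2.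
  move=> /andP[x0 x1].
  have := cos_mulr2n x; have : 0 <= cos (x *+ 2); last lra.
  apply: cos_ge0_pihalf; rewrite (mulr2n x).
  have := @pi_gt0 R; lra.
have cp (x : R) : 0 <= x <= t / 2 -> 0 <= cos x.
  move=> /andP[x0 x1]; apply: cos_ge0_pihalf; have := @pi_gt0 R; lra.
have c01 : 0 <= c <= t / 2 by rewrite ltW//= ltW.
have t01 : 0 <= t / 2 <= t / 2 by rewrite ltW//=.
rewrite [in leRHS](splitr t) sinD [cos (t / 2) * _]mulrC -mulr2n sE.
have hcc : 2^-1 <= cos c * cos (t / 2).
  have := c2 _ c01; have := c2 _ t01; have := cp _ c01; have := cp _ t01.
  set x := cos c; set y := cos (t / 2) => x0 y0 xx yy; rewrite -/x -/y.
  rewrite -(@ler_pXn2r _ 2) ?nnegrE ?mulr_ge0// exprMn.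
  have -> : (2^-1 : R) ^+ 2 = 2^-1 * 2^-1 by rewrite expr2.
  by apply: ler_pM.
have -> : cos c * (t / 2) * cos (t / 2) *+ 2 = cos c * cos (t / 2) * t.
  by rewrite mulr2n; field.
by rewrite [leLHS]mulrC ler_wpM2r// ltW.
Qed.

(** Both sides are ln(1 + x) <= x, applied to 1 - sin^2 = cos^2 and to 1 + tan^2 = 1 / cos^2. *)
Lemma lnN_cos_bounds t : 0 < t < pi / 2 ->
  2^-1 * sin t ^+ 2 <= - ln (cos t) <= 2^-1 * tan t ^+ 2.
Proof.
move=> t01; have c0 := cos_gt0_0pihalf t01.
have c20 : 0 < cos t ^+ 2 by rewrite exprn_gt0.
have l2 : ln (cos t ^+ 2) = 2 * ln (cos t) by rewrite lnXn// mulr_natl.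
apply/andP; split.
  have : ln (1 + - sin t ^+ 2) <= - sin t ^+ 2.
    by apply: le_ln1Dx; rewrite ltrN2 sin2cos2 -subr_gt0 opprB addrCA subrr addr0.
  by rewrite -cos2sin2 l2; lra.
have : ln (1 + tan t ^+ 2) <= tan t ^+ 2.
  by apply: le_ln1Dx; rewrite (lt_le_trans _ (sqr_ge0 _))// oppr_lt0.
by rewrite -cos2_tan2 ?gt_eqF// lnV ?posrE// l2; lra.
Qed.

Lemma lnN_cos_gt0 t : 0 < t < pi / 2 -> 0 < - ln (cos t).
Proof.
move=> t01; have /andP[h _] := lnN_cos_bounds t01; apply: lt_le_trans h.
by rewrite mulr_gt0// exprn_gt0// sin_gt0_pihalf.
Qed.

Definition psi (a : R) t : R := (- ln (cos t)) `^ (- a).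

Lemma psi_ge0 a t : 0 <= psi a t. Proof. exact: powR_ge0. Qed.

Lemma psi_sin_le a t : 0 < a <= 2^-1 -> 0 < t < pi / 2 ->
  psi a t <= 2 * sin t `^ (- (2 * a)).
Proof.
move=> /andP[a0 a1] t01; have s0 : 0 < sin t by exact: sin_gt0_pihalf.
have /andP[h _] := lnN_cos_bounds t01; have l0 := lnN_cos_gt0 t01.
have hs : 0 < 2^-1 * sin t ^+ 2 by rewrite mulr_gt0// exprn_gt0.
rewrite /psi !powRN.
apply: (@le_trans _ _ ((2^-1 * sin t ^+ 2) `^ a)^-1).
  rewrite lef_pV2 ?posrE ?powR_gt0//.
  by apply: ge0_ler_powR; rewrite ?nnegrE ?(ltW a0) ?(ltW hs) ?(ltW l0).
rewrite powRM ?invr_ge0 ?sqr_ge0// invfM -powR_mulrn ?(ltW s0)// -powRrM.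
rewrite ler_wpM2r ?invr_ge0 ?powR_ge0//.
(* The factor 2 bounds (1/2)^(-a) = 2^a, where a <= 1. *)
rewrite -powRN -powR_inv1// -powRrM mulN1r opprK -[leRHS]powRr1//; apply: ler_powR; lra.
Qed.

Lemma psi_half_bounds t : 0 < t < pi / 2 ->
  Num.sqrt 2 * cos t / sin t <= psi 2^-1 t <= Num.sqrt 2 / sin t.
Proof.
move=> t01; have s0 : 0 < sin t by exact: sin_gt0_pihalf.
have c0 := cos_gt0_0pihalf t01; have l0 := lnN_cos_gt0 t01.
have /andP[h1 h2] := lnN_cos_bounds t01.
rewrite /psi powRN powR12_sqrt ?(ltW l0)//.
set L := - ln (cos t) in l0 h1 h2 *.
have L0 : 0 < Num.sqrt L by rewrite sqrtr_gt0.
have sq2 : 0 < Num.sqrt 2 :> R by rewrite sqrtr_gt0.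
have q2 : Num.sqrt 2 * Num.sqrt 2 = 2 :> R by rewrite -expr2 sqr_sqrtr.
have e (x : R) : 0 <= x -> Num.sqrt (2^-1 * x ^+ 2) = x / Num.sqrt 2.
  by move=> x0; rewrite sqrtrM// sqrtr_sqr ger0_norm// sqrtrV// mulrC.
have t0 : 0 <= tan t by rewrite divr_ge0 ?ltW.
apply/andP; split.
  have : Num.sqrt L <= tan t / Num.sqrt 2 by rewrite -e// ler_wsqrtr.
  move=> hL; rewrite -[leRHS]div1r ler_pdivlMr// mulrAC ler_pdivrMr// mul1r.
  apply: le_trans (ler_wpM2l _ hL) _; first by rewrite mulr_ge0 ?ltW.
  by rewrite /tan le_eqVlt; apply/orP; left; apply/eqP; field; rewrite !gt_eqF.
have : sin t / Num.sqrt 2 <= Num.sqrt L by rewrite -e ?(ltW s0)// ler_wsqrtr.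
rewrite ler_pdivrMr// => hL.
by rewrite -[leLHS]div1r ler_pdivrMr// mulrAC ler_pdivlMr// mul1r mulrC.
Qed.

End Trigonometry.

(** * The substitution u = - k ln(cos t) in the Gamma integral *)

Section GammaSubstitution.
Variables (R : realType) (a : R) (m : nat).
Local Notation k := (m.+1%:R : R).
Local Notation mu := (@lebesgue_measure R).
Local Notation TR := (measurableTypeR R).

Let G (u : R) : R := u `^ (- a) * expR (- u).
Let F (t : R) : R := - (k * ln (cos t)).
Let h (t : R) : R := k `^ (- a) * (psi a t * (k * cos t ^+ m * sin t)).

Let k_gt0 : 0 < k. Proof. by []. Qed.

Let is_derive_F (t : R) : 0 < t < pi / 2 -> is_derive t 1 F (k * tan t).
Proof.
move=> t01; have c0 := cos_gt0_0pihalf t01.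
have d := @is_derive1_comp _ (@ln R) cos t _ _ (is_derive1_ln c0) (is_derive_cos t).
have d2 := is_deriveN (is_deriveZ k d).
by apply: is_derive_eq d2 _; rewrite /GRing.scale /= /tan; field; rewrite gt_eqF.
Qed.

Let itv_near (t : R) : 0 < t < pi / 2 -> \forall s \near t, 0 < s < pi / 2.
Proof.
move=> t01; have : t \in `]0, (pi / 2)[ by rewrite in_itv.
by move=> /near_in_itvoo; apply: filterS => s; rewrite in_itv.
Qed.

Let derive1_F (t : R) : 0 < t < pi / 2 -> derive1 F t = k * tan t.
Proof. by move=> t01; rewrite derive1E; have d := is_derive_F t01; rewrite derive_val. Qed.

Let continuous_F' (t : R) : 0 < t < pi / 2 -> {for t, continuous (derive1 F)}.
Proof.
move=> t01; rewrite /prop_for /continuous_at derive1_F//.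
apply: cvg_trans (_ : k * tan s @[s --> t] --> _).
  by apply: near_eq_cvg; apply: filterS (itv_near t01) => s s01; rewrite derive1_F.
apply: cvgM; first exact: cvg_cst.
by apply: continuous_tan; rewrite gt_eqF// cos_gt0_0pihalf.
Qed.

Let continuous_F (t : R) : 0 < t < pi / 2 -> {for t, continuous F}.
Proof.
move=> t01; apply: differentiable_continuous; apply/derivable1_diffP.
by have [] := is_derive_F t01.
Qed.

Let F_incr (s t : R) : 0 < s -> s < t -> t < pi / 2 -> F s < F t.
Proof.
move=> s0 st t1; have p0 := @pi_gt0 R.
have cs : 0 < cos s by apply: cos_gt0_0pihalf; rewrite s0 (lt_trans st).
have ct : 0 < cos t by apply: cos_gt0_0pihalf; rewrite t1 (lt_trans s0).
rewrite ltrN2 ltr_pM2l// ltr_ln ?posrE// ltr_cos// in_itv/=; lra.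
Qed.

Let F_gt0 (t : R) : 0 < t < pi / 2 -> 0 < F t.
Proof. by move=> t01; rewrite /F -mulrN mulr_gt0// lnN_cos_gt0. Qed.

Let F_surj (u : R) : 0 < u -> exists2 t, 0 < t < pi / 2 & F t = u.
Proof.
move=> u0; pose v := expR (- (u / k)).
have v0 : 0 < v by exact: expR_gt0.
have v1 : v < 1 by rewrite /v -expR0 ltr_expR oppr_lt0 divr_gt0.
have vN : -1 <= v <= 1 by rewrite ltW//= ?(ltW v1)// (lt_trans _ v0).
have cv : cos (acos v) = v by apply: acosK; rewrite in_itv.
exists (acos v).
  rewrite acos_gt0 ?(ltW v1) ?v1 ?andbT//=; last by have /andP[-> _] := vN.
  rewrite ltNge; apply/negP => h1.
  have p0 := @pi_gt0 R.
  have : cos (acos v) <= cos (pi / 2).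
    rewrite leNgt ltr_cos ?in_itv/= -?leNgt//.
      by rewrite acos_ge0// acos_lepi.
    by rewrite divr_ge0 ?pi_ge0//=; lra.
  by rewrite cv cos_pihalf leNgt v0.
by rewrite /F cv /v expRK mulrN opprK mulrC divfK// gt_eqF.
Qed.

Let continuous_G (u : R) : 0 < u -> {for u, continuous G}.
Proof.
move=> u0.
have cp : {for u, continuous (fun v : R => v `^ (- a))}.
  apply: differentiable_continuous; apply/derivable1_diffP.
  by apply: derivable_powR; rewrite in_itv/= u0.
apply: cvgM; first exact: cp.
by apply: continuous_comp; [exact: continuousN|exact: continuous_expR].
Qed.

Let GFE (t : R) : 0 < t < pi / 2 -> ((G \o F) * derive1 F) t = h t.
Proof.
move=> t01; have c0 := cos_gt0_0pihalf t01; have l0 := lnN_cos_gt0 t01.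
have -> : ((G \o F) * derive1 F) t = G (F t) * derive1 F t by [].
rewrite derive1_F// /G /F /h /psi opprK.
rewrite expRM_natl lnK// -mulrN powRM ?(ltW l0)// exprS /tan.
by field; rewrite gt_eqF.
Qed.

Let step (x y : R) : 0 < x -> x <= y -> y < pi / 2 ->
  (\int[mu]_(u in `[F x, F y]) (G u)%:E = \int[mu]_(t in `[x, y]) (h t)%:E)%E.
Proof.
move=> x0 xy y1.
have xy01 t : x <= t <= y -> 0 < t < pi / 2.
  by move=> /andP[xt ty]; rewrite (lt_le_trans x0)//= (le_lt_trans ty).
have x01 : 0 < x < pi / 2 by apply: xy01; rewrite lexx.
have y01 : 0 < y < pi / 2 by apply: xy01; rewrite lexx andbT.
rewrite (@integration_by_substitution_increasing R F G x y)//.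
- by apply: eq_integral => t; rewrite inE/= in_itv/= => /xy01 t01; rewrite GFE.
- move=> s t; rewrite !in_itv/= => /xy01/andP[s0 _] /xy01/andP[_ t1] st; exact: F_incr.
- by move=> t; rewrite in_itv/= => /andP[/ltW xt /ltW ty]; apply/continuous_F'/xy01; rewrite xt.
- by apply/cvg_ex; exists (derive1 F x); apply: cvg_at_right_filter; exact: continuous_F'.
- by apply/cvg_ex; exists (derive1 F y); apply: cvg_at_left_filter; exact: continuous_F'.
- split.
  + move=> t; rewrite in_itv/= => /andP[/ltW xt /ltW ty].
    by have [] := is_derive_F (xy01 t _); rewrite ?xt.
  + by apply: cvg_at_right_filter; exact: continuous_F.
  + by apply: cvg_at_left_filter; exact: continuous_F.
- apply: continuous_in_subspaceT => u; rewrite inE/= in_itv/= => /andP[xu _].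
  by apply: continuous_G; apply: lt_le_trans xu; exact: F_gt0.
Qed.

Lemma measurable_gamma_integrand : measurable_fun [set: TR] G.
Proof.
apply: measurable_funM; first exact: measurable_powR.
by apply: measurableT_comp => //; exact: measurable_expR.
Qed.

Lemma measurable_psi : measurable_fun [set: TR] (@psi R a).
Proof.
apply: (measurableT_comp (measurable_powR (- a))).
apply: measurableT_comp => //; apply: (measurableT_comp (@measurable_ln R)).
by apply: continuous_measurable_fun; exact: continuous_cos.
Qed.

Lemma measurable_cos_sin : measurable_fun [set: TR] (fun t : R => k * cos t ^+ m * sin t).
Proof.
apply: measurable_funM; last by apply: continuous_measurable_fun; exact: continuous_sin.
apply: measurable_funM => //; apply: measurable_funX.
by apply: continuous_measurable_fun; exact: continuous_cos.
Qed.

Let measurable_h : measurable_fun [set: TR] h.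
Proof.
apply: measurable_funM => //; apply: measurable_funM; first exact: measurable_psi.
exact: measurable_cos_sin.
Qed.

Let h_ge0 (t : R) : 0 < t < pi / 2 -> 0 <= h t.
Proof.
move=> t01; rewrite mulr_ge0 ?powR_ge0// mulr_ge0 ?psi_ge0// mulr_ge0 ?mulr_ge0 ?exprn_ge0//.
  by rewrite ltW// cos_gt0_0pihalf.
by rewrite ltW// sin_gt0_pihalf.
Qed.

(** With u = - k ln(cos t), exp(-u) is cos^k t and du is k tan t dt. The change of variables is made
    on compact intervals inside ]0, pi/2[; these and their images exhaust the two domains, and
    monotone convergence identifies the limits. *)
Lemma gamma_substitution :
  (\int[mu]_(u in `]0%R, +oo[) (u `^ (- a) * expR (- u))%:E =
   \int[mu]_(t in `]0%R, (pi / 2)%R[)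
     (k `^ (- a) * (psi a t * (k * cos t ^+ m * sin t)))%:E)%E.
Proof.
(* The denominator [n.+2] keeps [x n] at most pi/4, so that [x n <= y n]. *)
pose x n : R := (pi / 2) / n.+2%:R; pose y n : R := pi / 2 - x n.
have p2 : 0 < pi / 2 :> R by rewrite divr_gt0 ?pi_gt0.
have x0 n : 0 < x n by rewrite divr_gt0.
have xy n : x n <= y n.
  have : x n <= (pi / 2) / 2 by rewrite /x ler_pM2l// lef_pV2 ?posrE// ler_nat.
  by rewrite /y; lra.
have y1 n : y n < pi / 2 by rewrite /y gtrBl.
have x_dec i j : (i <= j)%N -> x j <= x i.
  by move=> ij; rewrite /x ler_pM2l// lef_pV2 ?posrE// ler_nat !ltnS.
have xcvg t : 0 < t -> exists n, x n <= t.
  move=> t0; exists (Num.truncn ((pi / 2) / t)); rewrite /x ler_pdivrMr// [leRHS]mulrC -ler_pdivrMr//.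
  have /andP[_ /ltW] : (Num.truncn (pi / 2 / t))%:R <= pi / 2 / t < (Num.truncn (pi / 2 / t)).+1%:R.
    by apply: truncn_itv; rewrite divr_ge0// ltW.
  by move=> /le_trans; apply; rewrite ler_nat.
have xy01 n t : x n <= t <= y n -> 0 < t < pi / 2.
  by move=> /andP[xt ty]; rewrite (lt_le_trans (x0 n))//= (le_lt_trans ty).
have F_le s t : 0 < s -> s <= t -> t < pi / 2 -> F s <= F t.
  move=> s0; rewrite le_eqVlt => /predU1P[->//|st] t1; exact/ltW/F_incr.
pose A n : set TR := [set` `[F (x n), F (y n)]]; pose B n : set TR := [set` `[x n, y n]].
have AU : \bigcup_n A n = `]0%R, +oo[%classic.
  apply/seteqP; split=> u /=.
    move=> [n _]; rewrite /A /= !in_itv/= andbT => /andP[+ _]; apply: lt_le_trans.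
    by apply: F_gt0; apply: (xy01 n); rewrite lexx xy.
  rewrite in_itv/= andbT => /F_surj[t /andP[t0 t1] <-].
  have [n1 n1t] := xcvg t t0; have [n2 n2t] := xcvg (pi / 2 - t) ltac:(by rewrite subr_gt0).
  exists (maxn n1 n2) => //; rewrite /A /= in_itv/=; apply/andP; split; apply: F_le => //.
  - by apply: le_trans n1t; apply: x_dec; exact: leq_maxl.
  - have := x_dec _ _ (leq_maxr n1 n2); rewrite /y; lra.
have BU : \bigcup_n B n = `]0%R, (pi / 2)%R[%classic.
  apply/seteqP; split=> t /=.
    by move=> [n _]; rewrite /B /= !in_itv/=; exact: xy01.
  rewrite in_itv/= => /andP[t0 t1].
  have [n1 n1t] := xcvg t t0; have [n2 n2t] := xcvg (pi / 2 - t) ltac:(by rewrite subr_gt0).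
  exists (maxn n1 n2) => //; rewrite /B /= in_itv/=; apply/andP; split.
  - by apply: le_trans n1t; apply: x_dec; exact: leq_maxl.
  - have := x_dec _ _ (leq_maxr n1 n2); rewrite /y; lra.
have y_inc i j : (i <= j)%N -> y i <= y j by move=> /x_dec; rewrite /y; lra.
have A_nd : nondecreasing_seq A.
  move=> i j ij; rewrite subsetEset; apply: subset_itv; rewrite bnd_simp; apply: F_le => //.
  - exact: x_dec.
  - exact: le_lt_trans (xy i) (y1 i).
  - exact: lt_le_trans (x0 i) (xy i).
  - exact: y_inc.
have B_nd : nondecreasing_seq B.
  move=> i j ij; rewrite subsetEset; apply: subset_itv; rewrite bnd_simp; [exact: x_dec|exact: y_inc].
have cA := @ge0_nondecreasing_set_cvg_integral _ TR R A (EFin \o G) mu A_nd.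
have cB := @ge0_nondecreasing_set_cvg_integral _ TR R B (EFin \o h) mu B_nd.
have eAB : (fun n => \int[mu]_(u in A n) (EFin \o G) u)%E =
    (fun n => \int[mu]_(t in B n) (EFin \o h) t)%E.
  by apply/funext => n; exact: step.
rewrite AU eAB in cA; rewrite BU in cB.
apply: (cvg_unique (@ereal_hausdorff R)) (cA _ _ _) (cB _ _ _).
- by move=> n; exact: measurable_itv.
- by move=> n; apply/measurable_EFinP; apply: measurable_funTS; exact: measurable_gamma_integrand.
- by move=> n u _; rewrite lee_fin mulr_ge0 ?powR_ge0 ?expR_ge0.
- by move=> n; exact: measurable_itv.
- by move=> n; apply/measurable_EFinP; exact: measurable_funTS.
- by move=> n t; rewrite /B /= in_itv /= => /xy01 t01; rewrite lee_fin h_ge0.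
Qed.

End GammaSubstitution.

Section OpenInterval.
Variables (R : realType) (a b : R).
Local Notation mu := (@lebesgue_measure R).
Local Notation TR := (measurableTypeR R).
Implicit Types f g : R -> R.

(** Used because the estimates on the kernels hold only inside the interval: for a > 0 the value of
    [psi a] at 0, where it should be infinite, is the default 0. *)
Lemma Rintegral_itvoo f : measurable_fun [set: TR] f ->
  \int[mu]_(t in `[a, b]) f t = \int[mu]_(t in `]a, b[) f t.
Proof.
move=> mf; rewrite /Rintegral; congr fine.
apply: (@integral_itv_bndoo _ a b (EFin \o f) true false).
by apply/measurable_EFinP; exact: measurable_funTS.
Qed.

Lemma integrable_itvoo f : measurable_fun [set: TR] f ->
  mu.-integrable `]a, b[ (EFin \o f) -> mu.-integrable `[a, b] (EFin \o f).
Proof.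
move=> mf /integrableP[_ fi].
apply/integrableP; split; first by apply/measurable_EFinP; exact: measurable_funTS.
rewrite (@integral_itv_bndoo _ a b (fun x => `|(EFin \o f) x|%E) true false)//.
by apply: measurableT_comp => //; apply/measurable_EFinP; exact: measurable_funTS.
Qed.

Lemma bounded_integrable_itv f (M : R) : measurable_fun [set: TR] f ->
  (forall t, a < t < b -> `|f t| <= M) -> mu.-integrable `[a, b] (EFin \o f).
Proof.
move=> mf fM; apply: integrable_itvoo => //; apply: measurable_bounded_integrable => //.
- set x := (X in (X < _)%E).
  have -> : x = lebesgue_measure `]a, b[%classic by [].
  by rewrite lebesgue_measure_itv /=; case: ifP => _; rewrite ?ltry.
- exact: measurable_funTS.
- exists M; split; first exact: num_real.
  by move=> x /ltW hx t /=; rewrite in_itv /= => tab; exact: le_trans (fM _ tab) hx.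
Qed.

Lemma le_Rintegral_itvoo f g : measurable_fun [set: TR] f -> measurable_fun [set: TR] g ->
  mu.-integrable `[a, b] (EFin \o f) -> mu.-integrable `[a, b] (EFin \o g) ->
  (forall t, a < t < b -> f t <= g t) ->
  \int[mu]_(t in `[a, b]) f t <= \int[mu]_(t in `[a, b]) g t.
Proof.
move=> mf mg fi gi fg; rewrite !Rintegral_itvoo//.
have sub : `]a, b[ `<=` (`[a, b]%classic : set TR).
  by move=> t /=; rewrite !in_itv/= => /andP[/ltW -> /ltW ->].
apply: le_Rintegral.
- exact: measurable_itv.
- apply: integrableS fi => //.
- apply: integrableS gi => //.
- by move=> t /=; rewrite in_itv/=; exact: fg.
Qed.

End OpenInterval.

Section GammaBounds.
Variable R : realType.
Local Notation mu := (@lebesgue_measure R).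
Local Notation TR := (measurableTypeR R).
Implicit Types (a t : R) (m : nat).

(** By [psi_sin_le], psi times sin is at most 2 sin^(1 - 2a), which is bounded because 2a <= 1: the
    sine cancels the singularity at 0, also when a = 1/2. *)
Lemma psi_cos_sin_bounds a m t : 0 < a <= 2^-1 -> 0 < t < pi / 2 ->
  0 <= psi a t * (m.+1%:R * cos t ^+ m * sin t) <= 2 * m.+1%:R.
Proof.
move=> a01 t01; have s0 := sin_gt0_pihalf t01; have c0 := cos_gt0_0pihalf t01.
have cm0 : 0 <= cos t ^+ m by rewrite exprn_ge0 ?(ltW c0).
have cm1 : cos t ^+ m <= 1 by rewrite exprn_ile1 ?(ltW c0)// cos_le1.
rewrite !mulr_ge0 ?psi_ge0 ?(ltW s0)//=.
have ps : psi a t * sin t <= 2.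
  apply: le_trans (ler_wpM2r (ltW s0) (psi_sin_le a01 t01)) _.
  rewrite -mulrA -[leRHS]mulr1 ler_wpM2l// -[X in _ * X]powRr1 ?(ltW s0)//.
  rewrite -powRD; last by rewrite (gt_eqF s0) implybT.
  have a1 : 0 <= - (2 * a) + 1 by lra.
  rewrite -[leRHS](powRr0 (sin t)); apply: ger_powR a1; by rewrite s0 sin_le1.
have -> : psi a t * (m.+1%:R * cos t ^+ m * sin t) =
    psi a t * sin t * (m.+1%:R * cos t ^+ m) by ring.
apply: ler_pM => //; rewrite ?mulr_ge0 ?psi_ge0 ?(ltW s0)//.
by rewrite -[leRHS]mulr1 ler_wpM2l.
Qed.

Lemma measurable_psi_cos_sin a m :
  measurable_fun [set: TR] (fun t => psi a t * (m.+1%:R * cos t ^+ m * sin t)).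
Proof. by apply: measurable_funM; [exact: measurable_psi|exact: measurable_cos_sin]. Qed.

Lemma integrable_psi_cos_sin a m : 0 < a <= 2^-1 ->
  mu.-integrable `[0%R, (pi / 2)%R]
    (EFin \o (fun t => psi a t * (m.+1%:R * cos t ^+ m * sin t))).
Proof.
move=> a01; apply: (@bounded_integrable_itv _ _ _ _ (2 * m.+1%:R)).
  exact: measurable_psi_cos_sin.
by move=> t t01; have /andP[h1 h2] := psi_cos_sin_bounds m a01 t01; rewrite ger0_norm.
Qed.

Lemma Rintegral_psi_cos_sin a m : 0 < a <= 2^-1 ->
  \int[mu]_(t in `[0%R, pi / 2]) (psi a t * (m.+1%:R * cos t ^+ m * sin t)) =
    m.+1%:R `^ a * Gamma (1 - a).
Proof.
move=> a01; have ii := integrable_psi_cos_sin m a01.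
have k0 : 0 < m.+1%:R `^ a :> R by rewrite powR_gt0.
have -> : Gamma (1 - a) = fine (\int[mu]_(u in `]0%R, +oo[) (u `^ (- a) * expR (- u))%:E)%E.
  rewrite /Gamma /Rintegral; congr fine; apply: eq_integral => u _.
  by have -> : 1 - a - 1 = - a by ring.
rewrite (gamma_substitution a m).
rewrite -[fine _]/(\int[mu]_(t in `]0%R, pi / 2[) (m.+1%:R `^ (- a) *
  (psi a t * (m.+1%:R * cos t ^+ m * sin t)))).
rewrite -Rintegral_itvoo; last first.
  by apply: measurable_funM => //; exact: measurable_psi_cos_sin.
by rewrite RintegralZl// powRN mulVKf// gt_eqF.
Qed.

(** The case k = 1 of [Rintegral_psi_cos_sin] writes Gamma(1 - a) as the integral of psi sin; a
    minorant with an explicit primitive then bounds Gamma from below. *)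
Lemma le_Gamma_of_le_psi a (F f : R -> R) : 0 < a <= 2^-1 ->
  continuous f -> (forall t : R, is_derive t 1 F (f t)) ->
  (forall t : R, 0 < t < pi / 2 -> f t <= psi a t * sin t) ->
  F (pi / 2) - F 0 <= Gamma (1 - a).
Proof.
move=> a01 cf dF fle; have p2 : 0 < pi / 2 :> R by rewrite divr_gt0 ?pi_gt0.
have := Rintegral_psi_cos_sin 0 a01; rewrite powR1 mul1r => <-.
rewrite -(Rintegral_derive p2 cf dF).
apply: le_Rintegral_itvoo.
- by apply: continuous_measurable_fun.
- exact: measurable_psi_cos_sin.
- apply: continuous_compact_integrable; first exact: segment_compact.
  exact: continuous_subspaceT.
- exact: integrable_psi_cos_sin.
- by move=> t t01; rewrite expr0 mulr1 mul1r fle.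
Qed.

(** The minorant is cos sin. With L = - ln(cos t), the inequality cos t <= psi reads L^a <= exp L,
    and L^a is at most max(1, L), hence at most 1 + L. *)
Lemma Gamma_gt0 a : 0 < a <= 2^-1 -> 0 < Gamma (1 - a).
Proof.
move=> a01; have /andP[a0 a1] := a01.
have dF (t : R) : is_derive t 1 (fun t => 2^-1 * sin t ^+ 2) (cos t * sin t).
  have d := is_deriveZ (2^-1 : R) (is_deriveX 2 (is_derive_sin t)).
  by apply: is_derive_eq d _; rewrite /GRing.scale /=; field.
apply: lt_le_trans (_ : 2^-1 * sin (pi / 2) ^+ 2 - 2^-1 * sin 0 ^+ 2 <= _).
  by rewrite sin_pihalf sin0 expr1n expr0n/= mulr0 subr0 mulr1 invr_gt0.
apply: (le_Gamma_of_le_psi a01 _ dF).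
  by move=> t; apply: cvgM; [exact: continuous_cos|exact: continuous_sin].
move=> t t01; have s0 := sin_gt0_pihalf t01; have c0 := cos_gt0_0pihalf t01.
rewrite ler_wpM2r ?(ltW s0)//.
have l0 := lnN_cos_gt0 t01; rewrite /psi powRN.
have eL : cos t = (expR (- ln (cos t)))^-1 by rewrite expRN lnK// invrK.
rewrite {1}eL lef_pV2 ?posrE ?expR_gt0 ?powR_gt0//.
set L := - ln (cos t) in l0 *.
have e1 : 1 + L <= expR L by exact: expR_ge1Dx.
have [L1|L1] := leP 1 L.
  by apply: le_trans (_ : L `^ 1 <= _); [apply: ler_powR; lra|rewrite powRr1//; lra].
apply: le_trans (_ : 1 `^ a <= _); last by rewrite powR1; lra.
by apply: ge0_ler_powR; rewrite ?nnegrE//; lra.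
Qed.

(** The lower bound of [psi_half_bounds], multiplied by sin, is sqrt 2 cos, whose integral is sqrt
    2. *)
Lemma sqrt2_le_Gamma_half : Num.sqrt 2 <= Gamma (1 - 2^-1) :> R.
Proof.
have h01 : 0 < (2^-1 : R) <= 2^-1 by rewrite lexx invr_gt0 ltr0n.
have dF (t : R) : is_derive t 1 (fun t => Num.sqrt 2 * sin t) (Num.sqrt 2 * cos t).
  exact: is_deriveZ (is_derive_sin t).
apply: le_trans (_ : Num.sqrt 2 * sin (pi / 2) - Num.sqrt 2 * sin 0 <= _).
  by rewrite sin_pihalf sin0 mulr0 subr0 mulr1.
apply: (le_Gamma_of_le_psi h01 _ dF).
  by move=> t; apply: cvgM; [exact: cvg_cst|exact: continuous_cos].
move=> t t01; have s0 := sin_gt0_pihalf t01.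
have /andP[h _] := psi_half_bounds t01.
by rewrite -ler_pdivrMr.
Qed.

End GammaBounds.

Section SumIntegral.
Context d (T : measurableType d) (R : realType) (m : {measure set T -> \bar R}) (D : set T).
Hypothesis mD : measurable D.

Lemma cintegral_sum_real (I : finType) (g : I -> T -> R) (c : I -> R[i]) :
  (forall i, m.-integrable D (EFin \o g i)) ->
  cintegral m D (fun t => \sum_i (g i t)%:C * c i) =
    \sum_i (\int[m]_(t in D) g i t)%:C * c i.
Proof.
move=> ig; have im (e : I -> R) i : m.-integrable D (EFin \o (fun t => e i * g i t)).
  exact: (@integrableZl _ _ _ _ _ mD (e i) (EFin \o g i) (ig i)).
have h (e : I -> R) : \int[m]_(t in D) (\sum_i e i * g i t) = \sum_i e i * \int[m]_(t in D) g i t.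
  rewrite (Rintegral_sum mD (im e)); apply: eq_bigr => i _.
  exact: (RintegralZl (e i) mD (ig i)).
have reM (z : R[i]) r : complex.Re (r%:C * z) = complex.Re z * r by rewrite mulrC Re_mul_real.
have imM (z : R[i]) r : complex.Im (r%:C * z) = complex.Im z * r by rewrite mulrC Im_mul_real.
rewrite /cintegral.
have -> : (fun t => complex.Re (\sum_i (g i t)%:C * c i)) =
    (fun t => \sum_i complex.Re (c i) * g i t).
  by apply/funext => t; rewrite raddf_sum; apply: eq_bigr => i _; exact: reM.
have -> : (fun t => complex.Im (\sum_i (g i t)%:C * c i)) =
    (fun t => \sum_i complex.Im (c i) * g i t).
  by apply/funext => t; rewrite raddf_sum; apply: eq_bigr => i _; exact: imM.
rewrite !h; apply/eqP; rewrite eq_complex /=; apply/andP; split; apply/eqP.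
  by rewrite [RHS]raddf_sum; apply: eq_bigr => i _; rewrite -reM.
by rewrite [RHS]raddf_sum; apply: eq_bigr => i _; rewrite -imM.
Qed.

End SumIntegral.

(** * Fractional powers of the Laplacian as integrals of the heat derivative *)

Section LaplacianPower.
Variables (R : realType) (n : nat).
Local Notation mu := (@lebesgue_measure R).
Local Notation TR := (measurableTypeR R).
Implicit Types (f : cube n -> R[i]) (a t : R).

Let is_derive_cosX (t : R) k : is_derive t 1 (fun s => cos s ^+ k) (- (k%:R * cos t ^+ k.-1 * sin t)).
Proof.
have d := is_deriveX k (is_derive_cos t).
rewrite exprfctE in d; apply: is_derive_eq d _; rewrite /GRing.scale /=; ring.
Qed.

(** The spectral form of the derivative, next to the spatial one of [cderive_cos_laplacian]. It
    displays the dependence on |A|, and oddness in t. The empty set may be included, its coefficient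
    being |A| = 0. *)
Lemma cderive_cos_laplacian_walsh t f x :
  cderive (fun s => cos_laplacian s f x) t =
  \sum_(A : {set 'I_n}) (- (#|A|%:R * cos t ^+ #|A|.-1 * sin t))%:C * (fourier f A * walsh R A x).
Proof.
pose c A := fourier f A * walsh R A x.
have e s : cos_laplacian s f x = mean f + \sum_(A : {set 'I_n} | A != finset.set0) c A * (cos s ^+ #|A|)%:C.
  rewrite /cos_laplacian; congr (_ + _); apply: eq_bigr => A _.
  by rewrite /ofreal -mulrA mulrC.
have d (u : R[i] -> R) : (forall A (r : R), u (c A * r%:C) = u (c A) * r) ->
    (forall z w, u (z + w) = u z + u w) -> u 0 = 0 ->
    is_derive t 1 (fun s => u (cos_laplacian s f x))
     (u (\sum_(A : {set 'I_n}) c A * (- (#|A|%:R * cos t ^+ #|A|.-1 * sin t))%:C)).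
  move=> uM uD u0.
  have us I (r : seq I) P F : u (\sum_(i <- r | P i) F i) = \sum_(i <- r | P i) u (F i).
    exact: (big_morph u uD u0).
  have -> : (fun s => u (cos_laplacian s f x)) =
      cst (u (mean f)) + \sum_(A : {set 'I_n}) (fun s => (if A != finset.set0 then u (c A) else 0) * cos s ^+ #|A|).
    apply/funext => s; rewrite e uD us big_mkcond; congr (_ + _).
    rewrite fct_sumE; apply: eq_bigr => A _; case: ifP => _; rewrite ?uM ?mul0r//.
  have dA A : is_derive t 1 (fun s => (if A != finset.set0 then u (c A) else 0) * cos s ^+ #|A|)
      (u (c A) * - (#|A|%:R * cos t ^+ #|A|.-1 * sin t)).
    have h := is_deriveZ (if A != finset.set0 then u (c A) else 0) (is_derive_cosX t #|A|).
    apply: is_derive_eq h _; rewrite /GRing.scale /=.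
    by case: eqVneq => [->|]//=; rewrite cards0 !mul0r oppr0 !mulr0.
  have hs : is_derive t 1 (\sum_(A : {set 'I_n}) (fun s => (if A != finset.set0 then u (c A) else 0) * cos s ^+ #|A|))
     (\sum_(A : {set 'I_n}) u (c A) * - (#|A|%:R * cos t ^+ #|A|.-1 * sin t)).
    apply: (big_ind2 (fun F v => is_derive t 1 F v)) => [|F1 v1 F2 v2 h1 h2|A _]; last exact: dA.
      exact: is_derive_cst.
    exact: is_deriveD.
  have h := is_deriveD (is_derive_cst (u (mean f)) t 1) hs.
  by apply: is_derive_eq h _; rewrite add0r us; apply: eq_bigr => A _; rewrite uM.
have dr := d (@complex.Re R) (fun A r => ltac:(by rewrite Re_mul_real)) (fun z w => raddfD _ z w) erefl.
have di := d (@complex.Im R) (fun A r => ltac:(by rewrite Im_mul_real)) (fun z w => raddfD _ z w) erefl.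
rewrite /cderive !derive1E (@derive_val _ _ _ _ _ _ _ dr) (@derive_val _ _ _ _ _ _ _ di).
under [RHS]eq_bigr do rewrite mulrC.
by case: (\sum_A _).
Qed.

(** Each Walsh function is handled by [Rintegral_psi_cos_sin] with k = |A|; the factor 4^a comes
    from the eigenvalues 4 |A| of the Laplacian. *)
Lemma laplacian_pow_integral a f x : 0 < a <= 2^-1 ->
  laplacian_pow a f x = (- (4 `^ a / Gamma (1 - a)))%:C *
    cintegral mu `[0%R, pi / 2]
      (fun t => ofreal (psi a t) * cderive (fun s => cos_laplacian s f x) t).
Proof.
move=> a01; have g0 := Gamma_gt0 a01.
pose g (A : {set 'I_n}) t : R := - (psi a t * (#|A|%:R * cos t ^+ #|A|.-1 * sin t)).
have ig A : mu.-integrable `[0%R, (pi / 2)%R] (EFin \o g A) /\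
    \int[mu]_(t in `[0%R, pi / 2]) g A t = - ((if A != finset.set0 then #|A|%:R `^ a else 0) * Gamma (1 - a)).
  have [->|A0] := eqVneq A finset.set0.
    have -> : g finset.set0 = cst 0.
      by apply/funext => t; rewrite /g cards0 !mul0r mulr0 oppr0.
    rewrite mul0r oppr0; split; last by rewrite Rintegral_cst ?mul0r.
    exact: integrable0.
  have -> : g A = (fun t => (-1) * (psi a t * (#|A|.-1.+1%:R * cos t ^+ #|A|.-1 * sin t))).
    by apply/funext => t; rewrite /g prednK ?card_gt0// mulN1r.
  have i := integrable_psi_cos_sin #|A|.-1 a01.
  split; first exact: (@integrableZl _ TR R mu _ (measurable_itv _) (-1) _ i).
  rewrite (@RintegralZl _ TR R mu _ _ (-1) (measurable_itv _) i) Rintegral_psi_cos_sin// prednK ?card_gt0// mulN1r//.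
rewrite (_ : (fun t => _) = (fun t => \sum_A (g A t)%:C * (fourier f A * walsh R A x))); last first.
  apply/funext => t; rewrite cderive_cos_laplacian_walsh mulr_sumr; apply: eq_bigr => A _.
  by rewrite mulrA /ofreal -rmorphM /= mulrN.
rewrite (@cintegral_sum_real _ TR R mu _ (measurable_itv _) _ g (fun A => fourier f A * walsh R A x) (fun A => (ig A).1)) mulr_sumr.
rewrite /laplacian_pow big_mkcond; apply: eq_bigr => A _; rewrite (ig A).2.
rewrite [RHS]mulrA -rmorphM /= mulrNN; set w := if A != finset.set0 then _ else _ : R.
have -> : 4 `^ a / Gamma (1 - a) * (w * Gamma (1 - a)) = 4 `^ a * w.
  by field; rewrite gt_eqF.
rewrite /w; case: ifP => _; last by rewrite mulr0 mul0r.
by rewrite natrM powRM// -mulrA.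
Qed.

End LaplacianPower.

Section FractionalPower.
Variable R : realType.
Local Notation mu := (@lebesgue_measure R).
Local Notation TR := (measurableTypeR R).

Lemma integrable_powRN (b c : R) : 0 <= b < 1 -> 0 < c ->
  mu.-integrable `[0%R, c] (EFin \o (fun t => t `^ (- b))).
Proof.
move=> /andP[b0 b1] c0; have d0 : 0 < 1 - b by rewrite subr_gt0.
have mp : measurable_fun [set: TR] (fun t : R => t `^ (- b)) by exact: measurable_powR.
apply: integrable_itvoo => //.
pose F t : R := (1 - b)^-1 * t `^ (1 - b).
have dF (t : R) : 0 < t -> is_derive t 1 F (t `^ (- b)).
  move=> t0; have d := is_deriveZ (1 - b)^-1 (is_derive1_powR (1 - b) t0).
  apply: is_derive_eq d _; rewrite /GRing.scale /= mulrA mulVf ?gt_eqF// mul1r.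
  by congr (_ `^ _); ring.
have cp (u : R) : 0 < u -> {for u, continuous (fun v : R => v `^ (- b))}.
  move=> u0; apply: differentiable_continuous; apply/derivable1_diffP.
  by apply: derivable_powR; rewrite in_itv/= u0.
have cF (u : R) : 0 < u -> {for u, continuous F}.
  move=> u0; apply: differentiable_continuous; apply/derivable1_diffP.
  by have [] := dF u u0.
pose x n : R := c / n.+2%:R.
have x0 n : 0 < x n by rewrite divr_gt0.
have xc n : x n < c by rewrite /x gtr_pMr// invf_lt1// ltr1n.
have step n : (\int[mu]_(t in `[x n, c]) (t `^ (- b))%:E <= (F c)%:E)%E.
  rewrite (continuous_FTC2 (F := F) (xc n)).
  - by rewrite -EFinB lee_fin gerBl mulr_ge0 ?powR_ge0// invr_ge0 ltW.
  - apply: continuous_in_subspaceT => u; rewrite inE/= in_itv/= => /andP[xu _].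
    by apply: cp; exact: lt_le_trans xu.
  - split.
    + move=> t; rewrite in_itv/= => /andP[xt _].
      by have [] := dF t (lt_trans (x0 n) xt).
    + by apply: cvg_at_right_filter; exact: cF.
    + by apply: cvg_at_left_filter; exact: cF.
  - move=> t; rewrite in_itv/= => /andP[xt _].
    by rewrite derive1E; have d := dF t (lt_trans (x0 n) xt); rewrite derive_val.
pose A n : set TR := [set` `[x n, c]].
have A_nd : nondecreasing_seq A.
  move=> i j ij; rewrite subsetEset; apply: subset_itv; rewrite bnd_simp//.
  by rewrite /x ler_pM2l// lef_pV2 ?posrE// ler_nat !ltnS.
have AU : `]0%R, c[ `<=` \bigcup_n A n.
  move=> t /=; rewrite in_itv/= => /andP[t0 tc].
  exists (Num.truncn (c / t)) => //; rewrite /A /= in_itv/= (ltW tc) andbT.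
  rewrite /x ler_pdivrMr// [leRHS]mulrC -ler_pdivrMr//.
  have /andP[_ /ltW] : (Num.truncn (c / t))%:R <= c / t < (Num.truncn (c / t)).+1%:R.
    by apply: truncn_itv; rewrite divr_ge0// ltW.
  by move=> /le_trans; apply; rewrite ler_nat.
have mA n : measurable (A n) by exact: measurable_itv.
have mpe (D : set TR) : measurable_fun D (EFin \o (fun t : R => t `^ (- b))).
  by apply/measurable_EFinP; exact: measurable_funTS.
have cA := @ge0_nondecreasing_set_cvg_integral _ TR R A (EFin \o (fun t : R => t `^ (- b))) mu A_nd
  mA (fun n => mpe (A n)) (fun n t _ => powR_ge0 _ _).
apply/integrableP; split; first exact: mpe.
apply: (@le_lt_trans _ _ (F c)%:E); last by rewrite ltry.
apply: (@le_trans _ _ (\int[mu]_(t in \bigcup_n A n) (t `^ (- b))%:E)%E).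
  under eq_integral do rewrite /= ger0_norm ?powR_ge0//.
  apply: ge0_subset_integral => //.
  - exact: bigcup_measurable.
  - by move=> t _; rewrite lee_fin powR_ge0.
rewrite -(cvg_lim _ cA)//; apply: lime_le; first by apply/cvg_ex; eexists; exact: cA.
by apply: nearW => n; exact: step.
Qed.

(** Near 0, psi is at most a multiple of t^(-2a) by [psi_sin_le] and [sin_ge_half], and 2a < 1. *)
Lemma integrable_psi (a : R) : 0 < a < 2^-1 ->
  mu.-integrable `[0%R, pi / 2] (EFin \o psi a).
Proof.
move=> /andP[a0 a1]; have p2 : 0 < pi / 2 :> R by rewrite divr_gt0 ?pi_gt0.
have b01 : 0 <= 2 * a < 1 by lra.
apply: integrable_itvoo; first exact: measurable_psi.
have i0 := @integrableZl _ TR R mu _ (measurable_itv _) (2 * 2 `^ (2 * a)) _ (integrable_powRN b01 p2).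
have sub : `]0, (pi / 2)[ `<=` (`[0, (pi / 2)]%classic : set TR).
  by move=> t /=; rewrite !in_itv/= => /andP[/ltW -> /ltW ->].
have io : mu.-integrable (`]0, (pi / 2)[%classic : set TR) (fun t => ((2 * 2 `^ (2 * a))%:E * (t `^ (- (2 * a)))%:E)%E).
  by apply: integrableS i0.
apply: le_integrable io => //.
  by apply/measurable_EFinP; apply: measurable_funTS; exact: measurable_psi.
move=> t /=; rewrite in_itv/= => t01; rewrite lee_fin !ger0_norm ?psi_ge0//; last first.
  by rewrite !mulr_ge0 ?powR_ge0.
have aa : 0 < a <= 2^-1 by rewrite a0 ltW.
apply: le_trans (psi_sin_le aa t01) _; rewrite -mulrA ler_wpM2l//.
have /andP[t0 t1] := t01.
have t2 : 0 < t / 2 by rewrite divr_gt0.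
have : t / 2 <= sin t by apply: sin_ge_half; rewrite !ltW.
move=> h; rewrite !powRN; apply: (@le_trans _ _ ((t / 2) `^ (2 * a))^-1).
  rewrite lef_pV2 ?posrE ?powR_gt0 ?(lt_le_trans t2)//.
  apply: ge0_ler_powR; rewrite ?nnegrE ?(ltW t2)//; first by case/andP: b01.
  exact: le_trans (ltW t2) h.
rewrite powRM ?(ltW t0)// invfM mulrC ler_wpM2r// ?invr_ge0 ?powR_ge0//.
by rewrite -powRN -powR_inv1// -powRrM mulN1r opprK.
Qed.

Variables (n : nat) (E : symmetric_space R n.+1) (K : R).
Hypothesis EK : admissible_constant 6 E K.

Lemma snorm_laplacian_pow (a : R) f : 0 < a < 2^-1 ->
  E (laplacian_pow a f) <= K_alpha a * K * snormR E (grad_abs f).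
Proof.
move=> a01; have /andP[a0 a1] := a01; have aa : 0 < a <= 2^-1 by rewrite a0 ltW.
have g0 := Gamma_gt0 aa; have ip := integrable_psi a01.
have -> : laplacian_pow a f = (fun x => (- (4 `^ a / Gamma (1 - a)))%:C *
    cintegral mu `[0%R, pi / 2]
      (fun t => ofreal (psi a t) * cderive (fun s => cos_laplacian s f x) t)).
  by apply/funext => x; exact: laplacian_pow_integral.
rewrite snormZ cabs_real normrN ger0_norm ?divr_ge0 ?powR_ge0 ?(ltW g0)//.
have iphi : cintegrable mu `[0%R, pi / 2] (fun t => ofreal (psi a t)).
  split; first exact: ip.
  exact: integrable0.
apply: le_trans (ler_wpM2l _ (snorm_heat_integral EK f iphi)) _.
  by rewrite divr_ge0 ?powR_ge0 ?(ltW g0).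
have -> : \int[mu]_(t in `[0%R, pi / 2]) cabs (ofreal (psi a t)) =
    \int[mu]_(t in `[0%R, pi / 2]) psi a t.
  by apply: eq_Rintegral => t _; rewrite cabs_real ger0_norm ?psi_ge0.
have -> : K_alpha a = (Gamma (1 - a))^-1 * \int[mu]_(t in `[0%R, pi / 2]) psi a t by [].
set J := \int[mu]_(t in _) _; set G := snormR _ _.
have J0 : 0 <= J by apply: Rintegral_ge0 => t _; exact: psi_ge0.
have KG : 0 <= 2^-1 * K * G.
  apply: le_trans (CE_norm_grad_mx f EK); have [V [s [sv _]]] := exists_sv_decomp (grad_mx f).
  by rewrite (CE_normE E sv) gauge_ge0.
(* The bound 4^a <= 2 compensates the factor 1/2 of the main inequality. *)
have p4 : 4 `^ a <= 2 :> R.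
  apply: (@le_trans _ _ (4 `^ 2^-1)); first by apply: ler_powR => //; rewrite ?ler1n// ltW.
  rewrite powR12_sqrt// (_ : 4 = 2 ^+ 2); last by rewrite -natrX.
  by rewrite sqrtr_sqr ger0_norm.
have -> : (Gamma (1 - a))^-1 * J * K * G = 2 / Gamma (1 - a) * ((2^-1 * K * G) * J) by field; rewrite gt_eqF.
apply: ler_wpM2r; first exact: mulr_ge0.
by apply: ler_wpM2r => //; rewrite invr_ge0 ltW.
Qed.

End FractionalPower.

(** * Truncated convolutions on the circle *)

Section MonotoneIntegral.
Context d (T : measurableType d) (R : realType) (m : {measure set T -> \bar R}).
Import HBNNSimple.

(* [ge0_le_integral] without any measurability: the integral of a nonnegative
   function is a supremum over the simple functions below it. *)
Lemma ge0_le_integral_nonmeasurable (D : set T) (f g : T -> \bar R) :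
  (forall x, D x -> (0 <= f x)%E) -> (forall x, D x -> (f x <= g x)%E) ->
  (\int[m]_(x in D) f x <= \int[m]_(x in D) g x)%E.
Proof.
move=> f0 fg; have g0 x : D x -> (0 <= g x)%E by move=> Dx; exact: le_trans (f0 x Dx) (fg x Dx).
rewrite !ge0_integralE//; apply: ub_ereal_sup => _ [h hf <-].
apply: ereal_sup_ubound; exists h => // x; apply: le_trans (hf x) _.
by rewrite !patchE; case: ifPn => // /[!inE]; exact: fg.
Qed.

End MonotoneIntegral.

(** * Reflections and translations of periodic integrals *)

Section PeriodicIntegral.
Variable R : realType.
Local Notation mu := (@lebesgue_measure R).
Local Notation TR := (measurableTypeR R).
Local Open Scope ereal_scope.

Lemma measurable_reflect (c : R) : measurable_fun [set: TR] (fun x : TR => (c - x)%R : TR).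
Proof. by apply: measurable_funB. Qed.

(** Lebesgue measure is determined by half-open intervals; a reflection only changes which endpoint
    is included. *)
Lemma lebesgue_measure_reflect (c : R) (A : set TR) : measurable A ->
  mu ((fun x : TR => (c - x)%R) @^-1` A) = mu A.
Proof.
pose phi : {mfun TR >-> TR} := HB.pack (fun x : TR => (c - x)%R : TR)
  (isMeasurableFun.Build _ _ _ _ _ (measurable_reflect c)).
move=> mA; apply/esym; apply: (lebesgue_measure_unique (mu := pushforward mu phi)) mA.
move=> _ [[a b]] _ <-; rewrite /pushforward.
transitivity (mu `[(c - b)%R, (c - a)%R[%classic); last first.
  by congr (mu _); apply/seteqP; split => x /=; rewrite !in_itv/=; lra.
rewrite [LHS]lebesgue_measure_itv [RHS]lebesgue_measure_itv /= !lte_fin.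
rewrite ltrD2l ltrN2; case: ifP => // _; rewrite -!EFinD; congr EFin; ring.
Qed.

Lemma ge0_integral_reflect (c : R) (D : set TR) (f : TR -> \bar R) :
  measurable D -> measurable_fun D f -> (forall x, D x -> 0 <= f x) ->
  \int[mu]_(x in (fun x : TR => (c - x)%R : TR) @^-1` D) f (c - x)%R =
  \int[mu]_(x in D) f x.
Proof.
move=> mD mf f0.
rewrite -(@ge0_integral_pushforward _ _ TR TR R _ (measurable_reflect c) mu D f)//; last first.
  by move=> x /set_mem; exact: f0.
apply: eq_measure_integral; first exact: measurable_reflect.
by move=> ? A mA _; exact: (lebesgue_measure_reflect c mA).
Qed.

(** A translation is a product of two reflections, so the invariance of the measure is proved for
    reflections only. *)
Lemma ge0_integral_shift (c a b : R) (f : TR -> \bar R) :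
  measurable_fun [set: TR] f -> (forall x, 0 <= f x) ->
  \int[mu]_(x in `]a, b]) f (x + c)%R = \int[mu]_(x in `](a + c)%R, (b + c)%R]) f x.
Proof.
move=> mf f0.
have mf' : measurable_fun [set: TR] (fun x : TR => f (c - x)%R).
  exact: measurableT_comp (measurable_reflect c).
rewrite -(@ge0_integral_reflect c `](a + c)%R, (b + c)%R]%classic f)//; last exact: measurable_funTS.
have -> : (fun x : TR => (c - x)%R : TR) @^-1` `](a + c)%R, (b + c)%R] = `[(- b)%R, (- a)%R[%classic.
  by apply/seteqP; split => x /=; rewrite !in_itv/=; lra.
rewrite -(@ge0_integral_reflect 0 `[(- b)%R, (- a)%R[%classic (fun x => f (c - x)%R))//; last exact: measurable_funTS.
have -> : (fun x : TR => (0 - x)%R : TR) @^-1` `[(- b)%R, (- a)%R[ = `]a, b]%classic.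
  by apply/seteqP; split => x /=; rewrite !in_itv/=; lra.
by apply: eq_integral => x _; congr f; rewrite sub0r opprK addrC.
Qed.

Section Periodic.
Variable f : TR -> \bar R.
Hypothesis mf : measurable_fun [set: TR] f.
Hypothesis f0 : forall x, 0 <= f x.
Hypothesis f_per : forall x, f (x + 2 * pi)%R = f x.

Let split (a b c : R) : (a <= b <= c)%R ->
  \int[mu]_(x in `]a, c]) f x = \int[mu]_(x in `]a, b]) f x + \int[mu]_(x in `]b, c]) f x.
Proof.
move=> /andP[ab bc].
have -> : `]a, c]%classic = `]a, b] `|` `]b, c] :> set TR.
  by rewrite -(@itv_bndbnd_setU _ _ _ (BRight b))// bnd_simp.
rewrite ge0_integral_setU//; first exact: measurable_funTS.
apply/disj_setPS => x [/=]; rewrite !in_itv/= => /andP[_ xb] /andP[bx _].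
by move: bx; rewrite ltNge xb.
Qed.

Let shift2pi (a b : R) :
  \int[mu]_(x in `](a + 2 * pi)%R, (b + 2 * pi)%R]) f x = \int[mu]_(x in `]a, b]) f x.
Proof. by rewrite -ge0_integral_shift//; apply: eq_integral => x _; exact: f_per. Qed.

Lemma ge0_integral_period (c : R) : (- (2 * pi) <= c <= 2 * pi)%R ->
  \int[mu]_(x in `](c - pi)%R, (c + pi)%R]) f x = \int[mu]_(x in `](- pi)%R, pi]) f x.
Proof.
move=> /andP[c1 c2]; have p0 := @pi_gt0 R; have [c0|c0] := leP 0%R c.
  rewrite (@split (c - pi) pi (c + pi)); last by lra.
  rewrite (@split (- pi) (c - pi) pi); last by lra.
  rewrite addeC; congr (_ + _).
  rewrite -(shift2pi (- pi) (c - pi)).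
  have -> : (- pi + 2 * pi = pi :> R)%R by ring.
  by have -> : (c - pi + 2 * pi = c + pi)%R by ring.
rewrite (@split (c - pi) (- pi) (c + pi)); last by lra.
rewrite (@split (- pi) (c + pi) pi); last by lra.
rewrite addeC; congr (_ + _).
rewrite -(shift2pi (c - pi) (- pi)).
have -> : (- pi + 2 * pi = pi :> R)%R by ring.
by have -> : (c - pi + 2 * pi = c + pi)%R by ring.
Qed.

Lemma ge0_integral_reflect_period (c : R) : (- (2 * pi) <= c <= 2 * pi)%R ->
  \int[mu]_(x in `[(- pi)%R, pi]) f (c - x)%R = \int[mu]_(x in `[(- pi)%R, pi]) f x.
Proof.
move=> cD; have mfc : measurable_fun [set: TR] (fun x : TR => f (c - x)%R).
  exact: measurableT_comp (measurable_reflect c).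
rewrite (@integral_itv_bndoo _ (- pi)%R pi f true false); last exact: measurable_funTS.
rewrite -(@integral_itv_bndoo _ (- pi)%R pi f false false); last exact: measurable_funTS.
rewrite -(ge0_integral_period cD).
rewrite -(@ge0_integral_reflect c `](c - pi)%R, (c + pi)%R]%classic f)//; last exact: measurable_funTS.
have -> : (fun x : TR => (c - x)%R : TR) @^-1` `](c - pi)%R, (c + pi)%R] = `[(- pi)%R, pi[%classic.
  by apply/seteqP; split => x /=; rewrite !in_itv/=; lra.
rewrite (@integral_itv_bndoo _ (- pi)%R pi (fun x => f (c - x)%R) true false); last exact: measurable_funTS.
by rewrite -(@integral_itv_bndoo _ (- pi)%R pi (fun x => f (c - x)%R) true true)//; exact: measurable_funTS.
Qed.

End Periodic.

Lemma ge0_integral_translate_period (f : TR -> \bar R) (c : R) :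
  measurable_fun [set: TR] f -> (forall x, 0 <= f x) ->
  (forall x, f (x + 2 * pi)%R = f x) -> (- (2 * pi) <= c <= 2 * pi)%R ->
  \int[mu]_(x in `[(- pi)%R, pi]) f (x - c)%R = \int[mu]_(x in `[(- pi)%R, pi]) f x.
Proof.
move=> mf f0 fp cD; have p0 := @pi_gt0 R.
have mg : measurable_fun [set: TR] (fun x : TR => f (0 - x)%R).
  exact: measurableT_comp (measurable_reflect 0).
have gp x : f (0 - (x + 2 * pi))%R = f (0 - x)%R.
  by rewrite -(fp (0 - (x + 2 * pi))%R); congr f; ring.
rewrite -[RHS](@ge0_integral_reflect_period f mf f0 fp 0); last by lra.
rewrite -(@ge0_integral_reflect_period (fun x => f (0 - x)%R) mg _ gp c)//.
by apply: eq_integral => x _; congr f; ring.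
Qed.

Lemma Rintegral_reflect_period (g : R -> R) (c : R) :
  measurable_fun [set: TR] g -> (forall x, g (x + 2 * pi)%R = g x) ->
  (- (2 * pi) <= c <= 2 * pi)%R ->
  (\int[mu]_(x in `[(- pi)%R, pi]) g (c - x) = \int[mu]_(x in `[(- pi)%R, pi]) g x)%R.
Proof.
move=> mg gp cD; rewrite /Rintegral; congr fine; rewrite [LHS]integralE [RHS]integralE.
have mE : measurable_fun [set: TR] (EFin \o g) by apply/measurable_EFinP.
congr (_ - _).
  etransitivity; last apply: (@ge0_integral_reflect_period (EFin \o g)^\+ _ _ _ c) => //.
  - by apply: eq_integral => x _; rewrite ?funeposE ?funenegE.
  - exact: measurable_funepos.
  - by move=> x; rewrite !funeposE /= gp.
etransitivity; last apply: (@ge0_integral_reflect_period (EFin \o g)^\- _ _ _ c) => //.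
- by apply: eq_integral => x _; rewrite ?funeposE ?funenegE.
- exact: measurable_funeneg.
- by move=> x; rewrite !funenegE /= gp.
Qed.

Lemma integrable_reflect_period (g : R -> R) (c : R) :
  measurable_fun [set: TR] g -> (forall x, g (x + 2 * pi)%R = g x) ->
  (- (2 * pi) <= c <= 2 * pi)%R ->
  mu.-integrable `[(- pi)%R, pi] (EFin \o g) ->
  mu.-integrable `[(- pi)%R, pi] (EFin \o (fun x => g (c - x)%R)).
Proof.
move=> mg gp cD /integrableP[_ gi].
have mgc : measurable_fun [set: TR] (fun x : TR => g (c - x)%R).
  exact: measurableT_comp mg (measurable_reflect c).
apply/integrableP; split; first by apply/measurable_EFinP; exact: measurable_funTS.
have h := @ge0_integral_reflect_period (fun x => `|(g x)%:E|) _ (fun x => abse_ge0 _) _ c cD.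
rewrite [X in X < _](h _ _)//.
- by apply: measurableT_comp => //; apply/measurable_EFinP.
- by move=> x; rewrite gp.
Qed.

End PeriodicIntegral.

(** * Bessel's inequality *)

Section Bessel.
Context d (T : measurableType d) (R : realType) (m : {measure set T -> \bar R}) (D : set T).
Hypothesis mD : measurable D.
Hypothesis finD : (m D < +oo)%E.

Lemma integrable_Rsum (J : finType) (F : J -> T -> R) :
  (forall i, m.-integrable D (EFin \o F i)) ->
  m.-integrable D (EFin \o (fun x => \sum_i F i x)).
Proof.
move=> iF; have -> : EFin \o (fun x => \sum_i F i x) =
    (fun x => (\sum_(i <- index_enum J | xpredT i) (EFin \o F i) x)%E).
  by apply/funext => x; rewrite /= sumEFin.
by apply: (@integrable_sum _ _ _ m D mD J (index_enum J) xpredT) => j _; exact: iF.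
Qed.

Lemma integrable_of_sqr (g : T -> R) : measurable_fun D g ->
  m.-integrable D (EFin \o (fun x => g x ^+ 2)) -> m.-integrable D (EFin \o g).
Proof.
move=> mg ig2.
have i1 : m.-integrable D (EFin \o cst (1 : R)).
  by apply: measurable_bounded_integrable => //; exact: bounded_cst.
apply: (le_integrable mD _ _ (integrableD mD i1 ig2)); first exact/measurable_EFinP.
move=> x Dx; rewrite /= lee_fin [leRHS]ger0_norm ?addr_ge0 ?sqr_ge0//.
have -> : g x ^+ 2 = `|g x| ^+ 2 by rewrite real_normK// num_real.
have := normr_ge0 (g x); set y := `|g x| => y0; nra.
Qed.

Variables (I : finType) (e : I -> T -> R) (p : R).
Hypothesis me : forall i, measurable_fun D (e i).
Hypothesis e1 : forall i x, `|e i x| <= 1.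
Hypothesis p0 : 0 < p.
Hypothesis e_orth : forall i j,
  \int[m]_(x in D) (e i x * e j x) = if i == j then p else 0.

Let iee i j : m.-integrable D (EFin \o (fun x => e i x * e j x)).
Proof.
apply: measurable_bounded_integrable => //; first exact: measurable_funM.
exists 1; split; first exact: num_real.
by move=> M /ltW hM x _ /=; rewrite (le_trans _ hM)// normrM mulr_ile1.
Qed.

Lemma Rintegral_orthogonal_sum (c : I -> R) :
  \int[m]_(x in D) ((\sum_i c i * e i x) ^+ 2) = p * \sum_i c i ^+ 2.
Proof.
have E x : (\sum_i c i * e i x) ^+ 2 = \sum_i \sum_j (c i * c j) * (e i x * e j x).
  rewrite expr2 mulr_suml; apply: eq_bigr => i _; rewrite mulr_sumr.
  by apply: eq_bigr => j _; ring.
under eq_Rintegral do rewrite E.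
have ic i j : m.-integrable D (EFin \o (fun x => (c i * c j) * (e i x * e j x))).
  exact: (@integrableZl _ _ _ _ _ mD (c i * c j) _ (iee i j)).
rewrite (Rintegral_sum mD); last first.
  by move=> i; apply: integrable_Rsum => j; exact: ic.
rewrite mulr_sumr; apply: eq_bigr => i _.
rewrite (Rintegral_sum mD (ic i)) (bigD1 i)//= big1 ?addr0 => [|j ji].
  by rewrite (RintegralZl _ mD (iee i i)) e_orth eqxx; ring.
by rewrite (RintegralZl _ mD (iee i j)) e_orth eq_sym (negPf ji) mulr0.
Qed.

Lemma Bessel_inequality (g : T -> R) : measurable_fun D g ->
  m.-integrable D (EFin \o (fun x => g x ^+ 2)) ->
  \sum_i (\int[m]_(x in D) (g x * e i x)) ^+ 2 <= p * \int[m]_(x in D) (g x ^+ 2).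
Proof.
move=> mg ig2; have ig := integrable_of_sqr mg ig2.
have ige i : m.-integrable D (EFin \o (fun x => g x * e i x)).
  by apply: (integrable_mul_bounded mD ig (me i)) => x _; exact: e1.
pose al i := \int[m]_(x in D) (g x * e i x).
pose b i := p^-1 * al i.
have ib i : m.-integrable D (EFin \o (fun x => (2 * b i) * (g x * e i x))).
  exact: (@integrableZl _ _ _ _ _ mD (2 * b i) _ (ige i)).
pose s x := \sum_i b i * e i x.
have is2 : m.-integrable D (EFin \o (fun x => s x ^+ 2)).
  have ms : measurable_fun D s.
    by apply: measurable_sum => i; apply: measurable_funM.
  apply: measurable_bounded_integrable => //; first exact: measurable_funX.
  have bs x : `|s x| <= \sum_i `|b i|.
    apply: le_trans (ler_norm_sum _ _ _) _; apply: ler_sum => i _.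
    by rewrite normrM ler_piMr.
  exists ((\sum_i `|b i|) ^+ 2); split; first exact: num_real.
  move=> M /ltW hM x _ /=; rewrite (le_trans _ hM)// normrX.
  by rewrite ler_pXn2r ?nnegrE ?sumr_ge0.
have igs : m.-integrable D (EFin \o (fun x => \sum_i (2 * b i) * (g x * e i x))).
  exact: integrable_Rsum.
have : 0 <= \int[m]_(x in D) ((g x ^+ 2 - \sum_i (2 * b i) * (g x * e i x)) + s x ^+ 2).
  apply: Rintegral_ge0 => x _.
  have -> : g x ^+ 2 - \sum_i (2 * b i) * (g x * e i x) + s x ^+ 2 = (g x - s x) ^+ 2.
    rewrite (_ : \sum_i _ = 2 * g x * s x); first by ring.
    by rewrite /s mulr_sumr; apply: eq_bigr => i _; ring.
  exact: sqr_ge0.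
rewrite (RintegralD mD _ is2); last exact: (integrableB mD ig2 igs).
rewrite (RintegralB mD ig2 igs) (Rintegral_sum mD ib) (Rintegral_orthogonal_sum b).
have -> : \sum_i \int[m]_(x in D) (2 * b i * (g x * e i x)) = 2 * (p^-1 * \sum_i al i ^+ 2).
  rewrite !mulr_sumr; apply: eq_bigr => i _; rewrite (RintegralZl _ mD (ige i)) -/(al i) /b.
  by ring.
have -> : p * \sum_i b i ^+ 2 = p^-1 * \sum_i al i ^+ 2.
  by rewrite !mulr_sumr; apply: eq_bigr => i _; rewrite /b; field; rewrite gt_eqF.
set J := \int[m]_(x in D) _; set S := \sum_i _ => h.
have : p^-1 * S <= J by lra.
by rewrite mulrC ler_pdivrMr// mulrC.
Qed.

End Bessel.

Section Trigonometric.
Variable R : realType.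
Local Notation mu := (@lebesgue_measure R).
Local Notation TR := (measurableTypeR R).
Local Notation D := (`[(- pi)%R, pi]%classic : set TR).

Lemma sin_natpi (k : nat) : sin (k%:R * pi) = 0 :> R.
Proof.
elim: k => [|k IHk]; first by rewrite mul0r sin0.
by rewrite -natr1 mulrDl mul1r sinD IHk sinpi mul0r mulr0 addr0.
Qed.

Lemma continuous_sinM (c : R) : continuous (fun t : R => sin (c * t)).
Proof.
move=> t; apply: continuous_comp; last exact: continuous_sin.
by apply: cvgM; [exact: cvg_cst|exact: cvg_id].
Qed.

Lemma continuous_cosM (c : R) : continuous (fun t : R => cos (c * t)).
Proof.
move=> t; apply: continuous_comp; last exact: continuous_cos.
by apply: cvgM; [exact: cvg_cst|exact: cvg_id].
Qed.

Let Npi_lt : - pi < pi :> R. Proof. by have := @pi_gt0 R; lra. Qed.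

Lemma Rintegral_cosM (c : R) : sin (c * pi) = 0 ->
  \int[mu]_(t in `[- pi, pi]) cos (c * t) = if c == 0 then 2 * pi else 0.
Proof.
move=> s0; have [->|c0] := eqVneq c 0.
  have d (t : R) : is_derive t 1 id (cos (0 * t)).
    by rewrite mul0r cos0; exact: is_derive_id.
  by rewrite (Rintegral_derive Npi_lt (@continuous_cosM 0) d); ring.
have d (t : R) : is_derive t 1 (fun t => c^-1 * sin (c * t)) (cos (c * t)).
  have dl : is_derive t 1 (fun t : R => c * t) c.
    by apply: is_derive_eq (is_deriveZ c (is_derive_id t 1)) _; rewrite /GRing.scale /= mulr1.
  have d := is_deriveZ c^-1 (is_derive1_comp (is_derive_sin (c * t)) dl).
  by apply: is_derive_eq d _; rewrite /GRing.scale /=; field.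
by rewrite (Rintegral_derive Npi_lt (@continuous_cosM c) d) mulrN sinN s0 oppr0 mulr0 subr0.
Qed.

Lemma Rintegral_sinM (c : R) : \int[mu]_(t in `[- pi, pi]) sin (c * t) = 0.
Proof.
have [->|c0] := eqVneq c 0.
  by under eq_Rintegral do rewrite mul0r sin0; rewrite Rintegral_cst ?mul0r.
have d (t : R) : is_derive t 1 (fun t => (- c^-1) * cos (c * t)) (sin (c * t)).
  have dl : is_derive t 1 (fun t : R => c * t) c.
    by apply: is_derive_eq (is_deriveZ c (is_derive_id t 1)) _; rewrite /GRing.scale /= mulr1.
  have d := is_deriveZ (- c^-1) (is_derive1_comp (is_derive_cos (c * t)) dl).
  by apply: is_derive_eq d _; rewrite /GRing.scale /=; field.
by rewrite (Rintegral_derive Npi_lt (@continuous_sinM c) d) mulrN cosN subrr.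
Qed.

(** The constant function is left out: the kernels to be convolved are sine polynomials, which see
    only nonzero frequencies. Index k stands for frequency k + 1. *)
Definition trig K (i : 'I_K * bool) (t : R) : R :=
  if i.2 then sin (i.1.+1%:R * t) else cos (i.1.+1%:R * t).

Lemma measurable_trig K (i : 'I_K * bool) : measurable_fun [set: TR] (trig i).
Proof.
rewrite /trig; case: i.2; apply: continuous_measurable_fun.
  exact: continuous_sinM.
exact: continuous_cosM.
Qed.

Lemma trig_le1 K (i : 'I_K * bool) t : `|trig i t| <= 1.
Proof. by rewrite /trig ler_norml; case: i.2; rewrite ?sin_geN1 ?sin_le1 ?cos_geN1 ?cos_le1. Qed.

Lemma trig_orthogonal K (i j : 'I_K * bool) :
  \int[mu]_(t in `[- pi, pi]) (trig i t * trig j t) = if i == j then pi else 0.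
Proof.
case: i j => [i a] [j b]; rewrite /trig /=; set k : R := i.+1%:R; set l : R := j.+1%:R.
have skl : sin ((k - l) * pi) = 0 by rewrite mulrBl sinB !sin_natpi mul0r mulr0 subr0.
have skl' : sin ((k + l) * pi) = 0 by rewrite mulrDl sinD !sin_natpi mul0r mulr0 addr0.
have kl0 : (k + l == 0) = false.
  by rewrite /k /l -natrD pnatr_eq0.
have klE : (k - l == 0) = (i == j).
  by rewrite subr_eq0 eqr_nat eqSS.
have iC (c : R) : mu.-integrable D (EFin \o (fun t => cos (c * t))).
  apply: continuous_compact_integrable; first exact: segment_compact.
  by apply: continuous_subspaceT; exact: continuous_cosM.
have iS (c : R) : mu.-integrable D (EFin \o (fun t => sin (c * t))).
  apply: continuous_compact_integrable; first exact: segment_compact.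
  by apply: continuous_subspaceT; exact: continuous_sinM.
have comb (f g : R -> R) (u : R) : mu.-integrable D (EFin \o f) -> mu.-integrable D (EFin \o g) ->
    \int[mu]_(t in D) (2^-1 * f t + u * g t) = 2^-1 * \int[mu]_(t in D) f t + u * \int[mu]_(t in D) g t.
  move=> fi gi; rewrite (@RintegralD _ TR R mu D _ _ (measurable_itv _)).
  - rewrite (@RintegralZl _ TR R mu D f 2^-1 (measurable_itv _) fi).
    by rewrite (@RintegralZl _ TR R mu D g u (measurable_itv _) gi).
  - exact: (@integrableZl _ TR R mu D (measurable_itv _) 2^-1 _ fi).
  - exact: (@integrableZl _ TR R mu D (measurable_itv _) u _ gi).
have hpi : 2^-1 * (2 * pi) = pi :> R by field.
case: a; case: b => /=.
- transitivity (\int[mu]_(t in D) (2^-1 * cos ((k - l) * t) + (- 2^-1) * cos ((k + l) * t))).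
    by apply: eq_Rintegral => t _; rewrite mulrBl mulrDl cosB cosD; field.
  rewrite comb// !Rintegral_cosM// kl0 klE mulr0 addr0 xpair_eqE andbT.
  by case: eqP; rewrite ?hpi ?mulr0.
- transitivity (\int[mu]_(t in D) (2^-1 * sin ((k + l) * t) + 2^-1 * sin ((k - l) * t))).
    by apply: eq_Rintegral => t _; rewrite mulrBl mulrDl sinB sinD; field.
  by rewrite comb// !Rintegral_sinM !mulr0 addr0 xpair_eqE andbF.
- transitivity (\int[mu]_(t in D) (2^-1 * sin ((k + l) * t) + (- 2^-1) * sin ((k - l) * t))).
    by apply: eq_Rintegral => t _; rewrite mulrBl mulrDl sinB sinD; field.
  by rewrite comb// !Rintegral_sinM !mulr0 addr0 xpair_eqE andbF.
- transitivity (\int[mu]_(t in D) (2^-1 * cos ((k - l) * t) + 2^-1 * cos ((k + l) * t))).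
    by apply: eq_Rintegral => t _; rewrite mulrBl mulrDl cosB cosD; field.
  rewrite comb// !Rintegral_cosM// kl0 klE mulr0 addr0 xpair_eqE andbT.
  by case: eqP; rewrite ?hpi ?mulr0.
Qed.

End Trigonometric.

(** * Convolutions bounded on L^2 of the circle *)

Section PeriodicConvolution.
Variable R : realType.
Local Notation mu := (@lebesgue_measure R).
Local Notation TR := (measurableTypeR R).
Local Notation D := (`[(- pi)%R, pi]%classic : set TR).
Variable g : R -> R.
Hypothesis mg : measurable_fun [set: TR] g.
Hypothesis g_per : forall x, g (x + 2 * pi) = g x.
Hypothesis ig2 : mu.-integrable D (EFin \o (fun x => g x ^+ 2)).

Let mD : measurable D. Proof. exact: measurable_itv. Qed.

Let p_gt0 : 0 < pi :> R. Proof. exact: pi_gt0. Qed.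

Let muD : (mu D < +oo)%E.
Proof.
by rewrite /= lebesgue_measure_itv /=; case: ifP => _; rewrite ?ltry.
Qed.

Let ig : mu.-integrable D (EFin \o g).
Proof. by apply: (integrable_of_sqr mD muD) => //; exact: measurable_funTS. Qed.

Let mgx (x : R) : measurable_fun [set: TR] (fun t : TR => g (x - t)).
Proof. exact: measurableT_comp mg (measurable_reflect x). Qed.

Let D2 (x : R) : - pi <= x <= pi -> - (2 * pi) <= x <= 2 * pi.
Proof. by have := p_gt0; lra. Qed.

Lemma integrable_convolution (h : R -> R) (M x : R) : measurable_fun [set: TR] h ->
  (forall t, - pi < t < pi -> `|h t| <= M) -> - pi <= x <= pi ->
  mu.-integrable D (EFin \o (fun t => h t * g (x - t))).
Proof.
move=> mh hM xD; apply: integrable_itvoo; first exact: measurable_funM.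
have sub : `]- pi, pi[ `<=` D.
  by move=> t /=; rewrite !in_itv/= => /andP[/ltW -> /ltW ->].
have ix := integrable_reflect_period mg g_per (D2 xD) ig.
have io : mu.-integrable (`](- pi), pi[%classic : set TR) (EFin \o (fun t => g (x - t))).
  by apply: integrableS ix.
have := @integrable_mul_bounded _ TR R mu `](- pi), pi[%classic (measurable_itv _) _ h M io.
move=> /(_ (measurable_funTS mh)) H.
have -> : (fun t => h t * g (x - t)) = (fun t => g (x - t) * h t).
  by apply/funext => t; rewrite mulrC.
by apply: H => t /=; rewrite in_itv/=; exact: hM.
Qed.

(** Convolution with a sine polynomial multiplies the trigonometric coefficients of g by numbers of
    modulus at most M, up to exchanging sine and cosine. Orthogonality of the result gives one
    factor pi and Bessel's inequality for g the other. [A] is this trigonometric polynomial,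
    measurable on the whole line. *)
Lemma trig_polynomial_convolution K (c : 'I_K -> R) (M : R) :
  (forall k, `|c k| <= M) -> exists A : R -> R,
  [/\ measurable_fun [set: TR] A,
      forall x, - pi <= x <= pi ->
        \int[mu]_(t in D) ((\sum_k c k * sin (k.+1%:R * t)) * g (x - t)) = A x,
      mu.-integrable D (EFin \o (fun x => A x ^+ 2))
    & \int[mu]_(x in D) (A x ^+ 2) <= (pi * M) ^+ 2 * \int[mu]_(x in D) (g x ^+ 2)].
Proof.
move=> cM.
pose al (i : 'I_K * bool) := \int[mu]_(x in D) (g x * trig i x).
(* Addition formula for sin(k (x - s)): the sine coefficient of the result is the cosine coefficient
   of g, and conversely with a sign. *)
pose b (i : 'I_K * bool) := if i.2 then c i.1 * al (i.1, false) else - (c i.1 * al (i.1, true)).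
pose A x := \sum_i b i * trig i x.
have sE (F : 'I_K * bool -> R) : \sum_i F i = \sum_k (F (k, true) + F (k, false)).
  rewrite (eq_bigr (fun i => F (i.1, i.2))); last by case.
  rewrite -(pair_bigA _ (fun k b => F (k, b))) /=.
  by apply: eq_bigr => k _; rewrite big_bool.
have mA : measurable_fun [set: TR] A.
  apply: measurable_sum => i; apply: measurable_funM; first exact: measurable_cst.
  exact: measurable_trig.
have igt (i : 'I_K * bool) : mu.-integrable D (EFin \o (fun x => g x * trig i x)).
  apply: (@integrable_mul_bounded _ TR R mu D mD _ _ 1 ig).
    by apply: measurable_funTS; exact: measurable_trig.
  by move=> x _; exact: trig_le1.
exists A; split => //.
- move=> x xD.
  have isin (k : 'I_K) : mu.-integrable D (EFin \o (fun t => c k * (sin (k.+1%:R * t) * g (x - t)))).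
    have -> : (fun t => c k * (sin (k.+1%:R * t) * g (x - t))) = (fun t => (c k * sin (k.+1%:R * t)) * g (x - t)).
      by apply/funext => t; rewrite mulrA.
    apply: (@integrable_convolution _ M) => //.
      apply: measurable_funM; first exact: measurable_cst.
      exact: (measurable_trig (k, true)).
    move=> t _; rewrite normrM -[leRHS]mulr1; apply: ler_pM => //.
    exact: (trig_le1 (k, true)).
  have -> : (fun t : TR => (\sum_k c k * sin (k.+1%:R * t)) * g (x - t)) =
      (fun t => \sum_k c k * (sin (k.+1%:R * t) * g (x - t))).
    by apply/funext => t; rewrite mulr_suml; apply: eq_bigr => k _; rewrite mulrA.
  rewrite (@Rintegral_sum _ TR R mu D mD _ _ isin) /A sE; apply: eq_bigr => k _.
  have E : (fun t => c k * (sin (k.+1%:R * t) * g (x - t))) =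
     (fun t => (fun s => c k * (sin (k.+1%:R * (x - s)) * g s)) (x - t)).
    by apply/funext => t; congr (_ * (sin (_ * _) * _)); ring.
  rewrite E (@Rintegral_reflect_period _ (fun s => c k * (sin (k.+1%:R * (x - s)) * g s)) x); last 3 first.
  + apply: measurable_funM; first exact: measurable_cst.
    apply: measurable_funM => //.
    exact: measurableT_comp (measurable_trig (k, true)) (measurable_reflect x).
  + move=> s; rewrite g_per; congr (_ * (_ * _)).
    have -> : k.+1%:R * (x - (s + 2 * pi)) = k.+1%:R * (x - s) - (2 * k.+1)%N%:R * pi.
      by rewrite natrM; ring.
    rewrite sinB sin_natpi mulr0 subr0.
    have -> : (2 * k.+1)%N%:R * pi = (k.+1%:R * pi) *+ 2 :> R by rewrite natrM mulr2n; ring.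
    by rewrite cos_mulr2n cos2sin2 sin_natpi expr0n/= subr0 mulr2n addrK mulr1.
  + exact: D2.
  have -> : (fun s : TR => c k * (sin (k.+1%:R * (x - s)) * g s)) =
     (fun s => (c k * sin (k.+1%:R * x)) * (g s * trig (k, false) s) +
               (- (c k * cos (k.+1%:R * x))) * (g s * trig (k, true) s)).
    by apply/funext => s; rewrite mulrBr sinB /trig /=; ring.
  rewrite (@RintegralD _ TR R mu D _ _ mD).
  + rewrite (@RintegralZl _ TR R mu D _ _ mD (igt (k, false))).
    rewrite (@RintegralZl _ TR R mu D _ _ mD (igt (k, true))).
    rewrite -/(al (k, false)) -/(al (k, true)) /b /trig /=; ring.
  + exact: (@integrableZl _ TR R mu D mD _ _ (igt (k, false))).
  + exact: (@integrableZl _ TR R mu D mD _ _ (igt (k, true))).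
- apply: (@bounded_integrable_itv _ _ _ _ ((\sum_i `|b i|) ^+ 2)); first exact: measurable_funX.
  move=> x _; rewrite normrX ler_pXn2r ?nnegrE ?sumr_ge0//.
  apply: le_trans (ler_norm_sum _ _ _) _; apply: ler_sum => i _.
  by rewrite normrM ler_piMr// trig_le1.
have mt (i : 'I_K * bool) : measurable_fun D (trig i).
  by apply: measurable_funTS; exact: measurable_trig.
have := @Bessel_inequality _ TR R mu D mD muD _ _ pi mt (@trig_le1 R K) p_gt0 (@trig_orthogonal R K) g (measurable_funTS mg) ig2.
rewrite (@Rintegral_orthogonal_sum _ TR R mu D mD muD _ _ pi mt (@trig_le1 R K) (@trig_orthogonal R K) b).
rewrite -/al => hB.
have hb : \sum_i b i ^+ 2 <= M ^+ 2 * \sum_i al i ^+ 2.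
  rewrite mulr_sumr !sE; apply: ler_sum => k _; rewrite /b /= sqrrN !exprMn addrC.
  have cM2 : c k ^+ 2 <= M ^+ 2.
    have M0 : 0 <= M by exact: le_trans (normr_ge0 _) (cM k).
    by rewrite -(real_normK (num_real (c k))) ler_pXn2r ?nnegrE.
  by apply: lerD; apply: ler_wpM2r => //; exact: sqr_ge0.
set J := \int[mu]_(x in D) _ in hB *.
apply: le_trans (ler_wpM2l (ltW p_gt0) hb) _.
have -> : (pi * M) ^+ 2 * J = pi * (M ^+ 2 * (pi * J)) by ring.
by apply: ler_wpM2l (ltW p_gt0) _ _ _; apply: ler_wpM2l hB; exact: sqr_ge0.
Qed.

Section Young.
Variables (w : R -> R) (M : R).
Hypothesis mw : measurable_fun [set: TR] w.
Hypothesis w0 : forall t, 0 <= w t.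
Hypothesis wM : forall t, w t <= M.

Let W : R := \int[mu]_(t in D) w t.

Hypothesis W0 : 0 < W.

Definition sqr_convolution (x : R) : \bar R :=
  (\int[mu]_(t in D) (w t * g (x - t) ^+ 2)%:E)%E.

Let iw : mu.-integrable D (EFin \o w).
Proof. by apply: (@bounded_integrable_itv _ _ _ _ M) => // t _; rewrite ger0_norm. Qed.

Lemma sqr_convolution_ge0 x : (0 <= sqr_convolution x)%E.
Proof. by apply: integral_ge0 => t _; rewrite lee_fin mulr_ge0// sqr_ge0. Qed.

(** Cauchy-Schwarz for the weight w, derived from y <= l/2 + y^2 / (2 l) with a free parameter l.
    When the right-hand side is infinite there is nothing to prove. *)
Lemma convolution_abs_sqr_le (x : R) : - pi <= x <= pi ->
  (((\int[mu]_(t in D) (w t * `|g (x - t)|)) ^+ 2)%:E <= W%:E * sqr_convolution x)%E.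
Proof.
move=> xD.
have mq : measurable_fun [set: TR] (fun t : TR => w t * g (x - t) ^+ 2).
  by apply: measurable_funM => //; exact: measurable_funX.
have [Qoo|] := eqVneq (sqr_convolution x) +oo%E.
  by rewrite Qoo gt0_muley ?leey// lte_fin.
rewrite -ltey => Qfin.
have iQ : mu.-integrable D (EFin \o (fun t => w t * g (x - t) ^+ 2)).
  apply/integrableP; split; first by apply/measurable_EFinP; exact: measurable_funTS.
  under eq_integral do rewrite /= (ger0_norm (mulr_ge0 (w0 _) (sqr_ge0 _))).
  exact: Qfin.
have -> : sqr_convolution x = (\int[mu]_(t in D) (w t * g (x - t) ^+ 2))%:E.
  by rewrite /sqr_convolution /Rintegral fineK// (integrable_fin_num mD iQ).
rewrite lee_fin; set q := \int[mu]_(t in D) (w t * g (x - t) ^+ 2).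
set b := \int[mu]_(t in D) _.
have ib : mu.-integrable D (EFin \o (fun t => w t * `|g (x - t)|)).
  have h := integrable_abse (@integrable_convolution w M x mw _ xD).
  have -> : EFin \o (fun t => w t * `|g (x - t)|) = (fun t => `|(w t * g (x - t))%:E|%E).
    by apply/funext => t; rewrite /= normrM ger0_norm.
  by apply: h => t _; rewrite ger0_norm.
have hl (l : R) : 0 < l -> b <= l / 2 * W + (2 * l)^-1 * q.
  move=> l0; rewrite /b /W /q -(@RintegralZl _ TR R mu D _ _ mD iw) -(@RintegralZl _ TR R mu D _ _ mD iQ).
  have i1 := @integrableZl _ TR R mu D mD (l / 2) _ iw.
  have i2 := @integrableZl _ TR R mu D mD (2 * l)^-1 _ iQ.
  rewrite -(@RintegralD _ TR R mu D _ _ mD i1 i2).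
  apply: (le_Rintegral mD) => //; first exact: (integrableD mD i1 i2).
  move=> t _; have -> : l / 2 * w t + (2 * l)^-1 * (w t * g (x - t) ^+ 2) =
    w t * (l / 2 + (2 * l)^-1 * g (x - t) ^+ 2) by ring.
  apply: ler_wpM2l => //.
  rewrite -(real_normK (num_real (g (x - t)))); set y := `|_|.
  have -> : l / 2 + (2 * l)^-1 * y ^+ 2 = y + (y - l) ^+ 2 / (2 * l) by field; rewrite gt_eqF.
  by rewrite lerDl divr_ge0 ?sqr_ge0// mulr_ge0// ltW.
have b0 : 0 <= b by apply: Rintegral_ge0 => t _; rewrite mulr_ge0.
move: b0; rewrite le_eqVlt => /predU1P[<-|b0].
  rewrite expr0n/= mulr_ge0 ?(ltW W0)//.
  by apply: Rintegral_ge0 => t _; rewrite mulr_ge0// sqr_ge0.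
(* At l = b / W the first term is b/2 and can be absorbed. *)
have := hl (b / W) (divr_gt0 b0 W0).
have -> : b / W / 2 * W + (2 * (b / W))^-1 * q = b / 2 + (W * q) / (2 * b).
  by field; rewrite !gt_eqF.
move=> h; have : b / 2 <= (W * q) / (2 * b) by lra.
by rewrite ler_pdivlMr ?mulr_gt0// (_ : b / 2 * (2 * b) = b ^+ 2)//; field.
Qed.

Let F (z : TR * TR) : \bar R := (w z.2 * g (z.1 - z.2) ^+ 2)%:E.

Let mF : measurable_fun [set: TR * TR] F.
Proof.
apply/measurable_EFinP; apply: measurable_funM; first exact: measurableT_comp.
by apply: measurable_funX; apply: measurableT_comp => //; exact: measurable_funB.
Qed.

Let h := F \_ (D `*` D).

Let mh : measurable_fun [set: TR * TR] h.
Proof.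
apply/(measurable_restrictT F (measurableX mD mD)).
exact: measurable_funTS.
Qed.

Let h0 z : (0 <= h z)%E.
Proof. by apply: erestrict_ge0 => y; rewrite lee_fin mulr_ge0// sqr_ge0. Qed.

Let hE x : (\int[mu]_t h (x, t))%E = (sqr_convolution \_ D) x.
Proof.
rewrite patchE; case: ifPn => xD.
  rewrite /sqr_convolution [RHS]integral_mkcond; apply: eq_integral => t _.
  by rewrite /h !patchE in_setX xD.
by rewrite integral0_eq// => t _; rewrite /h patchE in_setX (negPf xD).
Qed.

Lemma measurable_sqr_convolution : measurable_fun D sqr_convolution.
Proof.
apply/(measurable_restrictT _ mD).
have -> : sqr_convolution \_ D = fubini_F mu h by apply/funext => x; rewrite -hE.
exact: measurable_fun_fubini_tonelli_F.
Qed.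

(** By Tonelli on the square, the inner integral in x is the same for every shift t since g is
    periodic. *)
Lemma integral_sqr_convolution :
  (\int[mu]_(x in D) sqr_convolution x = (W * \int[mu]_(x in D) (g x ^+ 2))%:E)%E.
Proof.
rewrite integral_mkcond; under eq_integral do rewrite -hE.
rewrite (fubini_tonelli h)//.
have Jfin : (\int[mu]_(x in D) (g x ^+ 2)%:E)%E = (\int[mu]_(x in D) (g x ^+ 2))%:E.
  by rewrite /Rintegral fineK// (integrable_fin_num mD ig2).
set J := \int[mu]_(x in D) (g x ^+ 2) in Jfin *.
transitivity (\int[mu]_(t in D) ((w t)%:E * J%:E))%E.
  rewrite [RHS]integral_mkcond; apply: eq_integral => t _; rewrite patchE; case: ifPn => tD.
    transitivity (\int[mu]_(x in D) ((w t)%:E * (g (x - t) ^+ 2)%:E))%E.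
      rewrite [RHS]integral_mkcond; apply: eq_integral => x _.
      by rewrite /h !patchE in_setX tD andbT.
    rewrite ge0_integralZl//; last 3 first.
    - apply/measurable_EFinP; apply: measurable_funTS; apply: measurable_funX.
      by apply: measurableT_comp mg _; exact: measurable_funB.
    - by move=> x _; rewrite lee_fin sqr_ge0.
    - by rewrite lee_fin.
    congr (_ * _)%E; rewrite -Jfin.
    apply: (@ge0_integral_translate_period _ (fun x => (g x ^+ 2)%:E) t).
    - by apply/measurable_EFinP; exact: measurable_funX.
    - by move=> x; rewrite lee_fin sqr_ge0.
    - by move=> x; rewrite g_per.
    - by apply: D2; move: tD; rewrite inE/= in_itv.
  by rewrite integral0_eq// => x _; rewrite /h patchE in_setX (negPf tD) andbF.
rewrite ge0_integralZr//; last 3 first.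
- by apply/measurable_EFinP; exact: measurable_funTS.
- by move=> t _; rewrite lee_fin.
- by rewrite lee_fin; apply: Rintegral_ge0 => x _; exact: sqr_ge0.
rewrite EFinM; congr (_ * _)%E; rewrite /W /Rintegral fineK//; exact: (integrable_fin_num mD iw).
Qed.

End Young.

End PeriodicConvolution.

(** * Comparison of the truncated kernel with a conjugate Fejer kernel *)

Section KernelComparison.
Variables (R : realType) (m : nat).
Local Notation mu := (@lebesgue_measure R).
Local Notation TR := (measurableTypeR R).
Local Notation K := (m.+1%:R : R).
Implicit Types t : R.

(* Coefficients of the conjugate Fejer kernel, scaled to the singularity
   sqrt 2 / t of [H_kernel] at 0. *)
Definition fejer_coef (k : 'I_m.+1) : R := Num.sqrt 2 * (1 - k.+1%:R / K).

(** A majorant of the difference of the two kernels. The constant 2 covers [H_kernel] minus its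
    cotangent model; the Poisson-like bump covers the scale 1/K and the oscillating remainder, with
    a mass that stays bounded as K grows. *)
Definition fejer_weight t : R := 2 + 16 * K / (1 + (K * t) ^+ 2).

Let K_gt0 : 0 < K. Proof. by []. Qed.

Let r2 : 0 <= Num.sqrt 2 :> R. Proof. exact: sqrtr_ge0. Qed.

Let r2_le2 : Num.sqrt 2 <= 2 :> R.
Proof. by rewrite -(@ler_pXn2r _ 2) ?nnegrE// sqr_sqrtr//; lra. Qed.

Lemma fejer_coef_le2 k : `|fejer_coef k| <= 2.
Proof.
have h1 : k.+1%:R / K <= 1 by rewrite ler_pdivrMr// mul1r ler_nat.
have h0 : 0 <= k.+1%:R / K by rewrite divr_ge0.
have r := r2; have r' := r2_le2.
rewrite /fejer_coef ger0_norm ?mulr_ge0 ?subr_ge0//.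
by rewrite -[leRHS]mulr1; apply: ler_pM => //; rewrite ?subr_ge0// lerBlDr lerDl.
Qed.

Let sum_sin t (n : nat) :
  (1 - cos t) * (\sum_(k < n) 2 * sin (k.+1%:R * t)) = sin t + sin (n%:R * t) - sin (n.+1%:R * t).
Proof.
elim: n => [|n IHn]; first by rewrite big_ord0 mulr0 mul0r sin0 mul1r; ring.
rewrite big_ord_recr/= mulrDr IHn.
have -> : n.+2%:R * t = n.+1%:R * t + t by rewrite -[n.+2%:R]natr1; ring.
rewrite [sin (_ + t)]sinD.
have -> : n.+1%:R * t = n%:R * t + t by rewrite -[n.+1%:R]natr1; ring.
rewrite sinD cosD; set a := sin (n%:R * t); set b := cos (n%:R * t).
apply/eqP; rewrite -subr_eq0; apply/eqP.
transitivity (a * (1 - (cos t ^+ 2 + sin t ^+ 2))); first by ring.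
by rewrite cos2Dsin2 subrr mulr0.
Qed.

Let fejer_identity t (n : nat) :
  (1 - cos t) * (\sum_(k < n) (n%:R - k.+1%:R) * (2 * sin (k.+1%:R * t))) =
    n%:R * sin t - sin (n%:R * t).
Proof.
elim: n => [|n IHn]; first by rewrite big_ord0 mulr0 !mul0r sin0 subr0.
rewrite big_ord_recr/= subrr mul0r addr0.
have -> : \sum_(k < n) (n.+1%:R - k.+1%:R) * (2 * sin (k.+1%:R * t)) =
    \sum_(k < n) (n%:R - k.+1%:R) * (2 * sin (k.+1%:R * t)) + \sum_(k < n) 2 * sin (k.+1%:R * t).
  by rewrite -big_split /=; apply: eq_bigr => k _; rewrite -[n.+1%:R]natr1; ring.
have -> : n.+1%:R * sin t = n%:R * sin t + sin t by rewrite -natr1 mulrDl mul1r.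
by rewrite mulrDr IHn sum_sin; ring.
Qed.

Definition fejer_kernel t : R := \sum_k fejer_coef k * sin (k.+1%:R * t).

Lemma fejer_kernelN t : fejer_kernel (- t) = - fejer_kernel t.
Proof.
rewrite /fejer_kernel -sumrN; apply: eq_bigr => k _.
by rewrite mulrN sinN mulrN.
Qed.

Lemma fejer_kernel_le t : `|fejer_kernel t| <= 2 * K.
Proof.
apply: le_trans (ler_norm_sum _ _ _) _.
apply: (@le_trans _ _ (\sum_(k < m.+1) (2 : R))); last by rewrite sumr_const card_ord -(mulr_natr 2).
apply: ler_sum => k _; rewrite normrM -[leRHS]mulr1; apply: ler_pM => //.
  exact: fejer_coef_le2.
by rewrite ler_norml sin_geN1 sin_le1.
Qed.

(** The first term is cot(t/2), the limit kernel; the second is the oscillating remainder, of order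
    1 / (K t^2). *)
Let fejer_kernelE t : 0 < t <= pi -> fejer_kernel t =
  Num.sqrt 2 / 2 * (sin t / (1 - cos t) - sin (K * t) / (K * (1 - cos t))).
Proof.
move=> t0; have ct : 0 < 1 - cos t.
  rewrite subr_gt0 -cos0 ltr_cos ?in_itv/= ?lexx ?pi_ge0//; have := @pi_gt0 R; lra.
have -> : fejer_kernel t = Num.sqrt 2 / 2 * (K^-1 *
    \sum_(k < m.+1) (K - k.+1%:R) * (2 * sin (k.+1%:R * t))).
  rewrite /fejer_kernel !mulr_sumr; apply: eq_bigr => k _; rewrite /fejer_coef.
  by field; rewrite gt_eqF.
congr (_ * _); apply: (mulfI (lt0r_neq0 ct)).
rewrite mulrCA fejer_identity; field.
by rewrite !gt_eqF.
Qed.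

Let one_sub_cos t : 0 <= t <= pi -> t ^+ 2 / 8 <= 1 - cos t.
Proof.
move=> t01; have h : t / 2 / 2 <= sin (t / 2) by apply: sin_ge_half; lra.
have -> : 1 - cos t = 2 * sin (t / 2) ^+ 2.
  have -> : cos t = cos ((t / 2) *+ 2) by congr cos; rewrite mulr2n; field.
  by rewrite cos_mulr2n cos2sin2 mulr2n; ring.
have : (t / 2 / 2) ^+ 2 <= sin (t / 2) ^+ 2.
  by rewrite ler_pXn2r// nnegrE ?(le_trans _ h)//; lra.
lra.
Qed.

(** On ]0, pi/2[ the cotangent term is the midpoint of the two bounds in [psi_half_bounds], so the
    distance is at most half the gap, sqrt 2 / 2 (1 - cos t) / sin t. From pi/2 on, the kernel is 0
    and the cotangent term itself is small. *)
Let H_kernel_sub t : 0 < t <= pi ->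
  `|H_kernel t - Num.sqrt 2 / 2 * (sin t / (1 - cos t))| <= 2.
Proof.
move=> /andP[t0 tpi]; have p0 := @pi_gt0 R; have r := r2; have r' := r2_le2.
have s0 : 0 <= sin t by rewrite sin_ge0_pi// (ltW t0).
have s1 := sin_le1 t; have c1 := cos_le1 t.
have [t2|t2] := ltP t (pi / 2).
  have t01 : 0 < t < pi / 2 by rewrite t0.
  have sp := sin_gt0_pihalf t01; have cp := cos_gt0_0pihalf t01.
  have sc := cos2Dsin2 t.
  have scge1 : 1 <= sin t + cos t.
    move: sc s1 c1 sp cp; set s := sin t; set c := cos t => *; nra.
  have -> : H_kernel t = psi 2^-1 t.
    rewrite /H_kernel indicE mem_set/= ?in_itv/= ?gtr0_sg ?mul1r//.
    by apply/andP; split; lra.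
  have c_lt1 : 0 < 1 - cos t.
    by rewrite subr_gt0 -cos0 ltr_cos ?in_itv/= ?lexx ?pi_ge0//; lra.
  have -> : sin t / (1 - cos t) = (1 + cos t) / sin t.
    have e : sin t * sin t = (1 + cos t) * (1 - cos t) by rewrite -expr2 sin2cos2; ring.
    by rewrite -[LHS](mulfK (lt0r_neq0 sp)); congr (_ / _); rewrite mulrAC e mulfK// gt_eqF.
  have /andP[h1 h2] := psi_half_bounds t01.
  have e1 : Num.sqrt 2 / 2 * ((1 + cos t) / sin t) - Num.sqrt 2 * cos t / sin t =
    Num.sqrt 2 / 2 * ((1 - cos t) / sin t) by field; rewrite gt_eqF.
  have e2 : Num.sqrt 2 / sin t - Num.sqrt 2 / 2 * ((1 + cos t) / sin t) =
    Num.sqrt 2 / 2 * ((1 - cos t) / sin t) by field; rewrite gt_eqF.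
  have q1 : (1 - cos t) / sin t <= 1 by rewrite ler_pdivrMr// mul1r; lra.
  have q0 : 0 <= (1 - cos t) / sin t by rewrite divr_ge0// ltW.
  have h3 : Num.sqrt 2 / 2 * ((1 - cos t) / sin t) <= 2.
    by rewrite -[leRHS]mulr1; apply: ler_pM => //; lra.
  by rewrite ler_norml; apply/andP; split; lra.
have -> : H_kernel t = 0.
  move: t2; rewrite le_eqVlt => /predU1P[<-|t2].
    (* At pi/2 the default values ln 0 = 0 and 0^(-1/2) = 0 make the kernel vanish. *)
    rewrite /H_kernel cos_pihalf ln0// oppr0 powR0 ?mulr0// oppr_eq0 invr_eq0.
  rewrite /H_kernel indicE memNset ?mul0r//= in_itv/= => /andP[_].
  by rewrite leNgt t2.
have c0 : cos t <= 0.
  rewrite -cos_pihalf leNgt ltr_cos ?in_itv/= -?leNgt//.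
    by rewrite (ltW t0).
  by apply/andP; split; lra.
have q1 : sin t / (1 - cos t) <= 1 by rewrite ler_pdivrMr ?mul1r; lra.
have q0 : 0 <= sin t / (1 - cos t) by rewrite divr_ge0//; lra.
have h3 : Num.sqrt 2 / 2 * (sin t / (1 - cos t)) <= 2.
  by rewrite -[leRHS]mulr1; apply: ler_pM => //; lra.
by rewrite sub0r normrN ger0_norm// mulr_ge0//; lra.
Qed.

(** The truncation radius 1/K is the scale of the Fejer kernel. Beyond it the remainder is at most 8
    / (K t^2) and (K t)^2 >= 1; below it only the Fejer kernel is left, at most 2 K, while the bump
    is at least 8 K. *)
Let kernel_sub_pos t : 0 < t <= pi ->
  `|(if K^-1 < t then H_kernel t else 0) - fejer_kernel t| <= fejer_weight t.
Proof.
move=> t0; have /andP[tp tpi] := t0; have kt0 : 0 < K * t by rewrite mulr_gt0.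
have d0 : 0 < 1 + (K * t) ^+ 2 by rewrite ltr_pwDl// sqr_ge0.
case: ifPn => [h|].
  have kt1 : 1 < K * t by rewrite mulrC -ltr_pdivrMr// mul1r.
  have o := one_sub_cos (introT andP (conj (ltW tp) tpi)).
  have t20 : 0 < t ^+ 2 / 8 by rewrite divr_gt0// exprn_gt0.
  have ct : 0 < 1 - cos t by exact: lt_le_trans o.
  rewrite fejer_kernelE//.
  have -> : H_kernel t - Num.sqrt 2 / 2 * (sin t / (1 - cos t) - sin (K * t) / (K * (1 - cos t))) =
    (H_kernel t - Num.sqrt 2 / 2 * (sin t / (1 - cos t))) + Num.sqrt 2 / 2 * (sin (K * t) / (K * (1 - cos t))) by ring.
  apply: le_trans (ler_normD _ _) _; apply: lerD; first exact: H_kernel_sub.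
  rewrite normrM.
  have a1 : `|Num.sqrt 2 / 2| <= 1 :> R by rewrite ger0_norm ?divr_ge0//; have := r2_le2; lra.
  rewrite -[leRHS]mul1r; apply: ler_pM => //.
  rewrite normrM normfV [X in _ / X]gtr0_norm ?mulr_gt0//.
  apply: (@le_trans _ _ (1 / (K * (t ^+ 2 / 8)))).
    apply: ler_pM => //; first by rewrite ler_norml sin_geN1 sin_le1.
    by rewrite lef_pV2 ?posrE ?mulr_gt0// ler_pM2l.
  rewrite ler_pdivlMr// -mulrA mul1r mulrC ler_pdivrMr ?mulr_gt0//.
  have -> : 16 * K * (K * (t ^+ 2 / 8)) = 2 * (K * t) ^+ 2 by field.
  have : 1 <= (K * t) ^+ 2 by rewrite exprn_ege1// ltW.
  lra.
rewrite -leNgt => h.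
have kt1 : K * t <= 1 by rewrite mulrC -ler_pdivlMr// mul1r.
rewrite sub0r normrN; apply: le_trans (fejer_kernel_le t) _.
rewrite /fejer_weight; apply: (@le_trans _ _ (16 * K / (1 + (K * t) ^+ 2))); last by rewrite lerDr.
rewrite ler_pdivlMr//.
have : (K * t) ^+ 2 <= 1 by rewrite expr_le1// ltW.
by move: K_gt0; set u := (K * t) ^+ 2; move=> ? ?; nra.
Qed.

Lemma kernel_sub_le t : - pi <= t <= pi ->
  `|(if K^-1 < `|t| then H_kernel t else 0) - fejer_kernel t| <= fejer_weight t.
Proof.
move=> t01; have [t0|t0|->] := ltgtP t 0.
- have h : `|(if K^-1 < - t then H_kernel (- t) else 0) - fejer_kernel (- t)| <= fejer_weight (- t).
    by apply: kernel_sub_pos; lra.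
  have wN : fejer_weight (- t) = fejer_weight t by rewrite /fejer_weight mulrN sqrrN.
  have hN : H_kernel (- t) = - H_kernel t.
    rewrite /H_kernel cosN sgrN !indicE mulrN mulNr; congr (- (_ * _ * _)).
    congr ((nat_of_bool _)%:R); apply/idP/idP; rewrite !inE/= !in_itv/=; lra.
  rewrite (ltr0_norm t0); move: h; rewrite fejer_kernelN wN hN.
  by case: ifP => _; rewrite ?sub0r -?opprD ?normrN.
- by rewrite (gtr0_norm t0); apply: kernel_sub_pos; lra.
- have -> : fejer_kernel 0 = 0 by rewrite /fejer_kernel big1// => k _; rewrite mulr0 sin0 mulr0.
  have -> : `|0 : R| = 0 by rewrite normr0.
  rewrite ltNge invr_ge0 (ltW K_gt0) /= subr0 normr0 /fejer_weight.
  by rewrite addr_ge0// divr_ge0 ?mulr_ge0// addr_ge0// sqr_ge0.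
Qed.

Lemma fejer_weight_ge2 t : 2 <= fejer_weight t.
Proof. by rewrite /fejer_weight lerDl divr_ge0 ?mulr_ge0// addr_ge0// sqr_ge0. Qed.

Lemma fejer_weight_le t : fejer_weight t <= 2 + 16 * K.
Proof.
rewrite /fejer_weight lerD2l ler_pdivrMr ?ltr_pwDl ?sqr_ge0//.
by rewrite ler_peMr ?mulr_ge0// lerDl sqr_ge0.
Qed.

Lemma continuous_fejer_weight : continuous fejer_weight.
Proof.
move=> t; apply: cvgD; first exact: cvg_cst.
apply: cvgM; first exact: cvg_cst.
apply: cvgV; first by rewrite gt_eqF// ltr_pwDl// sqr_ge0.
apply: cvgD; first exact: cvg_cst.
apply: (@continuous_comp _ _ _ (fun s => K * s) (fun x => x ^+ 2)); last exact: exprn_continuous.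
by apply: cvgM; [exact: cvg_cst|exact: cvg_id].
Qed.

(** The bump has primitive 16 atan(K t) and thus mass below 16 pi for every K; the constant adds 4
    pi. *)
Lemma Rintegral_fejer_weight_le : \int[mu]_(t in `[- pi, pi]) fejer_weight t <= 20 * pi.
Proof.
have p0 := @pi_gt0 R; have np : - pi < pi :> R by lra.
have d (t : R) : is_derive t 1 (fun t => 2 * t + 16 * atan (K * t)) (fejer_weight t).
  have dl (c : R) : is_derive t 1 (fun t : R => c * t) c.
    by apply: is_derive_eq (is_deriveZ c (is_derive_id t 1)) _; rewrite /GRing.scale /= mulr1.
  have d := is_deriveD (dl 2) (is_deriveZ (16 : R) (is_derive1_comp (is_derive1_atan (K * t)) (dl K))).
  by apply: is_derive_eq d _; rewrite /fejer_weight /GRing.scale /=; ring.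
rewrite (Rintegral_derive np continuous_fejer_weight d) !mulrN atanN.
have := atan_ltpi2 (K * pi); lra.
Qed.

End KernelComparison.

(** * The L^2 bound for the scalar principal value operator *)

Section ConvolutionBound.
Variable R : realType.
Local Notation mu := (@lebesgue_measure R).
Local Notation TR := (measurableTypeR R).
Local Notation D := (`[(- pi)%R, pi]%classic : set TR).

Lemma le_limn_einfs (a b : (\bar R)^nat) : (forall n, (a n <= b n)%E) ->
  (limn (einfs a) <= limn (einfs b))%E.
Proof.
move=> ab; apply: lee_lim; [exact: is_cvg_einfs|exact: is_cvg_einfs|].
apply: nearW => n; apply: le_ereal_inf_tmp => _ [m /= nm <-].
by apply: le_trans (ab m); apply: ereal_inf_lbound; exists m.
Qed.

Lemma limn_einfs_le (a : (\bar R)^nat) (B : \bar R) : (forall n, (a n <= B)%E) ->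
  (limn (einfs a) <= B)%E.
Proof.
move=> aB; apply: lime_le; first exact: is_cvg_einfs.
apply: nearW => n; apply: le_trans (aB n).
by apply: ereal_inf_lbound; exists n => //=.
Qed.

Lemma Rintegral_truncated (k f : R -> R) (eps : R) :
  \int[mu]_(t in [set t : TR | (- pi <= t <= pi) /\ eps < `|t|]) (k t * f t) =
  \int[mu]_(t in D) ((if eps < `|t| then k t else 0) * f t).
Proof.
rewrite /Rintegral; congr fine; rewrite integral_mkcond [RHS]integral_mkcond.
apply: eq_integral => t _; rewrite !patchE.
have -> : (t \in [set t : TR | - pi <= t <= pi /\ eps < `|t|]) = (t \in D) && (eps < `|t|).
  by apply/idP/andP => [|[]]; rewrite !inE/= in_itv/=; [case=> -> ->|move=> -> ->].
by case: (t \in D) => //=; case: ifP => _; rewrite ?mul0r.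
Qed.

Lemma measurable_H_kernel : measurable_fun [set: TR] (@H_kernel R).
Proof.
apply: measurable_funM; last exact: (measurable_psi 2^-1).
apply: measurable_funM; first by apply: measurable_indic.
have ml (a b : R -> R) : measurable_fun [set: TR] a -> measurable_fun [set: TR] b ->
    measurable_fun [set: TR] (fun t : TR => a t < b t) by move=> ma mb; exact: measurable_fun_ltr.
apply: (eq_measurable_fun (fun t : R => if t < 0 then -1 else if 0 < t then 1 else 0 : R)).
  by move=> t _; case: sgrP.
apply: measurable_fun_ifT => //; first by apply: (ml id (cst 0)).
by apply: measurable_fun_ifT => //; apply: (ml (cst 0) id).
Qed.

Lemma measurable_truncated_H_kernel (eps : R) :
  measurable_fun [set: TR] (fun t : R => if eps < `|t| then H_kernel t else 0).
Proof.
apply: measurable_fun_ifT => //; last exact: measurable_H_kernel.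
by apply: (@measurable_fun_ltr _ TR R setT (fun=> eps) (fun t => `|t|)) => //; exact: measurableT_comp.
Qed.

Variables (g h : R -> R).
Hypothesis mg : measurable_fun [set: TR] g.
Hypothesis g_per : forall x, g (x + 2 * pi) = g x.
Hypothesis ig2 : mu.-integrable D (EFin \o (fun x => g x ^+ 2)).
Hypothesis mh : measurable_fun [set: TR] h.

Let T (x eps : R) := \int[mu]_(t in [set t : TR | (- pi <= t <= pi) /\ eps < `|t|])
   (H_kernel t * g (x - t)).

Hypothesis Th : {ae mu, forall x, T x eps @[eps --> 0^'+] --> h x}.

Let mD : measurable D. Proof. exact: measurable_itv. Qed.

Let J := \int[mu]_(x in D) (g x ^+ 2).
Let w m t := fejer_weight m t : R.
Let W m := \int[mu]_(t in D) w m t.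
Let Q m := sqr_convolution g (w m).

Let mw m : measurable_fun [set: TR] (w m).
Proof. by apply: continuous_measurable_fun; exact: continuous_fejer_weight. Qed.

Let w0 m t : 0 <= w m t. Proof. exact: le_trans (fejer_weight_ge2 m t). Qed.

Let wle m t : w m t <= 2 + 16 * m.+1%:R. Proof. exact: fejer_weight_le. Qed.

Let iw m : mu.-integrable D (EFin \o w m).
Proof.
by apply: (@bounded_integrable_itv _ _ _ _ (2 + 16 * m.+1%:R)) => // t _; rewrite ger0_norm.
Qed.

Let W_gt0 m : 0 < W m.
Proof.
have p0 := @pi_gt0 R; have np : - pi < pi :> R by lra.
have d (t : R) : is_derive t 1 (fun t => 2 * t) (2 : R).
  by apply: is_derive_eq (is_deriveZ (2 : R) (is_derive_id t 1)) _; rewrite /GRing.scale /= mulr1.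
have c2 : continuous (fun _ : R => 2 : R) by move=> t; exact: cvg_cst.
apply: (@lt_le_trans _ _ (\int[mu]_(t in D) (2 : R))).
  by rewrite (Rintegral_derive np c2 d); lra.
apply: (le_Rintegral mD) => //; first by apply: continuous_compact_integrable; [exact: segment_compact|exact: continuous_subspaceT].
by move=> t _; exact: fejer_weight_ge2.
Qed.

Let W_le m : W m <= 20 * pi. Proof. exact: Rintegral_fejer_weight_le. Qed.

Let phi m t : R := if m.+1%:R^-1 < `|t| then H_kernel t else 0.

Let mphi m : measurable_fun [set: TR] (phi m).
Proof. exact: measurable_truncated_H_kernel. Qed.

Let mF m : measurable_fun [set: TR] (@fejer_kernel R m).
Proof.
apply: measurable_sum => k; apply: measurable_funM; first exact: measurable_cst.
exact: (measurable_trig (k, true)).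
Qed.

Let T_restrict m x : T x m.+1%:R^-1 = \int[mu]_(t in D) (phi m t * g (x - t)).
Proof. exact: Rintegral_truncated. Qed.

(** The truncated convolution is [A] plus an error bounded by the convolution of |g| with
    [fejer_weight]; then (A + C)^2 <= 2 A^2 + 2 C^2, and [convolution_abs_sqr_le] treats the
    error. *)
Let T_le m x (A : R) : - pi <= x <= pi ->
  \int[mu]_(t in D) (fejer_kernel m t * g (x - t)) = A ->
  (((T x m.+1%:R^-1) ^+ 2)%:E <= (2 * A ^+ 2)%:E + (2 * (20 * pi))%:E * Q m x)%E.
Proof.
move=> xD AE_; rewrite T_restrict.
have tD t : - pi < t < pi -> - pi <= t <= pi by move=> /andP[/ltW -> /ltW ->].
have iF : mu.-integrable D (EFin \o (fun t => fejer_kernel m t * g (x - t))).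
  apply: (integrable_convolution mg g_per ig2 (mF m) (M := 2 * m.+1%:R)) => // t _.
  exact: fejer_kernel_le.
have md : measurable_fun [set: TR] (fun t => phi m t - fejer_kernel m t).
  by apply: measurable_funB; [exact: mphi|exact: mF].
have id_ : mu.-integrable D (EFin \o (fun t => (phi m t - fejer_kernel m t) * g (x - t))).
  apply: (integrable_convolution mg g_per ig2 md (M := 2 + 16 * m.+1%:R)) => // t /tD tD'.
  exact: le_trans (kernel_sub_le m tD') (wle m t).
have iwg : mu.-integrable D (EFin \o (fun t => w m t * `|g (x - t)|)).
  have ii : mu.-integrable D (EFin \o (fun t => w m t * g (x - t))).
    by apply: (integrable_convolution mg g_per ig2 (mw m) (M := 2 + 16 * m.+1%:R)) => // t _; rewrite ger0_norm.
  have h1 := integrable_abse ii.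
  have -> : EFin \o (fun t => w m t * `|g (x - t)|) = (fun t => `|(w m t * g (x - t))%:E|%E).
    by apply/funext => t; rewrite /= normrM ger0_norm.
  exact: h1.
set B := \int[mu]_(t in D) (w m t * `|g (x - t)|).
have TE : \int[mu]_(t in D) (phi m t * g (x - t)) =
    A + \int[mu]_(t in D) ((phi m t - fejer_kernel m t) * g (x - t)).
  rewrite -AE_ -(@RintegralD _ TR R mu D _ _ mD iF id_).
  by apply: eq_Rintegral => t _; ring.
set C := \int[mu]_(t in D) ((phi m t - fejer_kernel m t) * g (x - t)) in TE.
have CB : `|C| <= B.
  apply: le_trans (le_normr_Rintegral mD id_) _.
  apply: (le_Rintegral mD) => //; first exact: (integrable_abse id_).
  move=> t /=; rewrite in_itv/= => tD'; rewrite normrM; apply: ler_wpM2r => //.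
  exact: kernel_sub_le.
have BQ := convolution_abs_sqr_le mg g_per ig2 (mw m) (w0 m) (wle m) (W_gt0 m) xD.
rewrite TE.
apply: (@le_trans _ _ (2 * A ^+ 2 + 2 * B ^+ 2)%:E).
  rewrite lee_fin.
  have : C ^+ 2 <= B ^+ 2.
    rewrite -(real_normK (num_real C)) ler_pXn2r ?nnegrE//.
    exact: le_trans CB.
  have := sqr_ge0 (A - C); nra.
rewrite EFinD leeD2l// (EFinM 2) (EFinM 2 (20 * pi)) -muleA.
apply: lee_wpmul2l; first by rewrite lee_fin.
apply: le_trans BQ _; apply: lee_wpmul2r; first exact: sqr_convolution_ge0.
by rewrite lee_fin; exact: W_le.
Qed.

(** Only the radii 1 / (m + 1) are used. [T_le] integrates to a bound independent of m, which
    Fatou's lemma transmits to the almost everywhere limit h. In the constant, 2 bounds the Fejer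
    coefficients and 20 pi the mass of the weight. *)
Lemma integral_sqr_conv_le :
  (\int[mu]_(x in D) (h x ^+ 2)%:E <= ((2 * (pi * 2) ^+ 2 + 2 * (20 * pi) ^+ 2) * J)%:E)%E.
Proof.
have p0 := @pi_gt0 R.
have [A hA] := choice (fun m => trig_polynomial_convolution mg g_per ig2 (@fejer_coef_le2 R m)).
pose u m x := ((2 * A m x ^+ 2)%:E + (2 * (20 * pi))%:E * Q m x)%E.
have mA m : measurable_fun [set: TR] (A m) by have [] := hA m.
have iA m : mu.-integrable D (EFin \o (fun x => A m x ^+ 2)) by have [] := hA m.
have J0 : 0 <= J by apply: Rintegral_ge0 => x _; exact: sqr_ge0.
have mQ m : measurable_fun D (Q m) by exact: measurable_sqr_convolution.
have c0 : (0 <= (2 * (20 * pi))%:E :> \bar R)%E by rewrite lee_fin; lra.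
have mA2 m : measurable_fun D (fun x => (2 * A m x ^+ 2)%:E).
  apply/measurable_EFinP; apply: measurable_funTS; apply: measurable_funM => //.
  exact: measurable_funX.
have mu_ m : measurable_fun D (u m).
  by apply: emeasurable_funD => //; exact: measurable_funeM.
have u0 m x : D x -> (0 <= u m x)%E.
  move=> _; apply: adde_ge0; first by rewrite lee_fin mulr_ge0// sqr_ge0.
  by apply: mule_ge0 => //; exact: sqr_convolution_ge0.
have uI m : (\int[mu]_(x in D) u m x <= ((2 * (pi * 2) ^+ 2 + 2 * (20 * pi) ^+ 2) * J)%:E)%E.
  rewrite ge0_integralD//=; last 3 first.
  - by move=> x _; rewrite lee_fin mulr_ge0// sqr_ge0.
  - by move=> x _; apply: mule_ge0 => //; exact: sqr_convolution_ge0.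
  - exact: measurable_funeM.
  rewrite [X in (_ <= X%:E)%E]mulrDl [X in (_ <= X)%E]EFinD; apply: leeD.
    under eq_integral do rewrite EFinM.
    rewrite ge0_integralZl//; last 2 first.
    - by apply/measurable_EFinP; apply: measurable_funTS; exact: measurable_funX.
    - by move=> x _; rewrite lee_fin sqr_ge0.
    rewrite -mulrA EFinM; apply: lee_wpmul2l => //.
    have [_ _ iA2 leA] := hA m; move: leA; rewrite -lee_fin; apply: le_trans.
    by rewrite /Rintegral fineK//; exact: (integrable_fin_num mD iA2).
  rewrite ge0_integralZl//; last by move=> x _; exact: sqr_convolution_ge0.
  rewrite /Q (integral_sqr_convolution mg g_per ig2 (mw m) (w0 m) (wle m)).
  rewrite -EFinM lee_fin -/J -/(W m).
  have -> : 2 * (20 * pi) ^+ 2 * J = 2 * (20 * pi) * (20 * pi * J) by ring.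
  by apply: ler_wpM2l; [lra|apply: ler_wpM2r].
have hfat := fatou mu mD mu_ u0.
have lE x : limn_einf (u ^~ x) = limn (einfs (u ^~ x)) by exact: limn_einf_lim.
apply: (@le_trans _ _ (\int[mu]_(x in D) limn (einfs (u ^~ x)))%E); last first.
  under eq_integral do rewrite -lE.
  by apply: le_trans hfat _; rewrite limn_einf_lim; exact: limn_einfs_le.
apply: ae_ge0_le_integral => //.
- by move=> x _; rewrite lee_fin sqr_ge0.
- by apply/measurable_EFinP; apply: measurable_funTS; exact: measurable_funX.
- move=> x Dx; apply: lime_ge; first exact: is_cvg_einfs.
  by apply: nearW => n; apply: le_ereal_inf_tmp => _ [m _ <-]; exact: u0.
- apply: (emeasurable_fun_cvg (fun n x => einfs (u ^~ x) n)).
    by move=> n; exact: measurable_fun_einfs.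
  by move=> x _; exact: is_cvg_einfs.
apply: filterS Th; first exact: (ae_filter_ringOfSetsType mu).
move=> x Thx /=; rewrite in_itv/= => xD.
have cT : (T x m.+1%:R^-1 ^+ 2)%:E @[m --> \oo] --> ((h x) ^+ 2)%:E.
  apply: cvg_EFin; first exact: nearW.
  have hx : T x m.+1%:R^-1 @[m --> \oo] --> h x.
    move/cvg_at_rightP : Thx => /(_ (fun m => m.+1%:R^-1)); apply.
    by split => [n|]; [rewrite invr_gt0|exact: cvg_harmonic].
  rewrite expr2; under eq_cvg do rewrite /= expr2.
  exact: cvgM.
rewrite -(cvg_lim _ (cvg_einfs cT))//; apply: le_limn_einfs => m.
by apply: T_le => //; have [_ -> //] := hA m.
Qed.

End ConvolutionBound.

(** * Convolution of matrix-valued functions *)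

Section NormEquivalence.
Variables (R : realType) (n : nat) (E : symmetric_space R n).
Local Notation N := (2 ^ n)%N.
Implicit Types (S : 'M[R[i]]_N) (s : 'I_N -> R).

Lemma sum_sqr_entries S V s : sv_decomp S V s ->
  \sum_k s k ^+ 2 = \sum_i \sum_j cabs (S i j) ^+ 2.
Proof.
move=> sv; apply: complexI.
have := singular_values_powers 1 sv; rewrite expr1.
have -> : \sum_k s k ^+ 1.*2 = \sum_k s k ^+ 2 by [].
move=> <-; rewrite exchange_big rmorph_sum /mxtrace; apply: eq_bigr => j _.
rewrite mxE rmorph_sum; apply: eq_bigr => i _.
transitivity (S i j * (S i j)^*)%R; first by rewrite !mxE mulrC.
exact: esym (cabs_sqrC _).
Qed.

Let dl (k : 'I_N) : 'I_N -> R := fun i => (i == k)%:R.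

Let dl_gt0 k : 0 < gauge E (dl k).
Proof. by apply: (@gauge_gt0 _ _ E (dl k) k); rewrite /dl eqxx oner_eq0. Qed.

Lemma CE_norm_ge0 S : 0 <= CE_norm E S.
Proof. by have [V [s [sv _]]] := exists_sv_decomp S; rewrite (CE_normE E sv) gauge_ge0. Qed.

(** The sum of squared entries is the sum of the s_k^2. The gauge of s is at most the sum of s_k
    times the gauge of the k-th indicator, and at least each single such product. One constant is
    taken for both directions. *)
Lemma CE_norm_entries : exists2 c : R, 0 < c & forall S,
  CE_norm E S ^+ 2 <= c * (\sum_i \sum_j cabs (S i j) ^+ 2) /\
  \sum_i \sum_j cabs (S i j) ^+ 2 <= c * CE_norm E S ^+ 2.
Proof.
pose c1 := (\sum_k gauge E (dl k)) ^+ 2; pose c2 := \sum_k (gauge E (dl k) ^+ 2)^-1.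
have c10 : 0 <= c1 by exact: sqr_ge0.
have c20 : 0 <= c2 by apply: sumr_ge0 => k _; rewrite invr_ge0 sqr_ge0.
exists (1 + c1 + c2); first by lra.
move=> S; have [V [s [sv _]]] := exists_sv_decomp S; have [_ s0 _] := sv.
rewrite (CE_normE E sv) -(sum_sqr_entries sv); set q := \sum_k s k ^+ 2.
have q0 : 0 <= q by apply: sumr_ge0 => k _; exact: sqr_ge0.
split.
  apply: (@le_trans _ _ (c1 * q)); last by apply: ler_wpM2r => //; lra.
  have sq k : s k <= Num.sqrt q.
    rewrite -(ger0_norm (s0 k)) -sqrtr_sqr ler_sqrt// /q (bigD1 k)//= lerDl.
    by apply: sumr_ge0 => j _; exact: sqr_ge0.
  have hs : gauge E s <= \sum_k s k * gauge E (dl k).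
    have sE : s = (fun i => \sum_k s k * dl k i).
      apply/funext => i; rewrite (bigD1 i)//= /dl eqxx mulr1 big1 ?addr0// => j ji.
      by rewrite eq_sym (negPf ji) mulr0.
    rewrite [X in gauge E X]sE; elim: (index_enum _) => [|k r IH].
      by under [X in gauge E X]funext do rewrite big_nil; rewrite gauge0 big_nil.
    under [X in gauge E X]funext do rewrite big_cons.
    rewrite big_cons; apply: le_trans (gaugeD E _ _) _; apply: lerD => //.
    by rewrite gaugeZ (ger0_norm (s0 k)).
  have hs2 : gauge E s <= Num.sqrt q * \sum_k gauge E (dl k).
    apply: le_trans hs _; rewrite mulr_sumr; apply: ler_sum => k _.
    by apply: ler_wpM2r; rewrite ?gauge_ge0.
  have -> : c1 * q = (Num.sqrt q * \sum_k gauge E (dl k)) ^+ 2.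
    by rewrite exprMn sqr_sqrtr// mulrC.
  by rewrite ler_pXn2r ?nnegrE ?gauge_ge0// (le_trans (gauge_ge0 E s)).
apply: (@le_trans _ _ (c2 * gauge E s ^+ 2)); last first.
  by apply: ler_wpM2r; rewrite ?sqr_ge0//; lra.
rewrite mulr_suml; apply: ler_sum => k _.
rewrite mulrC ler_pdivlMr ?exprn_gt0// -exprMn ler_pXn2r ?nnegrE ?mulr_ge0 ?gauge_ge0//.
rewrite -[X in X * _](ger0_norm (s0 k)) -gaugeZ; apply: le_gauge => i.
by rewrite /dl; case: eqP => [->|_]; rewrite ?mulr1 ?mulr0 ?normr0.
Qed.

End NormEquivalence.

(** * Finiteness of the operator norm *)

Section HilbertTransform.
Variables (R : realType) (n : nat) (E : symmetric_space R n).
Local Notation N := (2 ^ n)%N.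
Local Notation mu := (@lebesgue_measure R).
Local Notation TR := (measurableTypeR R).
Local Notation D := (`[(- pi)%R, pi]%classic : set TR).

Let mD : measurable D. Proof. exact: measurable_itv. Qed.

Lemma cabs_sqr (z : R[i]) : cabs z ^+ 2 = complex.Re z ^+ 2 + complex.Im z ^+ 2.
Proof.
by case: z => a b; rewrite /cabs /= sqr_sqrtr// addr_ge0// sqr_ge0.
Qed.

Lemma CE_norm0 : CE_norm E 0 = 0.
Proof.
have [c c0 /(_ 0)[h _]] := CE_norm_entries E; apply/eqP; rewrite -sqrf_eq0 eq_le sqr_ge0 andbT.
apply: le_trans h _; rewrite big1 ?mulr0// => i _; rewrite big1// => j _.
by rewrite mxE cabs_sqr /= expr0n/= addr0.
Qed.

Let is_pv_conv0 (u : R -> R[i]) x : (forall t, u t = 0) -> is_pv_conv (@H_kernel R) u x 0.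
Proof.
move=> u0; have -> : u = (fun=> 0) by apply/funext.
have tz e : truncated_conv (@H_kernel R) (fun=> 0) x e = 0.
  rewrite /truncated_conv /cintegral; under eq_Rintegral do rewrite mulr0.
  by under [X in Complex _ X]eq_Rintegral do rewrite mulr0; rewrite /Rintegral !integral0.
by split; under eq_cvg do rewrite tz; exact: cvg_cst.
Qed.

Lemma H_norm_ge0 : (0 <= H_norm E)%E.
Proof.
apply: ereal_sup_ubound; exists (fun=> 0), (fun=> 0).
have z : L2_norm (CE_norm E) (fun=> 0 : 'M[R[i]]_N) = 0%E.
  rewrite /L2_norm; under eq_integral do rewrite CE_norm0 expr0n/=.
  by rewrite integral0 poweR0r// invr_neq0.
have mz : mx_measurable (fun=> 0 : 'M[R[i]]_N).
  by move=> i j; split; rewrite mxE.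
split; split => //; first by rewrite z.
apply: aeW => x i j; rewrite mxE; by apply: is_pv_conv0 => t; rewrite ?mxE.
Qed.

Lemma H_norm_fin_num : H_norm E \is a fin_num.
Proof.
rewrite ge0_fin_numE ?H_norm_ge0//.
have [c c0 cE] := CE_norm_entries E.
pose M1 : R := 2 * (pi * 2) ^+ 2 + 2 * (20 * pi) ^+ 2.
have M10 : 0 <= M1 by rewrite addr_ge0// mulr_ge0// sqr_ge0.
pose B : R := c * \sum_(i < N) \sum_(j < N) (M1 * c + M1 * c).
apply: (@le_lt_trans _ _ (B `^ 2^-1)%:E); last by rewrite ltry.
apply: ub_ereal_sup => _ [G [H [[mG perG G1] [mH _ GH ->]]]].
have IG : (\int[mu]_(t in D) ((CE_norm E (G t)) ^+ 2)%:E <= 1)%E.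
  have I0 : (0 <= \int[mu]_(t in D) ((CE_norm E (G t)) ^+ 2)%:E)%E.
    by apply: integral_ge0 => t _; rewrite lee_fin sqr_ge0.
  move: G1; rewrite /L2_norm; set I := (\int[mu]_(t in D) _)%E in I0 * => I1.
  have : ((I `^ 2^-1) `^ 2 <= 1 `^ 2)%E.
    apply: gt0_ler_poweR => //; rewrite in_itv/= ?poweR_ge0 ?leey ?lee01//.
  by rewrite -poweRrM mulVf// poweR1r poweRe1.
(* The scalar estimate, to be applied to the real and to the imaginary part of every entry. *)
have entry (u u' : R -> R) : measurable_fun [set: TR] u -> measurable_fun [set: TR] u' ->
    (forall x, u (x + 2 * pi) = u x) ->
    (forall t, u t ^+ 2 <= c * CE_norm E (G t) ^+ 2) ->
    {ae mu, forall x, (\int[mu]_(t in [set t : TR | (- pi <= t <= pi) /\ eps < `|t|])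
       (H_kernel t * u (x - t))) @[eps --> 0^'+] --> u' x} ->
    (\int[mu]_(t in D) (u' t ^+ 2)%:E <= (M1 * c)%:E)%E.
  move=> mu_ mu_' per uc cv.
  have mu2 : measurable_fun [set: TR] (fun t => u t ^+ 2) by exact: measurable_funX.
  have Iu : (\int[mu]_(t in D) (u t ^+ 2)%:E <= c%:E)%E.
    have h : (\int[mu]_(t in D) (c^-1 * u t ^+ 2)%:E <= 1)%E.
      (* Measurability of the C_E norm of [G t] is not established, so monotonicity is used in the
         form that does without it. *)
      apply: le_trans IG; apply: ge0_le_integral_nonmeasurable => t _.
        by rewrite lee_fin mulr_ge0 ?invr_ge0 ?sqr_ge0// ltW.
      by rewrite lee_fin mulrC ler_pdivrMr// mulrC.
    move: h; under eq_integral do rewrite EFinM.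
    rewrite ge0_integralZl//; last 3 first.
    - by apply/measurable_EFinP; exact: measurable_funTS.
    - by move=> t _; rewrite lee_fin sqr_ge0.
    - by rewrite lee_fin invr_ge0 ltW.
    by rewrite lee_pdivrMl// mule1.
  have iu2 : mu.-integrable D (EFin \o (fun t => u t ^+ 2)).
    apply/integrableP; split; first by apply/measurable_EFinP; exact: measurable_funTS.
    under eq_integral do rewrite /= ger0_norm ?sqr_ge0//.
    by apply: le_lt_trans Iu _; rewrite ltry.
  apply: le_trans (integral_sqr_conv_le mu_ per iu2 mu_' cv) _.
  rewrite lee_fin; apply: ler_wpM2l => //.
  rewrite -lee_fin /Rintegral fineK//; exact: (integrable_fin_num mD iu2).
have GHae : {ae mu, forall x i j, is_pv_conv (@H_kernel R) (fun t => G t i j) x (H x i j)}.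
  exact: GH.
have hre i j : (\int[mu]_(t in D) ((complex.Re (H t i j)) ^+ 2)%:E <= (M1 * c)%:E)%E.
  apply: (entry (fun t => complex.Re (G t i j))).
  - by have [] := mG i j.
  - by have [] := mH i j.
  - by move=> x; rewrite perG.
  - move=> t; apply: le_trans (cE (G t)).2.
    rewrite (bigD1 i)//= (bigD1 j)//= -addrA cabs_sqr -addrA lerDl.
    rewrite !addr_ge0 ?sqr_ge0 ?sumr_ge0// => k _; rewrite ?sqr_ge0//.
    by rewrite sumr_ge0// => l _; rewrite sqr_ge0.
  - apply: filterS GHae; first exact: (ae_filter_ringOfSetsType mu).
    move=> x /(_ i j)[+ _]; rewrite /truncated_conv /cintegral /=.
    apply: cvg_trans; apply: near_eq_cvg; apply: nearW => e.
    by apply: eq_Rintegral => t _; rewrite mulrC /ofreal Re_mul_real mulrC.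
have him i j : (\int[mu]_(t in D) ((complex.Im (H t i j)) ^+ 2)%:E <= (M1 * c)%:E)%E.
  apply: (entry (fun t => complex.Im (G t i j))).
  - by have [] := mG i j.
  - by have [] := mH i j.
  - by move=> x; rewrite perG.
  - move=> t; apply: le_trans (cE (G t)).2.
    rewrite (bigD1 i)//= (bigD1 j)//= -addrA cabs_sqr [X in X + _]addrC -addrA lerDl.
    rewrite !addr_ge0 ?sqr_ge0 ?sumr_ge0// => k _; rewrite ?sqr_ge0//.
    by rewrite sumr_ge0// => l _; rewrite sqr_ge0.
  - apply: filterS GHae; first exact: (ae_filter_ringOfSetsType mu).
    move=> x /(_ i j)[_]; rewrite /truncated_conv /cintegral /=.
    apply: cvg_trans; apply: near_eq_cvg; apply: nearW => e.
    by apply: eq_Rintegral => t _; rewrite mulrC /ofreal Im_mul_real mulrC.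
have IH : (\int[mu]_(t in D) ((CE_norm E (H t)) ^+ 2)%:E <= B%:E)%E.
  have m1 i j : measurable_fun D (fun t => ((complex.Re (H t i j)) ^+ 2)%:E).
    by apply/measurable_EFinP; apply: measurable_funTS; apply: measurable_funX; have [] := mH i j.
  have m2 i j : measurable_fun D (fun t => ((complex.Im (H t i j)) ^+ 2)%:E).
    by apply/measurable_EFinP; apply: measurable_funTS; apply: measurable_funX; have [] := mH i j.
  pose F i j t : \bar R := (((complex.Re (H t i j)) ^+ 2)%:E + ((complex.Im (H t i j)) ^+ 2)%:E)%E.
  have mF i j : measurable_fun D (F i j) by exact: emeasurable_funD.
  have F0 i j t : (0 <= F i j t)%E by rewrite adde_ge0 ?lee_fin ?sqr_ge0.
  apply: (@le_trans _ _ (\int[mu]_(t in D) (c%:E * \sum_(i < N) \sum_(j < N) F i j t))%E).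
    apply: ge0_le_integral_nonmeasurable => t _; first by rewrite lee_fin sqr_ge0.
    have -> : (\sum_(i < N) \sum_(j < N) F i j t)%E = (\sum_i \sum_j cabs (H t i j) ^+ 2)%:E.
      rewrite -sumEFin; apply: eq_bigr => i _; rewrite -sumEFin; apply: eq_bigr => j _.
      by rewrite /F -EFinD cabs_sqr.
    by rewrite -EFinM lee_fin; exact: (cE (H t)).1.
  have mFi i : measurable_fun D (fun t => \sum_(j < N) F i j t)%E.
    by apply: emeasurable_sum => j.
  have Fi0 i t : (0 <= \sum_(j < N) F i j t)%E by apply: sume_ge0 => j _.
  rewrite ge0_integralZl//; last 3 first.
  - by apply: emeasurable_sum => i; exact: mFi.
  - by move=> t _; apply: sume_ge0 => i _; exact: Fi0.
  - by rewrite lee_fin ltW.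
  rewrite EFinM; apply: lee_wpmul2l; first by rewrite lee_fin ltW.
  rewrite (ge0_integral_sum mu mD mFi); last by move=> i t _; exact: Fi0.
  rewrite -sumEFin; apply: lee_sum => i _.
  rewrite (ge0_integral_sum mu mD (mF i)); last by move=> j t _; exact: F0.
  rewrite -sumEFin; apply: lee_sum => j _.
  rewrite ge0_integralD//; last 2 first.
  - by move=> t _; rewrite lee_fin sqr_ge0.
  - by move=> t _; rewrite lee_fin sqr_ge0.
  by rewrite EFinD; apply: leeD.
rewrite /L2_norm -poweR_EFin; apply: gt0_ler_poweR => //.
- rewrite in_itv/= leey andbT; apply: integral_ge0 => t _; by rewrite lee_fin sqr_ge0.
- rewrite in_itv/= leey andbT lee_fin mulr_ge0 ?(ltW c0)//.
  by do 2 (apply: sumr_ge0 => ? _); rewrite addr_ge0// mulr_ge0// ltW.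
Qed.

End HilbertTransform.

(** * Principal values against Lipschitz functions *)

Section PrincipalValue.
Variable R : realType.
Local Notation mu := (@lebesgue_measure R).
Local Notation TR := (measurableTypeR R).
Local Notation D := (`[(- pi)%R, pi]%classic : set TR).

Lemma Rintegral_reflect (c : R) (A : set TR) (g : R -> R) :
  measurable A -> measurable_fun [set: TR] g ->
  \int[mu]_(x in (fun x : TR => (c - x)%R : TR) @^-1` A) g (c - x) =
  \int[mu]_(x in A) g x.
Proof.
move=> mA mg; rewrite /Rintegral; congr fine; rewrite [LHS]integralE [RHS]integralE.
have mE : measurable_fun A (EFin \o g) by apply/measurable_EFinP; exact: measurable_funTS.
congr (_ - _)%E.
  etransitivity; last apply: (@ge0_integral_reflect _ c A (EFin \o g)^\+%E) => //.
  - by apply: eq_integral => x _; rewrite !funeposE.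
  - exact: measurable_funepos.
etransitivity; last apply: (@ge0_integral_reflect _ c A (EFin \o g)^\-%E) => //.
- by apply: eq_integral => x _; rewrite !funenegE.
- exact: measurable_funeneg.
Qed.

Implicit Types t : R.

Variables (a : R -> R) (M : R).
Hypothesis ma : measurable_fun [set: TR] a.
Hypothesis aM : forall t, `|a t| <= M.
Hypothesis aL : forall s t, `|a s - a t| <= M * `|s - t|.

Let b t := psi 2^-1 t * (a (- t) - a t).

Let M0 : 0 <= M. Proof. exact: le_trans (aM 0). Qed.

Let maN : measurable_fun [set: TR] (fun t : R => a (- t)).
Proof. by apply: measurableT_comp ma _; exact: measurable_funN. Qed.

Let mb : measurable_fun [set: TR] b.
Proof. by apply: measurable_funM; [exact: measurable_psi|exact: measurable_funB]. Qed.

Let psi_le t : 0 < t < pi / 2 -> psi 2^-1 t <= 4 / t.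
Proof.
move=> t01; have /andP[t0 t1] := t01; have /andP[_ h] := psi_half_bounds t01.
have s0 := sin_gt0_pihalf t01.
have hs : t / 2 <= sin t by apply: sin_ge_half; rewrite !ltW.
have r2 : Num.sqrt 2 <= 2 :> R by rewrite -(@ler_pXn2r _ 2) ?nnegrE ?sqrtr_ge0// sqr_sqrtr//; lra.
apply: le_trans h _; rewrite ler_pdivrMr// mulrAC ler_pdivlMr//.
have : 0 <= Num.sqrt 2 :> R by exact: sqrtr_ge0.
by move: r2 hs; set r := Num.sqrt 2; set s := sin t; move=> *; nra.
Qed.

(** The singularity 4/t of the kernel is cancelled by the Lipschitz bound 2 M t on the
    difference. *)
Let b_le t : 0 < t < pi / 2 -> `|b t| <= 8 * M.
Proof.
move=> t01; have /andP[t0 _] := t01; rewrite /b normrM (ger0_norm (psi_ge0 _ _)).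
have -> : 8 * M = 4 / t * (M * `|- t - t|).
  rewrite -opprD normrN ger0_norm ?addr_ge0 ?ltW//; field.
  by rewrite gt_eqF.
by apply: ler_pM; rewrite ?psi_ge0 ?psi_le.
Qed.

Lemma integrable_psi_odd_part : mu.-integrable `[0%R, (pi / 2)%R] (EFin \o b).
Proof. exact: bounded_integrable_itv mb b_le. Qed.

Let H_kernel_pos t : 0 < t <= pi / 2 -> H_kernel t = psi 2^-1 t.
Proof.
move=> /andP[t0 t1]; rewrite /H_kernel indicE mem_set/= ?gtr0_sg ?mul1r//.
by rewrite in_itv/= t1 andbT; lra.
Qed.

Let H_kernel_out t : pi / 2 < t -> H_kernel t = 0 :> R.
Proof.
move=> t1; rewrite /H_kernel indicE memNset ?mul0r//= in_itv/= => /andP[_].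
by rewrite leNgt t1.
Qed.

Let H_kernelN t : H_kernel (- t) = - H_kernel t :> R.
Proof.
rewrite /H_kernel cosN sgrN !indicE mulrN mulNr; congr (- (_ * _ * _)).
congr ((nat_of_bool _)%:R); apply/idP/idP; rewrite !inE/= !in_itv/=; lra.
Qed.

Let trunc_kernel_le (eps t : R) : 0 < eps -> `|if eps < `|t| then H_kernel t else 0| <= 4 / eps.
Proof.
move=> e0; have pos s : 0 < s -> `|if eps < s then H_kernel s else 0| <= 4 / eps.
  move=> s0; have e4 : 0 <= 4 / eps by rewrite divr_ge0// ltW.
  case: ifP => [es|_]; last by rewrite normr0.
  have [s2|s2] := ltP (pi / 2) s; first by rewrite H_kernel_out// normr0.
  rewrite H_kernel_pos ?s0// ger0_norm ?psi_ge0//.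
  move: s2; rewrite le_eqVlt => /predU1P[->|s2].
    by rewrite /psi cos_pihalf ln0// oppr0 powR0// oppr_eq0 invr_eq0.
  apply: le_trans (psi_le _) _; first by rewrite s0.
  by rewrite ler_pM2l// lef_pV2 ?posrE// ltW.
have [t0|t0|->] := ltgtP t 0.
- rewrite (ltr0_norm t0); have := @pos (- t); rewrite oppr_gt0 H_kernelN => /(_ t0).
  by case: ifP => _; rewrite ?normrN.
- by rewrite (gtr0_norm t0); exact: pos.
- by rewrite normr0 ltNge (ltW e0) /= normr0 divr_ge0// ltW.
Qed.

(** The kernel is odd, so the negative half line folds onto the positive one; what remains is
    supported between eps and pi/2. *)
Let truncated_conv_odd (eps : R) : 0 < eps < pi / 2 ->
  \int[mu]_(t in [set t : TR | (- pi <= t <= pi) /\ eps < `|t|]) (H_kernel t * a (- t)) =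
  \int[mu]_(t in `]eps, pi / 2]) b t.
Proof.
move=> /andP[e0 e1]; have p0 := @pi_gt0 R; rewrite Rintegral_truncated.
pose k t : R := if eps < `|t| then H_kernel t else 0.
have mk : measurable_fun [set: TR] k by exact: measurable_truncated_H_kernel.
pose p t := k t * a (- t).
have mp : measurable_fun [set: TR] p by exact: measurable_funM.
have pM t : `|p t| <= 4 / eps * M.
  by rewrite normrM; apply: ler_pM => //; exact: trunc_kernel_le.
have ip (x y : R) : mu.-integrable `[x, y] (EFin \o p).
  by apply: (bounded_integrable_itv mp (M := 4 / eps * M)) => t _.
have mpN : measurable_fun [set: TR] (fun t => p (0 - t)).
  exact: measurableT_comp mp (measurable_reflect 0).
have ipN (x y : R) : mu.-integrable `[x, y] (EFin \o (fun t => p (0 - t))).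
  by apply: (bounded_integrable_itv mpN (M := 4 / eps * M)) => t _.
have split (f : R -> R) (x y z : R) : x <= y <= z -> mu.-integrable `[x, z] (EFin \o f) ->
    \int[mu]_(t in `[x, z]) f t = \int[mu]_(t in `[x, y]) f t + \int[mu]_(t in `]y, z]) f t.
  move=> /andP[xy yz] fi.
  by rewrite -(@Rintegral_itvB _ f (BLeft x) (BRight z) y fi) ?bnd_simp// addrC subrK.
have kN t : k (0 - t) = - k t.
  by rewrite sub0r /k normrN H_kernelN; case: ifP => _; rewrite ?oppr0.
have sub0 : `]0%R, pi] `<=` (`[0%R, pi]%classic : set TR).
  by move=> t /=; rewrite !in_itv/= => /andP[/ltW -> ->].
pose q t := k t * (a (- t) - a t).
have mq : measurable_fun [set: TR] q by apply: measurable_funM => //; exact: measurable_funB.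
have iq (x y : R) : mu.-integrable `[x, y] (EFin \o q).
  apply: (bounded_integrable_itv mq (M := 4 / eps * (M + M))) => t _.
  rewrite normrM; apply: ler_pM => //; first exact: trunc_kernel_le.
  by apply: le_trans (ler_normB _ _) _; exact: lerD.
transitivity (\int[mu]_(t in `[0, pi]) q t).
  rewrite -/(\int[mu]_(t in D) p t) (@split p (- pi) 0 pi)//; last by apply/andP; split; lra.
  have -> : \int[mu]_(t in `]0, pi]) p t = \int[mu]_(t in `[0, pi]) p t.
    by apply: Rintegral_itv_obnd_cbnd; apply: integrableS (ip 0 pi).
  rewrite -(@Rintegral_reflect 0 `[(- pi), 0]%classic p)//.
  have -> : (fun x : TR => (0 - x)%R : TR) @^-1` `[(- pi), 0] = `[0, pi]%classic.
    by apply/seteqP; split => x /=; rewrite !in_itv/=; lra.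
  rewrite -(@RintegralD _ TR R mu `[0, pi]%classic _ _ (measurable_itv _) (ipN 0 pi) (ip 0 pi)).
  by apply: eq_Rintegral => t _; rewrite /p /q kN sub0r opprK; ring.
rewrite (@split q 0 (pi / 2) pi)//; last by apply/andP; split; lra.
rewrite [X in _ + X](_ : _ = 0) ?addr0; last first.
  rewrite (_ : \int[mu]_(t in _) q t = \int[mu]_(t in `]pi / 2, pi]) (0 : R)); first by rewrite Rintegral_cst ?mul0r.
  apply: eq_Rintegral => t; rewrite inE/= in_itv/= => /andP[t1 _].
  by rewrite /q /k H_kernel_out// if_same mul0r.
rewrite (@split q 0 eps (pi / 2))//; last by apply/andP; split; lra.
rewrite [X in X + _](_ : _ = 0) ?add0r; last first.
  rewrite (_ : \int[mu]_(t in _) q t = \int[mu]_(t in `[0, eps]) (0 : R)); first by rewrite Rintegral_cst ?mul0r.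
  apply: eq_Rintegral => t; rewrite inE/= in_itv/= => /andP[t0 t1].
  by rewrite /q /k ger0_norm// ltNge t1/= mul0r.
apply: eq_Rintegral => t; rewrite inE/= in_itv/= => /andP[t0 t1].
have tp : 0 < t by exact: lt_trans t0.
by rewrite /q /k gtr0_norm// t0 H_kernel_pos// tp.
Qed.

(** By [truncated_conv_odd], the truncation only drops the integral of the bounded function [b] over
    [0, eps], at most 8 M eps. *)
Lemma pv_conv_odd_part :
  \int[mu]_(t in [set t : TR | (- pi <= t <= pi) /\ eps < `|t|]) (H_kernel t * a (- t))
    @[eps --> 0^'+] --> \int[mu]_(t in `[0, pi / 2]) (psi 2^-1 t * (a (- t) - a t)).
Proof.
have p2 : 0 < pi / 2 :> R by rewrite divr_gt0 ?pi_gt0.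
have ib := integrable_psi_odd_part.
apply/cvgrPdist_le => e e0.
(* The added 1 keeps the denominator positive when M = 0. *)
have d0 : 0 < e / (8 * M + 1) by rewrite divr_gt0// ltr_wpDl// mulr_ge0.
near=> eps.
have ep : 0 < eps by near: eps; exact: nbhs_right_gt.
have e1 : eps < pi / 2 by near: eps; exact: nbhs_right_lt.
have e2 : eps < e / (8 * M + 1) by near: eps; exact: nbhs_right_lt.
rewrite truncated_conv_odd ?ep//.
rewrite -(@Rintegral_itvB _ b (BLeft 0) (BRight (pi / 2)) eps ib) ?bnd_simp ?(ltW ep) ?(ltW e1)//.
rewrite opprB addrC subrK.
have sub : `[0%R, eps] `<=` (`[0%R, pi / 2]%classic : set TR).
  by move=> t /=; rewrite !in_itv/= => /andP[-> /le_lt_trans/(_ e1)/ltW].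
have ibe : mu.-integrable (`[0%R, eps]%classic : set TR) (EFin \o b) by apply: integrableS ib.
have hn := @le_normr_Rintegral _ TR R mu _ b (measurable_itv _) ibe.
apply: (le_trans hn).
apply: (@le_trans _ _ (\int[mu]_(t in `[0, eps]) (8 * M))).
  apply: le_Rintegral_itvoo.
  - exact: measurableT_comp.
  - by [].
  - exact: (integrable_abse ibe).
  - by apply: (bounded_integrable_itv (M := `|8 * M|)).
  - by move=> t /andP[t0 t1]; apply: b_le; rewrite t0 (lt_trans t1).
rewrite Rintegral_cst// /= lebesgue_measure_itv /= lte_fin ep /= subr0.
have : eps * (8 * M + 1) <= e by rewrite -ler_pdivlMr ?(ltW e2)// ltr_wpDl// mulr_ge0.
apply: le_trans; rewrite (_ : eps * (8 * M + 1) = 8 * M * eps + eps); last by ring.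
by rewrite lerDl ltW.
Unshelve. all: by end_near. Qed.

End PrincipalValue.

Section BoundedLipschitz.
Variable R : realType.
Implicit Types f g : R -> R.

(** Boundedness is included to make the class stable under products, which build the entries of the
    rotations. *)
Definition bounded_lipschitz f := exists M, (forall t, `|f t| <= M) /\
  (forall s t, `|f s - f t| <= M * `|s - t|).

Lemma bounded_lipschitz_cst (c : R) : bounded_lipschitz (fun=> c).
Proof. by exists `|c|; split => // s t; rewrite subrr normr0 mulr_ge0. Qed.

Lemma bounded_lipschitzD f g : bounded_lipschitz f -> bounded_lipschitz g ->
  bounded_lipschitz (fun t => f t + g t).
Proof.
move=> [A [fA fL]] [B [gB gL]]; exists (A + B); split => [t|s t].
  by apply: le_trans (ler_normD _ _) _; exact: lerD.
rewrite opprD addrACA mulrDl; apply: le_trans (ler_normD _ _) _; exact: lerD.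
Qed.

Lemma bounded_lipschitzM f g : bounded_lipschitz f -> bounded_lipschitz g ->
  bounded_lipschitz (fun t => f t * g t).
Proof.
move=> [A [fA fL]] [B [gB gL]].
have A0 : 0 <= A by exact: le_trans (fA 0).
have B0 : 0 <= B by exact: le_trans (gB 0).
exists (2 * (A * B)); split => [t|s t].
  rewrite normrM; apply: le_trans (ler_pM _ _ (fA t) (gB t)) _ => //.
  by rewrite ler_peMl ?mulr_ge0// ler1n.
have -> : f s * g s - f t * g t = (f s - f t) * g s + f t * (g s - g t) by ring.
apply: le_trans (ler_normD _ _) _; rewrite !normrM.
have -> : 2 * (A * B) * `|s - t| = (A * `|s - t|) * B + A * (B * `|s - t|) by ring.
by apply: lerD; apply: ler_pM.
Qed.

Lemma bounded_lipschitz_sum (I : Type) (r : seq I) (F : I -> R -> R) :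
  (forall i, bounded_lipschitz (F i)) -> bounded_lipschitz (fun t => \sum_(i <- r) F i t).
Proof.
move=> hF; elim: r => [|i r IH].
  by under eq_fun do rewrite big_nil; exact: bounded_lipschitz_cst.
by under eq_fun do rewrite big_cons; exact: bounded_lipschitzD.
Qed.

Lemma bounded_lipschitz_prod (I : Type) (r : seq I) (F : I -> R -> R) :
  (forall i, bounded_lipschitz (F i)) -> bounded_lipschitz (fun t => \prod_(i <- r) F i t).
Proof.
move=> hF; elim: r => [|i r IH].
  by under eq_fun do rewrite big_nil; exact: bounded_lipschitz_cst.
by under eq_fun do rewrite big_cons; exact: bounded_lipschitzM.
Qed.

Lemma bounded_lipschitz_translate f c : bounded_lipschitz f -> bounded_lipschitz (fun t => f (c + t)).
Proof.
move=> [M [fM fL]]; exists M; split => // s t.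
by apply: le_trans (fL _ _) _; rewrite opprD addrACA subrr add0r.
Qed.

Lemma bounded_lipschitz_derive f df : (forall t : R, is_derive t 1 f (df t)) ->
  (forall t, `|df t| <= 1) -> (forall t, `|f t| <= 1) -> bounded_lipschitz f.
Proof.
move=> dfE df1 f1; exists 1; split => // s t.
have cf : continuous f.
  by move=> x; apply: differentiable_continuous; apply/derivable1_diffP; have [] := dfE x.
have lt_case x y : x < y -> `|f y - f x| <= 1 * `|y - x|.
  move=> xy; have [c _ ->] := @MVT R f df x y xy (fun z _ => dfE z) (continuous_subspaceT cf).
  by rewrite normrM; apply: ler_wpM2r.
have [st|ts|->] := ltgtP s t; last by rewrite !subrr !normr0 mulr0.
  by rewrite distrC [`|s - t|]distrC; exact: lt_case.
exact: lt_case.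
Qed.

Lemma bounded_lipschitz_rot2 a b : bounded_lipschitz (fun t => rot2 t a b).
Proof.
have dl (t : R) : is_derive t 1 (fun t : R => t / 2) 2^-1.
  rewrite (_ : (fun t : R => t / 2) = (fun t => 2^-1 * t)); last by apply/funext => s; rewrite mulrC.
  by apply: is_derive_eq (is_deriveZ (2^-1 : R) (is_derive_id t 1)) _; rewrite /GRing.scale /= mulr1.
have h2 (x : R) : `|x| <= 1 -> `|x / 2| <= 1.
  by move=> x1; rewrite normrM [X in _ * X]ger0_norm// (le_trans (ler_pM _ _ x1 (lexx _)))//; lra.
have s1 (x : R) : `|sin x| <= 1 by rewrite ler_norml sin_geN1 sin_le1.
have c1 (x : R) : `|cos x| <= 1 by rewrite ler_norml cos_geN1 cos_le1.
have ds (t : R) : is_derive t 1 (fun t => sin (t / 2)) (cos (t / 2) / 2).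
  have d := @is_derive1_comp _ (@sin R) (fun t => t / 2) t _ _ (is_derive_sin (t / 2)) (dl t).
  by apply: is_derive_eq d _; rewrite /GRing.scale /= mulrC.
have dc (t : R) : is_derive t 1 (fun t => cos (t / 2)) (- sin (t / 2) / 2).
  have d := @is_derive1_comp _ (@cos R) (fun t => t / 2) t _ _ (is_derive_cos (t / 2)) (dl t).
  by apply: is_derive_eq d _; rewrite /GRing.scale /= mulrC.
have bs := bounded_lipschitz_derive ds (fun t => h2 _ (c1 _)) (fun t => s1 _).
have bc : bounded_lipschitz (fun t : R => cos (t / 2)).
  by apply: (bounded_lipschitz_derive dc) => t; [apply: h2; rewrite normrN|].
rewrite /rot2; case: (a == b) => //; case: a => //.
have := bounded_lipschitzM (bounded_lipschitz_cst (-1)) bs.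
by under eq_fun do rewrite mulN1r.
Qed.

Lemma bounded_lipschitz_rotR n (x y : 'I_(2 ^ n)) : bounded_lipschitz (fun t => rotR t x y).
Proof. by apply: bounded_lipschitz_prod => j; exact: bounded_lipschitz_rot2. Qed.

End BoundedLipschitz.

(** Passes from a supremum over a unit ball to a linear inequality. Normalizing by s + d with d
    tending to 0 includes the case s = 0. *)
Lemma homogeneous_bound (R : realType) (r s h T : R) : 0 < r -> 0 <= s -> 0 <= h ->
  (forall c, 0 <= c -> r * (c * s) <= 1 -> r * (c * T) <= h) -> T <= h * s.
Proof.
move=> r0 s0 h0 H; have hd d : 0 < d -> T <= h * (s + d).
  move=> d0; have sd : 0 < s + d by rewrite ltr_wpDl.
  have c0 : 0 < (r * (s + d))^-1 by rewrite invr_gt0 mulr_gt0.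
  have := H _ (ltW c0).
  have fe y : r * ((r * (s + d))^-1 * y) = y / (s + d) by field; rewrite !gt_eqF.
  by rewrite !fe !ler_pdivrMr// mul1r lerDl => /(_ (ltW d0)).
apply/ler_addgt0Pr => e e0.
have h1 : 0 < h + 1 by rewrite ltr_wpDl.
apply: le_trans (hd (e / (h + 1)) _) _; first by rewrite divr_gt0.
rewrite mulrDr lerD2l mulrCA ger_pMr// ler_pdivrMr// mul1r.
by rewrite lerDl.
Qed.

(** * Convolution of a rotation orbit with the odd kernel *)

Section RotationConjugation.
Variables (R : realType) (n : nat).
Local Notation N := (2 ^ n)%N.
Local Notation mu := (@lebesgue_measure R).
Local Notation TR := (measurableTypeR R).
Implicit Types (S : 'M[R[i]]_N) (i j : 'I_N) (x t : R).

Definition rot_conj S t : 'M[R[i]]_N := (rotmx t)^t* *m S *m rotmx t.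

Lemma rot_conjD S t x : rot_conj S (t + x) = rot_conj (rot_conj S t) x.
Proof. by rewrite /rot_conj -rotmxD trmxC_mul !mulmxA. Qed.

Lemma rot_conj_translate S x t : rot_conj (rot_conj S t) x = rot_conj S (x + t).
Proof. by rewrite -rot_conjD addrC. Qed.

Lemma rot_conj0 S : rot_conj S 0 = S.
Proof. by rewrite /rot_conj rotmxC oppr0 rotmx0 mul1mx mulmx1. Qed.

Lemma rot_conj_2pi S t : rot_conj S (t + 2 * pi) = rot_conj S t.
Proof.
apply/matrixP => i j; rewrite /rot_conj !rot_conjE; apply: eq_bigr => z _.
apply: eq_bigr => w _; rewrite !rotR_2pi mulrACA -expr2 sqrr_sign mul1r.
by [].
Qed.

Section Part.
(** [u] is the real or the imaginary part; both are treated at once. *)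
Variable u : R[i] -> R.
Hypothesis uD : forall z w, u (z + w) = u z + u w.
Hypothesis u0 : u 0 = 0.
Hypothesis uM : forall z r, u (z * r%:C) = u z * r.

Lemma rot_conj_part S t i j :
  u (rot_conj S t i j) = \sum_z \sum_w u (S z w) * (rotR t z i * rotR t w j).
Proof.
rewrite /rot_conj rot_conjE (big_morph u uD u0); apply: eq_bigr => z _.
by rewrite (big_morph u uD u0); apply: eq_bigr => w _; exact: uM.
Qed.

Lemma bounded_lipschitz_rot_conj S i j : bounded_lipschitz (fun t => u (rot_conj S t i j)).
Proof.
under eq_fun do rewrite rot_conj_part.
apply: bounded_lipschitz_sum => z; apply: bounded_lipschitz_sum => w.
apply: bounded_lipschitzM; first exact: bounded_lipschitz_cst.
by apply: bounded_lipschitzM; exact: bounded_lipschitz_rotR.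
Qed.

Lemma measurable_rot_conj_part S i j : measurable_fun [set: TR] (fun t => u (rot_conj S t i j)).
Proof.
apply: (eq_measurable_fun (fun t => \sum_z \sum_w u (S z w) * (rotR t z i * rotR t w j))).
  by move=> t _; rewrite rot_conj_part.
apply: measurable_sum => z; apply: measurable_sum => w.
by apply: measurable_funM => //; apply: measurable_funM; exact: measurable_rotR.
Qed.

Definition odd_integral S i j : R :=
  \int[mu]_(t in `[0, pi / 2]) (psi 2^-1 t * (u (rot_conj S (- t) i j) - u (rot_conj S t i j))).

Let integrable_translate S x i j : mu.-integrable `[0%R, (pi / 2)%R]
  (EFin \o (fun t => psi 2^-1 t * (u (rot_conj S (x - t) i j) - u (rot_conj S (x + t) i j)))).
Proof.
have [M [aM aL]] := bounded_lipschitz_translate x (bounded_lipschitz_rot_conj S i j).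
have ma : measurable_fun [set: TR] (fun t => u (rot_conj S (x + t) i j)).
  apply: measurableT_comp (measurable_rot_conj_part S i j) _.
  exact: measurable_funD.
exact: integrable_psi_odd_part ma aL.
Qed.

Lemma integrable_odd_integral S i j : mu.-integrable `[0%R, (pi / 2)%R]
  (EFin \o (fun t => psi 2^-1 t * (u (rot_conj S (- t) i j) - u (rot_conj S t i j)))).
Proof.
have h := integrable_translate S 0 i j.
have -> : (fun t => psi 2^-1 t * (u (rot_conj S (- t) i j) - u (rot_conj S t i j))) =
    (fun t => psi 2^-1 t * (u (rot_conj S (0 - t) i j) - u (rot_conj S (0 + t) i j))).
  by apply/funext => t; rewrite sub0r add0r.
exact: h.
Qed.

(** Convolution commutes with translation, and translating an orbit by x is conjugating by a fixed
    rotation. The limit at x is therefore the conjugate of the limit at 0, that is, the orbit of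
    [T]. *)
Lemma pv_rot_conj S (T : 'M[R[i]]_N) x i j : (forall k l, u (T k l) = odd_integral S k l) ->
  (\int[mu]_(t in [set t : TR | (- pi <= t <= pi) /\ eps < `|t|])
     (H_kernel t * u (rot_conj S (x - t) i j))) @[eps --> 0^'+] --> u (rot_conj T x i j).
Proof.
move=> TE; have [M [aM aL]] := bounded_lipschitz_translate x (bounded_lipschitz_rot_conj S i j).
have ma : measurable_fun [set: TR] (fun t => u (rot_conj S (x + t) i j)).
  apply: measurableT_comp (measurable_rot_conj_part S i j) _.
  exact: measurable_funD.
have := pv_conv_odd_part ma aM aL.
have -> // : \int[mu]_(t in `[0, pi / 2]) (psi 2^-1 t *
    (u (rot_conj S (x - t) i j) - u (rot_conj S (x + t) i j))) = u (rot_conj T x i j).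
pose F z w t := (psi 2^-1 t * (u (rot_conj S (- t) z w) - u (rot_conj S t z w))) *
   (rotR x z i * rotR x w j).
have iF z w : mu.-integrable `[0%R, (pi / 2)%R] (EFin \o F z w).
  have h := @integrableZl _ TR R mu _ (measurable_itv _) (rotR x z i * rotR x w j) _ (integrable_odd_integral S z w).
  by apply: eq_integrable h => // t _; rewrite /F EFinM muleC.
rewrite rot_conj_part.
have -> : \sum_z \sum_w u (T z w) * (rotR x z i * rotR x w j) =
    \int[mu]_(t in `[0, pi / 2]) (\sum_z \sum_w F z w t).
  rewrite (@Rintegral_sum _ TR R mu _ (measurable_itv _)); last first.
    by move=> z; apply: (@integrable_Rsum _ TR R mu _ (measurable_itv _)) => w; exact: iF.
  apply: eq_bigr => z _; rewrite (@Rintegral_sum _ TR R mu _ (measurable_itv _) _ _ (iF z)).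
  apply: eq_bigr => w _; rewrite TE /odd_integral.
  by rewrite (@RintegralZr _ TR R mu _ _ _ (measurable_itv _) (integrable_odd_integral S z w)).
apply: eq_Rintegral => t _.
have e s : u (rot_conj S (x + s) i j) = \sum_z \sum_w u (rot_conj S s z w) * (rotR x z i * rotR x w j).
  by rewrite -rot_conj_translate; exact: rot_conj_part.
rewrite (e t) (e (- t)) -sumrB mulr_sumr.
apply: eq_bigr => z _; rewrite -sumrB mulr_sumr; apply: eq_bigr => w _.
by rewrite /F; ring.
Qed.

End Part.

Let ReD (z w : R[i]) : complex.Re (z + w) = complex.Re z + complex.Re w.
Proof. exact: raddfD. Qed.

Let ImD (z w : R[i]) : complex.Im (z + w) = complex.Im z + complex.Im w.
Proof. exact: raddfD. Qed.

(* The convolution of [rot_conj S] with [H_kernel], evaluated at 0; as the kernel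
   is odd, the principal value is an absolutely convergent integral. *)
Definition odd_transform S : 'M[R[i]]_N :=
  \matrix_(i, j) Complex (odd_integral (@complex.Re R) S i j) (odd_integral (@complex.Im R) S i j).

Lemma is_pv_conv_rot_conj S x i j :
  is_pv_conv (@H_kernel R) (fun t => rot_conj S t i j) x (rot_conj (odd_transform S) x i j).
Proof.
split.
  have -> : (fun eps => complex.Re (truncated_conv (@H_kernel R) (fun t => rot_conj S t i j) x eps)) =
    (fun eps => \int[mu]_(t in [set t : TR | (- pi <= t <= pi) /\ eps < `|t|])
     (H_kernel t * complex.Re (rot_conj S (x - t) i j))).
    apply/funext => eps; rewrite /truncated_conv /cintegral /=.
    by apply: eq_Rintegral => t _; rewrite mulrC /ofreal Re_mul_real mulrC.
  by apply: (pv_rot_conj ReD _ (@Re_mul_real R)) => // k l; rewrite mxE.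
have -> : (fun eps => complex.Im (truncated_conv (@H_kernel R) (fun t => rot_conj S t i j) x eps)) =
  (fun eps => \int[mu]_(t in [set t : TR | (- pi <= t <= pi) /\ eps < `|t|])
   (H_kernel t * complex.Im (rot_conj S (x - t) i j))).
  apply/funext => eps; rewrite /truncated_conv /cintegral /=.
  by apply: eq_Rintegral => t _; rewrite mulrC /ofreal Im_mul_real mulrC.
by apply: (pv_rot_conj ImD _ (@Im_mul_real R)) => // k l; rewrite mxE.
Qed.

Lemma mx_measurable_rot_conj S : mx_measurable (rot_conj S).
Proof.
move=> i j; split.
  exact: (measurable_rot_conj_part ReD _ (@Re_mul_real R)).
exact: (measurable_rot_conj_part ImD _ (@Im_mul_real R)).
Qed.

Lemma rot_conjZ (c : R) S t : rot_conj (c%:C *: S) t = c%:C *: rot_conj S t.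
Proof. by rewrite /rot_conj -scalemxAr -scalemxAl. Qed.

Lemma odd_transformZ (c : R) S : odd_transform (c%:C *: S) = c%:C *: odd_transform S.
Proof.
have h (u : R[i] -> R) : (forall z w, u (z + w) = u z + u w) -> u 0 = 0 ->
    (forall z r, u (z * r%:C) = u z * r) -> forall i j,
    odd_integral u (c%:C *: S) i j = odd_integral u S i j * c.
  move=> uD u0 uM i j; rewrite /odd_integral.
  rewrite -(@RintegralZr _ TR R mu _ _ _ (measurable_itv _) (integrable_odd_integral uD u0 uM S i j)).
  have zE t : u (rot_conj (c%:C *: S) t i j) = u (rot_conj S t i j) * c by rewrite rot_conjZ mxE mulrC uM.
  by apply: eq_Rintegral => t _; rewrite (zE t) (zE (- t)); ring.
apply/matrixP => i j; rewrite !mxE (h _ ReD) ?(h _ ImD)//; try exact: Re_mul_real; try exact: Im_mul_real.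
by apply/eqP; rewrite eq_complex /= !mul0r subr0 addr0 ![_ * c]mulrC !eqxx.
Qed.

End RotationConjugation.

Section HilbertBound.
Variables (R : realType) (n : nat) (E : symmetric_space R n).
Local Notation N := (2 ^ n)%N.
Local Notation mu := (@lebesgue_measure R).
Implicit Types (S : 'M[R[i]]_N).

Lemma CE_norm_rot_conj S t : CE_norm E (rot_conj S t) = CE_norm E S.
Proof.
have [V [s [sv _]]] := exists_sv_decomp S; rewrite (CE_normE E sv).
have [Vu s0 SE] := sv; apply: (@CE_normE _ _ _ _ (V *m rotmx t)).
split; [exact: mul_unitarymx Vu (rotmx_unitary n t)|exact: s0|].
rewrite /rot_conj; set U := rotmx t.
have UU : U *m (U^t*) = 1%:M by exact: (unitarymxP (rotmx_unitary n t)).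
transitivity ((U^t*) *m ((S^t*) *m S) *m U).
  rewrite !trmxC_mul trmxCK !mulmxA -(mulmxA ((U^t*) *m (S^t*)) U (U^t*)) UU mulmx1.
  by [].
by rewrite SE trmxC_mul !mulmxA.
Qed.

Lemma CE_normZ (c : R) S : 0 <= c -> CE_norm E (c%:C *: S) = c * CE_norm E S.
Proof.
move=> c0; have [V [s [sv _]]] := exists_sv_decomp S; rewrite (CE_normE E sv).
have [Vu s0 SE] := sv; rewrite -[X in X * _](ger0_norm c0) -gaugeZ.
apply: (@CE_normE _ _ _ _ V); split; [exact: Vu|by move=> k; rewrite mulr_ge0|].
have -> : (c%:C *: S)^t* = c%:C *: S^t*.
  apply/matrixP => i j; rewrite !mxE rmorphM; congr (_ * _).
  by apply: conj_Creal; rewrite complex_real.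
have -> : real_diag (fun k => (c * s k) ^+ 2) = (c ^+ 2)%:C *: real_diag (fun k => s k ^+ 2).
  by apply/matrixP => i j; rewrite !mxE exprMn rmorphM mulrnAr.
rewrite -scalemxAl -scalemxAr scalerA SE -scalemxAr -scalemxAl; congr (_ *: _).
by rewrite expr2 rmorphM.
Qed.

Let Npi_lt : - pi < pi :> R. Proof. by have := @pi_gt0 R; lra. Qed.

Lemma L2_norm_rot_conj S : L2_norm (CE_norm E) (rot_conj S) = (Num.sqrt (2 * pi) * CE_norm E S)%:E.
Proof.
rewrite /L2_norm; under eq_integral do rewrite CE_norm_rot_conj.
have p0 : 0 <= 2 * pi :> R by rewrite mulr_ge0// pi_ge0.
have -> : (\int[mu]_(t in `[(- pi)%R, pi]) (CE_norm E S ^+ 2)%:E = ((2 * pi) * CE_norm E S ^+ 2)%:E)%E.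
  rewrite integral_cst//= lebesgue_measure_itv/= lte_fin Npi_lt -EFinD -EFinM; congr EFin.
  by ring.
rewrite poweR_EFin powR12_sqrt; last by rewrite mulr_ge0// sqr_ge0.
by rewrite sqrtrM// sqrtr_sqr ger0_norm ?CE_norm_ge0.
Qed.

Lemma CE_norm_odd_transform_le1 S : Num.sqrt (2 * pi) * CE_norm E S <= 1 ->
  Num.sqrt (2 * pi) * CE_norm E (odd_transform S) <= fine (H_norm E).
Proof.
move=> S1; rewrite -lee_fin fineK ?H_norm_fin_num// -L2_norm_rot_conj.
apply: ereal_sup_ubound; exists (rot_conj S), (rot_conj (odd_transform S)).
have m := @mx_measurable_rot_conj R n; have p := @rot_conj_2pi R n.
split; first by split; [exact: m|exact: p|rewrite L2_norm_rot_conj lee_fin].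
split; [exact: m|exact: p| |by []].
by apply: aeW => x i j; exact: is_pv_conv_rot_conj.
Qed.

Lemma CE_norm_odd_transform S : CE_norm E (odd_transform S) <= fine (H_norm E) * CE_norm E S.
Proof.
apply: (@homogeneous_bound R (Num.sqrt (2 * pi))).
- by rewrite sqrtr_gt0 mulr_gt0// pi_gt0.
- exact: CE_norm_ge0.
- by apply: fine_ge0; exact: H_norm_ge0.
- move=> c c0; have := @CE_norm_odd_transform_le1 (c%:C *: S).
  by rewrite odd_transformZ (CE_normZ S c0) (CE_normZ (odd_transform S) c0).
Qed.

(** The domination of diagonals by [overlap], used at the rotation of angle 0, the identity. *)
Lemma snorm_diag_le S : E (fun x => S (cube_rank x) (cube_rank x)) <= CE_norm E S.
Proof.
have [V [s [sv _]]] := exists_sv_decomp S; rewrite (CE_normE E sv).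
have [Vu s0 _] := sv; have [W [p [SE p01 WW]]] := sv_decomp_polar sv.
have ov := overlap_sum_le1 (rotmx_unitary n (0 : R)) Vu p01 WW.
have SE0 : S = (rotmx 0)^t* *m (W *m real_diag s *m V) *m rotmx 0.
  by rewrite -SE -/(rot_conj S 0) rot_conj0.
apply: (@le_trans _ _ (gauge E (fun k => cabs (S k k)))).
  by apply: snorm_lattice => x; rewrite /ofreal cabs_real ger0_norm ?cabs_ge0.
apply: (@gauge_substochastic R n E (fun i k => overlap W V (rotmx 0) i k)) => //.
- by move=> i k; exact: overlap_ge0.
- exact: ov.1.
- exact: ov.2.
- by move=> i; rewrite cabs_ge0 /= [in cabs _]SE0; exact: diag_conj_le_overlap.
Qed.

End HilbertBound.

(** * The square root of the Laplacian *)

Section SquareRoot.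
Variables (R : realType) (n : nat) (E : symmetric_space R n.+1) (K : R).
Local Notation mu := (@lebesgue_measure R).
Local Notation TR := (measurableTypeR R).
Hypothesis EK : admissible_constant 6 E K.

(** The diagonal of the orbit of [grad_mx f] is odd in t by the spectral form of the derivative, so
    the odd integral is -2 times the integral of psi against it; this 2 is the 4^(1/2) of
    [laplacian_pow_integral]. *)
Lemma laplacian_pow_half f (x : cube n.+1) :
  laplacian_pow 2^-1 f x =
  ((Gamma (1 - 2^-1 : R))^-1)%:C * odd_transform (grad_mx f) (cube_rank x) (cube_rank x).
Proof.
have h01 : 0 < (2^-1 : R) <= 2^-1 by rewrite lexx invr_gt0 ltr0n.
have g0 := Gamma_gt0 h01.
rewrite laplacian_pow_integral// powR12_sqrt//.
have -> : Num.sqrt 4 = 2 :> R.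
  by rewrite (_ : 4 = 2 ^+ 2) ?sqrtr_sqr ?ger0_norm// -natrX.
set U := fun t => rot_conj (grad_mx f) t (cube_rank x) (cube_rank x).
have dE t : cderive (fun s => cos_laplacian s f x) t = U t by exact: cderive_cos_laplacian.
have UN t : U (- t) = - U t.
  rewrite -!dE !cderive_cos_laplacian_walsh -sumrN; apply: eq_bigr => A _.
  by rewrite cosN sinN mulrN rmorphN /= !rmorphN /= opprK !mulNr opprK.
have -> : (fun t => ofreal (psi 2^-1 t) * cderive (fun s => cos_laplacian s f x) t) =
    (fun t => (psi 2^-1 t)%:C * U t) by apply/funext => t; rewrite dE.
have -> : (- (2 / Gamma (1 - 2^-1)))%:C = ((Gamma (1 - 2^-1))^-1)%:C * (- 2)%:C :> R[i].
  by rewrite -rmorphM /=; congr (_%:C); ring.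
rewrite -mulrA; congr (_ * _); rewrite mxE /odd_integral /cintegral.
have int (u : R[i] -> R) : (forall z w, u (z + w) = u z + u w) -> u 0 = 0 ->
    (forall z r, u (z * r%:C) = u z * r) -> (forall z, u (- z) = - u z) ->
    \int[mu]_(t in `[0, pi / 2]) (psi 2^-1 t * (u (U (- t)) - u (U t))) =
    (- 2) * \int[mu]_(t in `[0, pi / 2]) (u ((psi 2^-1 t)%:C * U t)).
  move=> uD u0 uM uN.
  have i0 := integrable_odd_integral uD u0 uM (grad_mx f) (cube_rank x) (cube_rank x).
  have e t : u ((psi 2^-1 t)%:C * U t) = (- 2^-1) * (psi 2^-1 t * (u (U (- t)) - u (U t))).
    by rewrite mulrC uM UN uN; field.
  under [in RHS]eq_Rintegral do rewrite e.
  rewrite (@RintegralZl _ TR R mu _ _ (- 2^-1) (measurable_itv _) i0).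
  by rewrite mulrA mulrNN divff ?mul1r.
rewrite (int (@complex.Re R) (fun z w => raddfD _ z w) erefl (@Re_mul_real R) (fun z => raddfN _ z)).
rewrite (int (@complex.Im R) (fun z w => raddfD _ z w) erefl (@Im_mul_real R) (fun z => raddfN _ z)).
by apply/eqP; rewrite eq_complex /= !mul0r subr0 addr0 !eqxx.
Qed.

Lemma snorm_laplacian_sqrt f :
  E (laplacian_pow 2^-1 f) <= H_const E * K * snormR E (grad_abs f).
Proof.
have h01 : 0 < (2^-1 : R) <= 2^-1 by rewrite lexx invr_gt0 ltr0n.
have g0 := Gamma_gt0 h01.
have -> : laplacian_pow 2^-1 f = (fun x => ((Gamma (1 - 2^-1 : R))^-1)%:C *
    odd_transform (grad_mx f) (cube_rank x) (cube_rank x)).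
  by apply/funext => x; exact: laplacian_pow_half.
rewrite snormZ cabs_real ger0_norm ?invr_ge0 ?(ltW g0)//.
have g1 : 0 <= (Gamma (1 - 2^-1 : R))^-1 by rewrite invr_ge0 ltW.
apply: le_trans (ler_wpM2l g1 (le_trans (snorm_diag_le E _) (CE_norm_odd_transform E _))) _.
have f1 (a b c d : R) : a != 0 -> a^-1 * (b * (2^-1 * c * d)) = (2 * a)^-1 * (b * (c * d)).
  by move=> a0; field; rewrite a0.
have f2 (a b c d : R) : b / a * c * d = a^-1 * (b * (c * d)) by ring.
rewrite /H_const; set h := fine (H_norm E); set G := snormR E _.
have h0 : 0 <= h by apply: fine_ge0; exact: H_norm_ge0.
apply: le_trans (ler_wpM2l g1 (ler_wpM2l h0 (CE_norm_grad_mx f EK))) _; rewrite -/G.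
have KG : 0 <= K * G.
  have : 0 <= 2^-1 * K * G := le_trans (CE_norm_ge0 E _) (CE_norm_grad_mx f EK).
  by rewrite -mulrA pmulr_rge0.
set r := Num.sqrt (2 * pi : R); set g := Gamma _ in g0 g1 *.
have r0 : 0 < r by rewrite sqrtr_gt0 mulr_gt0// pi_gt0.
have rg : r <= 2 * g.
  (* The lower bound sqrt 2 for Gamma(1/2) suffices, because pi <= 4. *)
  apply: (@le_trans _ _ (2 * Num.sqrt 2)); last by rewrite ler_pM2l// sqrt2_le_Gamma_half.
  rewrite -(@ler_pXn2r _ 2) ?nnegrE ?(ltW r0) ?mulr_ge0 ?sqrtr_ge0//.
  rewrite exprMn !sqr_sqrtr ?mulr_ge0 ?pi_ge0//.
  have := @pihalf_lt2 R; lra.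
rewrite f1 ?gt_eqF// f2.
by apply: ler_wpM2r; [exact: mulr_ge0|rewrite lef_pV2 ?posrE// mulr_gt0].
Qed.

End SquareRoot.

Local Close Scope complex_scope.
Local Close Scope sesquilinear_scope.

Theorem theorem1p1 (R : realType) :
  exists C : R, 0 < C /\
  forall (n : nat), (0 < n)%N ->
  forall (E : symmetric_space R n) (K : R), admissible_constant C E K ->
  [/\ (forall (phi : R -> R[i]) (f : cube n -> R[i]),
        cintegrable mu `[0%R, pi / 2] phi ->
        E (fun x => cintegral mu `[0%R, pi / 2]
             (fun t => phi t * cderive (fun s => cos_laplacian s f x) t))
        <= 2^-1 * K * snormR E (grad_abs f)
             * \int[mu]_(t in `[0%R, pi / 2]) cabs (phi t)),
      (forall f : cube n -> R[i],
        E (fun x => f x - mean f) <= pi / 4 * K * snormR E (grad_abs f)),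
      (forall (theta0 : R) (f : cube n -> R[i]), 0 <= theta0 < pi / 2 ->
        E (fun x => f x - cos_laplacian theta0 f x)
        <= 2^-1 * theta0 * K * snormR E (grad_abs f)),
      (forall (a : R) (f : cube n -> R[i]), 0 < a < 2^-1 ->
        E (laplacian_pow a f) <= K_alpha a * K * snormR E (grad_abs f))
    & (UMD (CE_norm E) ->
        H_norm E \is a fin_num /\
        forall f : cube n -> R[i],
          E (laplacian_pow 2^-1 f) <= H_const E * K * snormR E (grad_abs f))].
Proof.
exists 6; split => //; case=> [//|n] _ E K EK; split.
- by move=> phi f; exact: snorm_heat_integral.
- move=> f; have h := snorm_sub_cos_laplacian EK f (divr_ge0 (pi_ge0 R) (ler0n R 2)).
  have -> : pi / 4 * K * snormR E (grad_abs f) = 2^-1 * (pi / 2) * K * snormR E (grad_abs f).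
    by field.
  have -> : (fun x => f x - mean f) = (fun x => f x - cos_laplacian (pi / 2) f x).
    by apply/funext => x; rewrite cos_laplacian_pi2.
  exact: h.
- by move=> theta f /andP[t0 _]; exact: snorm_sub_cos_laplacian.
- by move=> a f; exact: snorm_laplacian_pow.
- by move=> _; split; [exact: H_norm_fin_num|exact: snorm_laplacian_sqrt].
Qed.
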